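(* For the braid representative $\sigma_1^{-2}\sigma_2\sigma_1^{-1}\sigma_2$ of the Whitehead link, the Poincaré series of $\overline{\mathrm{HHH}}$ is $$\overline{\mathscr P(A,Q,T)}=TQ^{-1}+T^2Q^{-3}+A\Big(T^{-1}Q^{-1}+Q^{-3}+\frac{Q^{-3}}{1-Q^2}+TQ^{-5}+T^2Q^{-7}\Big)+A^2\Big(T^{-1}Q^{-5}+\frac{Q^{-7}}{1-Q^2}\Big).$$
   Context: Let $\mathbf k$ be a field of characteristic $0$ and $S_3=\langle s,t\mid s^2=t^2=(st)^3=e\rangle$. Let $R=\mathbf k[\alpha_s,\alpha_t]$, the symmetric algebra on $V^*=\mathbf k\alpha_s\oplus\mathbf k\alpha_t$, with $\alpha_s,\alpha_t$ in degree $2$, and with $S_3$ acting by $s(\alpha_s)=-\alpha_s$, $s(\alpha_t)=\alpha_s+\alpha_t$, $t(\alpha_t)=-\alpha_t$, $t(\alpha_s)=\alpha_s+\alpha_t$. Put $R^e=R\otimes_{\mathbf k}R$; graded $R^e$-modules are graded $R$-bimodules. Grading shift: $M(1)_d=M_{d+1}$. For $u\in\{s,t\}$ let $B_u=R\otimes_{R^u}R(1)$. Rouquier complexes: $F_u=[B_u\to R(1)]$ with $B_u$ in cohomological degree $0$ and differential the multiplication map; $F_u^{-1}=[R(-1)\to B_u]$ with $B_u$ in cohomological degree $0$ and differential $1\mapsto\tfrac12(\alpha_u\otimes1+1\otimes\alpha_u)$. To the $3$-strand braid $\sigma_1^{-2}\sigma_2\sigma_1^{-1}\sigma_2$ one associates,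 with $\sigma_1\leftrightarrow s$, $\sigma_2\leftrightarrow t$, the complex $W^\bullet=F_s^{-1}\otimes_RF_s^{-1}\otimes_RF_t\otimes_RF_s^{-1}\otimes_RF_t$. For a graded bimodule $M$, $\mathrm{HH}^a(M)=\mathrm{Ext}^a_{R^e}(R,M)$ is graded with degree $d$ part $\mathrm{Ext}^a_{R^e\text{-gmod}}(R,M(d))$. $\overline{\mathrm{HHH}}$ is obtained by applying $\mathrm{HH}^a$ termwise to the complex $W^\bullet$ and taking cohomology: $\overline{\mathrm{HHH}}^{a,i,d}=H^i(\mathrm{HH}^a(W^\bullet))_d$, where $i$ is the cohomological degree in the complex and $d$ is the internal degree. Its Poincaré series is $\sum_{a,i,d}A^aT^iQ^d\dim_{\mathbf k}\overline{\mathrm{HHH}}^{a,i,d}$, where $\frac1{1-Q^2}$ is expanded as $\sum_{n\ge0}Q^{2n}$. *)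

(* Defs.v *)
From HB Require Import structures.
From mathcomp Require Import all_boot all_order all_algebra.
From mathcomp Require Import generic_quotient ring_quotient.
From mathcomp Require Import boolp functions.
From mathcomp Require Import freeg mpoly.

Set Implicit Arguments.
Unset Strict Implicit.
Unset Printing Implicit Defensive.

Import GRing.Theory.
Local Open Scope ring_scope.

(* 'X_0 = alpha_s and 'X_1 = alpha_t.  They have internal degree 2, so the    *)
(* internal degree of a monomial m is twice its mdeg.                         *)
Notation polyR k := {mpoly k[2]}.

(* An R^e-module is a k-space with two commuting actions of the k-algebra R;  *)
(* k-bilinearity of both actions expresses that k acts centrally.             *)
Record bimod (k : fieldType) := Bimod {
  bmod :> lmodType k;
  lact : polyR k -> bmod -> bmod;
  ract : bmod -> polyR k -> bmod;
  lact_linl : forall x, linear (lact^~ x);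
  lact_linr : forall p, linear (lact p);
  ract_linl : forall p, linear (ract^~ p);
  ract_linr : forall x, linear (ract x);
  lact1 : forall x, lact 1 x = x;
  lactM : forall p q x, lact (p * q) x = lact p (lact q x);
  ract1 : forall x, ract x 1 = x;
  ractM : forall x p q, ract x (p * q) = ract (ract x p) q;
  lractC : forall p x q, lact p (ract x q) = ract (lact p x) q
}.

Definition is_bihom (k : fieldType) (M N : bimod k) (f : M -> N) : Prop :=
  [/\ linear f, forall p x, f (lact p x) = lact p (f x)
    & forall x p, f (ract x p) = ract (f x) p].

Inductive lspan (k : fieldType) (V : lmodType k) (S : V -> Prop) : V -> Prop :=
| lspan0 : lspan S 0
| lspanD c x y : S x -> lspan S y -> lspan S (c *: x + y).

Section LinearFacts.
Variables (k : fieldType).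

Lemma linD (U V : lmodType k) (f : U -> V) : linear f ->
  forall x y, f (x + y) = f x + f y.
Proof. by move=> lf x y; have := lf 1 x y; rewrite !scale1r. Qed.

Lemma lin0 (U V : lmodType k) (f : U -> V) : linear f -> f 0 = 0.
Proof.
by move=> lf; have := lf (-1) 0 0; rewrite !scaleN1r !addNr.
Qed.

Lemma linZ (U V : lmodType k) (f : U -> V) : linear f ->
  forall c x, f (c *: x) = c *: f x.
Proof. by move=> lf c x; rewrite -[c *: x]addr0 lf lin0 // addr0. Qed.

Lemma linN (U V : lmodType k) (f : U -> V) : linear f ->
  forall x, f (- x) = - f x.
Proof. by move=> lf x; rewrite -scaleN1r linZ // scaleN1r. Qed.

Lemma lspanP (V : lmodType k) (S : V -> Prop) c x y :
  lspan S x -> lspan S y -> lspan S (c *: x + y).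
Proof.
move=> Sx Sy; elim: Sx => [|b z w Sz _ IH]; first by rewrite scaler0 add0r.
by rewrite scalerDr scalerA -addrA; apply: lspanD.
Qed.

Lemma lspan_incl (V : lmodType k) (S : V -> Prop) x : S x -> lspan S x.
Proof.
by move=> Sx; rewrite -[x]addr0 -[x]scale1r; apply: lspanD => //; apply: lspan0.
Qed.

Lemma lspan_map (U V : lmodType k) (S : U -> Prop) (T : V -> Prop) (f : U -> V) :
  linear f -> (forall c x y, T x -> T y -> T (c *: x + y)) -> T 0 ->
  (forall x, S x -> T (f x)) -> forall x, lspan S x -> T (f x).
Proof.
move=> lf TD T0 ST x; elim=> [|c y z Sy _ IH]; first by rewrite lin0.
by rewrite lf; apply: TD => //; apply: ST.
Qed.

End LinearFacts.

(* M (x)_A N for a set A of scalars of R (a subring in every use below):      *)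
(* the free k-space on M * N modulo bilinearity and (m a) (x) n = m (x) (a n) *)
(* for a in A.                                                                *)
Section Tensor.
Variables (k : fieldType) (A : polyR k -> Prop) (M N : bimod k).

Notation FG := {freeg (M * N)%type / k}.

Inductive tens_rel : FG -> Prop :=
| tens_rel_linl c m m' n :
    tens_rel (<< (c *: m + m', n) >> - (c *: << (m, n) >> + << (m', n) >>))
| tens_rel_linr c m n n' :
    tens_rel (<< (m, c *: n + n') >> - (c *: << (m, n) >> + << (m, n') >>))
| tens_rel_bal m a n : A a ->
    tens_rel (<< (ract m a, n) >> - << (m, lact a n) >>)
| tens_rel0 : tens_rel 0
| tens_relP c x y : tens_rel x -> tens_rel y -> tens_rel (c *: x + y).

Definition tens_null : {pred FG} := fun x => `[< tens_rel x >].

Lemma tens_nullP x : reflect (tens_rel x) (x \in tens_null).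
Proof. exact: asboolP. Qed.

Lemma tens_null_zmod : zmod_closed tens_null.
Proof.
split=> [|x y /tens_nullP rx /tens_nullP ry]; apply/tens_nullP.
  exact: tens_rel0.
by rewrite addrC -scaleN1r; apply: tens_relP.
Qed.

HB.instance Definition _ := GRing.isZmodClosed.Build FG tens_null tens_null_zmod.

Definition tens : Type := Quotient.quot (tens_null : zmodClosed FG).
HB.instance Definition _ := GRing.Zmodule.on tens.

Definition tpi (x : FG) : tens := \pi_(Quotient.quot (tens_null : zmodClosed FG))%qT x.
Definition trepr (x : tens) : FG :=
  repr (x : Quotient.quot (tens_null : zmodClosed FG)).

Lemma treprK : cancel trepr tpi. Proof. exact: reprK. Qed.

Lemma tpiP x y : tpi x = tpi y <-> tens_rel (x - y).
Proof.
split=> [e|r].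
  by apply/tens_nullP; rewrite Quotient.idealrBE; apply/eqP.
by apply/eqP; rewrite -Quotient.idealrBE; apply/tens_nullP.
Qed.

Lemma tpiD x y : tpi (x + y) = tpi x + tpi y.
Proof. exact: (raddfD (\pi_(Quotient.quot (tens_null : zmodClosed FG))%qT)). Qed.

Definition tscale (c : k) (x : tens) : tens := tpi (c *: trepr x).

Lemma tpiZ c x : tpi (c *: x) = tscale c (tpi x).
Proof.
apply/tpiP; rewrite -scalerBr -[_ *: _]addr0; apply: tens_relP; last exact: tens_rel0.
by apply/tpiP; rewrite treprK.
Qed.

Lemma tscaleA a b x : tscale a (tscale b x) = tscale (a * b) x.
Proof. by rewrite -(treprK x) -!tpiZ scalerA. Qed.
Lemma tscale1 : left_id 1 tscale.
Proof. by move=> x; rewrite -(treprK x) -!tpiZ scale1r. Qed.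
Lemma tscaleDr : right_distributive tscale +%R.
Proof.
by move=> a x y; rewrite -(treprK x) -(treprK y) -tpiD -!tpiZ scalerDr tpiD.
Qed.
Lemma tscaleDl x : {morph tscale^~ x : a b / a + b}.
Proof. by move=> a b; rewrite -(treprK x) -!tpiZ scalerDl tpiD. Qed.

HB.instance Definition _ :=
  GRing.Zmodule_isLmodule.Build k tens tscaleA tscale1 tscaleDr tscaleDl.

Lemma tpi_lin : linear tpi.
Proof. by move=> c x y; rewrite tpiD tpiZ. Qed.

Definition pure (m : M) (n : N) : tens := tpi << (m, n) >>.

Definition balanced (T : lmodType k) (f : M -> N -> T) : Prop :=
  [/\ forall n, linear (f^~ n), forall m, linear (f m)
    & forall m a n, A a -> f (ract m a) n = f m (lact a n)].

Lemma pure_balanced : balanced pure.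
Proof.
split=> [n c m m'|m c n n'|m a n Aa]; rewrite /pure.
- by rewrite -tpi_lin; apply/tpiP; apply: tens_rel_linl.
- by rewrite -tpi_lin; apply/tpiP; apply: tens_rel_linr.
- by apply/tpiP; apply: tens_rel_bal.
Qed.

Lemma tens_ind (P : tens -> Prop) : P 0 -> (forall x y, P x -> P y -> P (x + y)) ->
  (forall m n, P (pure m n)) -> forall x, P x.
Proof.
move=> P0 PD Pp x; rewrite -(treprK x); move: (trepr x) => {x}.
apply: freeg_ind_dom0 => [|c [m n] D _ _ IH]; first by rewrite lin0 //; exact: tpi_lin.
rewrite tpiD; apply: PD => //.
have -> : << c *g (m, n) >> = c *: << (m, n) >> :> FG.
  by apply/eqP/freeg_eqP => z; rewrite coeffZ !coeffU mul1r.
case: pure_balanced => lin _ _.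
by rewrite (linZ tpi_lin); have := linZ (lin n) c m; rewrite /pure => <-; apply: Pp.
Qed.

Section Lift.
Variables (T : lmodType k) (f : M -> N -> T).

Definition tens_lift (x : tens) : T := fglift (fun mn => f mn.1 mn.2) (trepr x).

Hypothesis bal_f : balanced f.

Lemma fglift_lin : linear (fglift (R := k) (fun mn : M * N => f mn.1 mn.2)).
Proof.
set F := (fun mn => _) : M * N -> T.
have addF := lift_is_additive F.
have fD x y : fglift F (x + y) = fglift F x + fglift F y.
  have F0 : fglift F 0 = 0 by rewrite -(subrr (0 : FG)) addF subrr.
  have FN z : fglift F (- z) = - fglift F z by rewrite -sub0r addF F0 sub0r.
  by rewrite -{1}[y]opprK addF FN opprK.
have F0 : fglift F 0 = 0 by rewrite -(subrr (0 : FG)) addF subrr.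
move=> c x y; rewrite fD; congr (_ + _).
move: x; apply: freeg_ind_dom0 => [|b z D _ _ IH]; first by rewrite scaler0 F0 scaler0.
rewrite scalerDr !fD IH scalerDr; congr (_ + _).
have -> : c *: << b *g z >> = << (c * b) *g z >> :> FG.
  by apply/eqP/freeg_eqP => w; rewrite coeffZ !coeffU mulrA.
by rewrite !liftU scalerA.
Qed.

Lemma tens_lift_tpi x : tens_lift (tpi x) = fglift (fun mn => f mn.1 mn.2) x.
Proof.
set F := fglift _; have lF : linear F by apply: fglift_lin.
have: tens_rel (trepr (tpi x) - x) by apply/tpiP; rewrite treprK.
suff H y : tens_rel y -> F y = 0.
  by move/H; rewrite (linD lF) (linN lF) => /subr0_eq.
have FU z : F << z >> = f z.1 z.2 by rewrite /F liftU scale1r.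
case: bal_f => ll lr lb; elim=> [c m m' n|c m n n'|m a n Aa||c {}x {}y _ hx _ hy].
- by rewrite (linD lF) (linN lF) lF !FU /= ll subrr.
- by rewrite (linD lF) (linN lF) lF !FU /= lr subrr.
- by rewrite (linD lF) (linN lF) !FU /= lb // subrr.
- exact: lin0.
- by rewrite lF hx hy scaler0 addr0.
Qed.

Lemma tens_lift_lin : linear tens_lift.
Proof.
move=> c x y; rewrite -(treprK x) -(treprK y) -tpi_lin !tens_lift_tpi.
exact: fglift_lin.
Qed.

Lemma tens_liftE m n : tens_lift (pure m n) = f m n.
Proof. by rewrite tens_lift_tpi liftU scale1r. Qed.

End Lift.
End Tensor.

(* Outer actions: p (m (x) n) q = (p m) (x) (n q). *)
Section TensorBimod.
Variables (k : fieldType) (A : polyR k -> Prop) (M N : bimod k).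

Lemma tens_lin_ext (T : lmodType k) (f g : tens A M N -> T) :
  linear f -> linear g -> (forall m n, f (pure A m n) = g (pure A m n)) -> f =1 g.
Proof.
move=> lf lg e; apply: tens_ind => [|x y hx hy|//]; first by rewrite !lin0.
by rewrite !linD // hx hy.
Qed.

Lemma balanced_map (M' N' : bimod k) (f : M -> M') (g : N -> N') :
  linear f -> (forall x p, f (ract x p) = ract (f x) p) ->
  linear g -> (forall p x, g (lact p x) = lact p (g x)) ->
  balanced A (fun m n => pure A (f m) (g n)).
Proof.
move=> lf fr lg gl; have [pl pr pb] := pure_balanced A M' N'.
split=> [n c x y|m c x y|m a n Aa]; first by rewrite lf (pl (g n)).
- by rewrite lg (pr (f m)).
- by rewrite fr gl pb.
Qed.

Definition tens_lact (p : polyR k) : tens A M N -> tens A M N :=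
  tens_lift (fun m n => pure A (lact p m) n).
Definition tens_ract (x : tens A M N) (p : polyR k) : tens A M N :=
  tens_lift (fun m n => pure A m (ract n p)) x.

Lemma tens_lact_bal p : balanced A (fun (m : M) (n : N) => pure A (lact p m) n).
Proof.
apply: (balanced_map (g := id)) => //; first exact: lact_linr.
by move=> x q; rewrite lractC.
Qed.

Lemma tens_ract_bal p : balanced A (fun (m : M) (n : N) => pure A m (ract n p)).
Proof.
apply: (balanced_map (f := id) (g := fun n => ract n p)) => //; first exact: ract_linl.
by move=> q x; rewrite lractC.
Qed.

Lemma tens_lactE p m n : tens_lact p (pure A m n) = pure A (lact p m) n.
Proof. exact: (tens_liftE (tens_lact_bal p)). Qed.
Lemma tens_ractE m n p : tens_ract (pure A m n) p = pure A m (ract n p).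
Proof. exact: (tens_liftE (tens_ract_bal p)). Qed.

Lemma tens_lact_linr p : linear (tens_lact p).
Proof. exact: (tens_lift_lin (tens_lact_bal p)). Qed.
Lemma tens_ract_linl p : linear (tens_ract^~ p).
Proof. exact: (tens_lift_lin (tens_ract_bal p)). Qed.

Lemma tens_lact_linl x : linear (tens_lact^~ x).
Proof.
move=> c p q; move: x; apply: tens_ind => [|x y hx hy|m n].
- by rewrite !(lin0 (tens_lact_linr _)) scaler0 addr0.
- by rewrite !(linD (tens_lact_linr _)) hx hy scalerDr addrACA.
by have [pl _ _] := pure_balanced A M N; rewrite !tens_lactE lact_linl (pl n).
Qed.

Lemma tens_ract_linr x : linear (tens_ract x).
Proof.
move=> c p q; move: x; apply: tens_ind => [|x y hx hy|m n].
- by rewrite !(lin0 (tens_ract_linl _)) scaler0 addr0.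
- by rewrite !(linD (tens_ract_linl _)) hx hy scalerDr addrACA.
by have [_ pr _] := pure_balanced A M N; rewrite !tens_ractE ract_linr (pr m).
Qed.

Lemma tens_lact1 x : tens_lact 1 x = x.
Proof.
move: x; apply: tens_ind => [|x y hx hy|m n]; first exact: (lin0 (tens_lact_linr _)).
  by rewrite (linD (tens_lact_linr _)) hx hy.
by rewrite tens_lactE lact1.
Qed.

Lemma tens_ract1 x : tens_ract x 1 = x.
Proof.
move: x; apply: tens_ind => [|x y hx hy|m n]; first exact: (lin0 (tens_ract_linl _)).
  by rewrite (linD (tens_ract_linl _)) hx hy.
by rewrite tens_ractE ract1.
Qed.

Lemma tens_lactM p q x : tens_lact (p * q) x = tens_lact p (tens_lact q x).
Proof.
move: x; apply: tens_ind => [|x y hx hy|m n].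
- by rewrite !(lin0 (tens_lact_linr _)).
- by rewrite !(linD (tens_lact_linr _)) hx hy.
by rewrite !tens_lactE lactM.
Qed.

Lemma tens_ractM x p q : tens_ract x (p * q) = tens_ract (tens_ract x p) q.
Proof.
move: x; apply: tens_ind => [|x y hx hy|m n].
- by rewrite !(lin0 (tens_ract_linl _)).
- by rewrite !(linD (tens_ract_linl _)) hx hy.
by rewrite !tens_ractE ractM.
Qed.

Lemma tens_lractC p x q : tens_lact p (tens_ract x q) = tens_ract (tens_lact p x) q.
Proof.
move: x; apply: tens_ind => [|x y hx hy|m n].
- by rewrite (lin0 (tens_ract_linl _)) !(lin0 (tens_lact_linr _)) (lin0 (tens_ract_linl _)).
- by rewrite !(linD (tens_ract_linl _), linD (tens_lact_linr _)) hx hy.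
by rewrite tens_lactE !tens_ractE tens_lactE.
Qed.

Definition tensor : bimod k :=
  Bimod tens_lact_linl tens_lact_linr tens_ract_linl tens_ract_linr
        tens_lact1 tens_lactM tens_ract1 tens_ractM tens_lractC.

End TensorBimod.

Section Bimodules.
Variable k : fieldType.
Implicit Types M N : bimod k.

Fact mul_linl (x : polyR k) : linear (fun p : polyR k => p * x).
Proof. by move=> c p q; rewrite mulrDl scalerAl. Qed.
Fact mul_linr (p : polyR k) : linear (fun x : polyR k => p * x).
Proof. by move=> c x y; rewrite mulrDr scalerAr. Qed.

Definition regular_bimod : bimod k :=
  @Bimod k (polyR k) *%R *%R mul_linl mul_linr mul_linl mul_linr
    (@mul1r _) (fun p q x => esym (mulrA p q x)) (@mulr1 _) (@mulrA _) (@mulrA _).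

Section DirectSum.
Variables M N : bimod k.
Notation S := (M * N)%type.
Definition dsum_lact (p : polyR k) (x : S) : S := (lact p x.1, lact p x.2).
Definition dsum_ract (x : S) (p : polyR k) : S := (ract x.1 p, ract x.2 p).
Fact dsum_lact_linl x : linear (dsum_lact^~ x).
Proof. by move=> c p q; congr pair; apply: lact_linl. Qed.
Fact dsum_lact_linr p : linear (dsum_lact p).
Proof. by move=> c x y; congr pair; apply: lact_linr. Qed.
Fact dsum_ract_linl p : linear (dsum_ract^~ p).
Proof. by move=> c x y; congr pair; apply: ract_linl. Qed.
Fact dsum_ract_linr x : linear (dsum_ract x).
Proof. by move=> c p q; congr pair; apply: ract_linr. Qed.
Fact dsum_lact1 x : dsum_lact 1 x = x.
Proof. by case: x => x y; rewrite /dsum_lact /= !lact1. Qed.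
Fact dsum_lactM p q x : dsum_lact (p * q) x = dsum_lact p (dsum_lact q x).
Proof. by rewrite /dsum_lact /= !lactM. Qed.
Fact dsum_ract1 x : dsum_ract x 1 = x.
Proof. by case: x => x y; rewrite /dsum_ract /= !ract1. Qed.
Fact dsum_ractM x p q : dsum_ract x (p * q) = dsum_ract (dsum_ract x p) q.
Proof. by rewrite /dsum_ract /= !ractM. Qed.
Fact dsum_lractC p x q : dsum_lact p (dsum_ract x q) = dsum_ract (dsum_lact p x) q.
Proof. by congr pair; apply: lractC. Qed.

Definition dsum : bimod k :=
  Bimod dsum_lact_linl dsum_lact_linr dsum_ract_linl dsum_ract_linr
        dsum_lact1 dsum_lactM dsum_ract1 dsum_ractM dsum_lractC.
End DirectSum.
End Bimodules.

(* A bimodule with a family of subspaces; [is_graded] says that the family is *)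
(* a grading.  The two are separated because [cterm] below is not graded on   *)
(* its whole carrier.                                                         *)
Record gbimod (k : fieldType) := GBimod {
  gbm :> bimod k;
  piece : int -> gbm -> Prop;
  piece0 : forall d, piece d 0;
  pieceP : forall d c x y, piece d x -> piece d y -> piece d (c *: x + y)
}.

Section Graded.
Variable k : fieldType.

Definition regular_piece (d : int) (p : polyR k) : Prop :=
  forall m : 'X_{1..2}, m \in msupp p -> (2 * mdeg m)%:Z = d.

Fact regular_piece0 d : regular_piece d 0.
Proof. by move=> m; rewrite msupp0. Qed.
Fact regular_pieceP d c p q :
  regular_piece d p -> regular_piece d q -> regular_piece d (c *: p + q).
Proof.
move=> hp hq m /msuppD_le; rewrite mem_cat => /orP[/msuppZ_le|]; first exact: hp.
exact: hq.
Qed.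

Lemma regular_pieceM d e p q :
  regular_piece d p -> regular_piece e q -> regular_piece (d + e) (p * q).
Proof.
move=> hp hq m /msuppM_le /allpairsP[[m1 m2] /= [/hp <- /hq <- ->]].
by rewrite mdegD mulnDr PoszD.
Qed.

Lemma regular_pieceX (i : 'I_2) : regular_piece 2 'X_i.
Proof. by move=> m /mem_msuppXP <-; rewrite mdeg1. Qed.

Lemma regular_piece1 : regular_piece 0 1.
Proof. by move=> m; rewrite msupp1 inE => /eqP ->; rewrite mdeg0. Qed.

Definition regular : gbimod k :=
  @GBimod k (regular_bimod k) regular_piece regular_piece0 regular_pieceP.

Definition is_graded (M : gbimod k) : Prop :=
  [/\ forall d e p (x : M), regular_piece d p -> piece e x -> piece (d + e) (lact p x),
      forall d e p (x : M), regular_piece d p -> piece e x -> piece (d + e) (ract x p),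
      forall x : M, exists (s : seq int) (f : int -> M),
        (forall d, piece d (f d)) /\ x = \sum_(d <- s) f d
    & forall (s : seq int) (f : int -> M), uniq s -> (forall d, piece d (f d)) ->
        \sum_(d <- s) f d = 0 -> forall d, d \in s -> f d = 0].

(* M(n)_d = M_(d + n) *)
Definition gshift (n : int) (M : gbimod k) : gbimod k :=
  @GBimod k M (fun d => piece (d + n)) (fun d => @piece0 k M _) (fun d => @pieceP k M _).

Definition is_ghom (M N : gbimod k) (f : M -> N) : Prop :=
  is_bihom f /\ forall d x, piece d x -> piece d (f x).

Definition is_gprojective (P : gbimod k) : Prop :=
  forall (M N : gbimod k) (g : M -> N) (f : P -> N),
    is_graded M -> is_graded N -> is_ghom g -> is_ghom f ->
    (forall y, exists x, g x = y) ->
    exists2 h : P -> M, is_ghom h & forall x, g (h x) = f x.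

Section GTensor.
Variables (A : polyR k -> Prop) (M N : gbimod k).

Definition tensor_gen (d : int) (x : tens A M N) : Prop :=
  exists d1 d2 m n, [/\ d = d1 + d2, piece d1 m, piece d2 n & x = pure A m n].

Definition gtensor : gbimod k :=
  @GBimod k (tensor A M N) (fun d => lspan (tensor_gen d))
    (fun d => lspan0 _) (fun d => @lspanP k _ _).
End GTensor.
End Graded.

(* A complex of graded bimodules is given by its total bimodule, with         *)
(* [cpiece i d] the part in cohomological degree i and internal degree d.     *)
(* [csgn] is the operator (-1)^i in cohomological degree i, used for the      *)
(* Koszul sign in the tensor product.                                         *)
Record cplx (k : fieldType) := Cplx {
  cbm :> bimod k;
  cpiece : int -> int -> cbm -> Prop;
  cdiff : cbm -> cbm;
  csgn : cbm -> cbm;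
  cpiece0 : forall i d, cpiece i d 0;
  cpieceP : forall i d c x y,
    cpiece i d x -> cpiece i d y -> cpiece i d (c *: x + y);
  cdiff_bihom : is_bihom cdiff;
  csgn_bihom : is_bihom csgn;
  cdiff_piece : forall i d x, cpiece i d x -> cpiece (i + 1) d (cdiff x);
  csgn_piece : forall i d x, cpiece i d x -> csgn x = ((-1) ^ i : k) *: x;
  cdiffK : forall x, cdiff (cdiff x) = 0;
  csgnK : forall x, csgn (csgn x) = x;
  csgn_diff : forall x, csgn (cdiff x) = - cdiff (csgn x)
}.

(* The term of C in cohomological degree i, i.e. the graded bimodule          *)
(* \bigoplus_d [cpiece i d].  The carrier is all of C, but a graded map from  *)
(* a graded bimodule takes values in the part spanned by the pieces.          *)
Definition cterm (k : fieldType) (C : cplx k) (i : int) : gbimod k :=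
  @GBimod k C (@cpiece k C i) (@cpiece0 k C i) (@cpieceP k C i).

Section TwoTerm.
Variables (k : fieldType) (n : int) (X Y : gbimod k) (f : X -> Y).
Hypothesis hf : is_ghom f.

(* X -> Y with X in cohomological degree n *)
Definition two_piece (i d : int) (x : dsum X Y) : Prop :=
  (if i == n then piece d x.1 else x.1 = 0) /\
  (if i == n + 1 then piece d x.2 else x.2 = 0).
Definition two_diff (x : dsum X Y) : dsum X Y := (0, f x.1).
Definition two_sgn (x : dsum X Y) : dsum X Y :=
  ((-1) ^ n *: x.1, (-1) ^ (n + 1) *: x.2).

Let flin : linear f. Proof. by case: hf => -[]. Qed.

Fact two_piece0 i d : two_piece i d 0.
Proof. by split; case: ifP => // _; apply: piece0. Qed.
Fact two_pieceP i d c x y :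
  two_piece i d x -> two_piece i d y -> two_piece i d (c *: x + y).
Proof.
rewrite /two_piece /= => -[x1 x2] [y1 y2]; split; move: x1 x2 y1 y2;
  do 2!case: ifP => _; move=> hx1 hx2 hy1 hy2;
  by [apply: pieceP | rewrite hx1 hy1 scaler0 addr0 | rewrite hx2 hy2 scaler0 addr0].
Qed.
Fact two_diff_bihom : is_bihom two_diff.
Proof.
case: hf => -[lf fl fr] _; split=> [c x y|p x|x p]; congr pair.
- by rewrite /= scaler0 addr0.
- exact: lf.
- by rewrite (lin0 (lact_linr _)).
- exact: fl.
- by rewrite (lin0 (ract_linl _)).
- exact: fr.
Qed.
Fact two_sgn_bihom : is_bihom two_sgn.
Proof.
split=> [c x y|p x|x p]; congr pair.
1,2: by rewrite /= scalerDr !scalerA mulrC.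
1,2: by rewrite /= (linZ (lact_linr _)).
1,2: by rewrite /= (linZ (ract_linl _)).
Qed.
Fact two_diff_piece i d x : two_piece i d x -> two_piece (i + 1) d (two_diff x).
Proof.
case=> x1 x2; split=> /=; first by case: ifP => // _; apply: piece0.
rewrite (inj_eq (addIr 1)); move: x1; case: ifP => _; last by move=> ->; exact: lin0.
by case: hf => _ fd /fd.
Qed.
Fact two_sgn_piece i d x : two_piece i d x -> two_sgn x = ((-1) ^ i : k) *: x.
Proof.
case: x => a b [] /= ha hb; congr pair => /=.
  by move: ha; case: eqP => [-> //|_ ->]; rewrite !scaler0.
by move: hb; case: eqP => [-> //|_ ->]; rewrite !scaler0.
Qed.
Fact two_diffK x : two_diff (two_diff x) = 0.
Proof. by congr pair; apply: lin0. Qed.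
Lemma signzK (i : int) : (-1) ^ i * (-1) ^ i = 1 :> k.
Proof. by rewrite -expfzMl mulrNN mulr1 exp1rz. Qed.
Fact two_sgnK x : two_sgn (two_sgn x) = x.
Proof. by case: x => x y; congr pair; rewrite /= scalerA signzK scale1r. Qed.
Fact two_sgn_diff x : two_sgn (two_diff x) = - two_diff (two_sgn x).
Proof.
congr pair; first by rewrite /= scaler0 oppr0.
by rewrite /= (linZ flin) expfzDr ?oppr_eq0 ?oner_eq0 // expr1z mulrN1 scaleNr.
Qed.

Definition two_term : cplx k :=
  Cplx two_piece0 two_pieceP two_diff_bihom two_sgn_bihom two_diff_piece
       two_sgn_piece two_diffK two_sgnK two_sgn_diff.
End TwoTerm.

(* C (x)_R D, with differential d (x) 1 + (-1)^i (x) d *)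
Section CTensor.
Variables (k : fieldType) (C D : cplx k).
Notation A := (fun _ : polyR k => True).
Notation T := (tensor A C D).

Definition ctens_gen (i d : int) (x : T) : Prop :=
  exists i1 i2 d1 d2 (m : C) (n : D),
    [/\ i = i1 + i2, d = d1 + d2, cpiece i1 d1 m, cpiece i2 d2 n & x = pure A m n].
Definition ctens_piece (i d : int) : T -> Prop := lspan (ctens_gen i d).
Definition ctens_diff : T -> T :=
  tens_lift (fun (m : C) (n : D) => pure A (cdiff m) n + pure A (csgn m) (cdiff n)).
Definition ctens_sgn : T -> T :=
  tens_lift (fun (m : C) (n : D) => pure A (csgn m) (csgn n)).

Fact ctens_diff_bal :
  balanced A (fun (m : C) (n : D) => pure A (cdiff m) n + pure A (csgn m) (cdiff n)).
Proof.
have [dl1 dl2 dl3] := cdiff_bihom C; have [dr1 dr2 dr3] := cdiff_bihom D.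
have [sl1 sl2 sl3] := csgn_bihom C.
have [al ar ab] : balanced A (fun (m : C) (n : D) => pure A (cdiff m) n).
  exact: (@balanced_map k A C D C D (@cdiff k C) id).
have [bl br bb] : balanced A (fun (m : C) (n : D) => pure A (csgn m) (cdiff n)).
  exact: (@balanced_map k A C D C D (@csgn k C) (@cdiff k D)).
split=> [n c x y|m c x y|m a n _]; last by rewrite ab // bb.
  by rewrite (al n) (bl n) scalerDr addrACA.
by rewrite (ar m) (br m) scalerDr addrACA.
Qed.
Fact ctens_sgn_bal : balanced A (fun (m : C) (n : D) => pure A (csgn m) (csgn n)).
Proof.
have [sl1 sl2 sl3] := csgn_bihom C; have [sr1 sr2 sr3] := csgn_bihom D.
exact: (@balanced_map k A C D C D (@csgn k C) (@csgn k D)).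
Qed.

Lemma ctens_diffE m n :
  ctens_diff (pure A m n) = pure A (cdiff m) n + pure A (csgn m) (cdiff n).
Proof. exact: (tens_liftE ctens_diff_bal). Qed.
Lemma ctens_sgnE m n : ctens_sgn (pure A m n) = pure A (csgn m) (csgn n).
Proof. exact: (tens_liftE ctens_sgn_bal). Qed.

Let dlin : linear ctens_diff. Proof. exact: (tens_lift_lin ctens_diff_bal). Qed.
Let slin : linear ctens_sgn. Proof. exact: (tens_lift_lin ctens_sgn_bal). Qed.

Fact ctens_piece0 i d : ctens_piece i d 0. Proof. exact: lspan0. Qed.
Fact ctens_pieceP i d c x y :
  ctens_piece i d x -> ctens_piece i d y -> ctens_piece i d (c *: x + y).
Proof. exact: lspanP. Qed.

Fact ctens_diff_bihom : is_bihom ctens_diff.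
Proof.
have [_ dl2 _] := cdiff_bihom C; have [_ _ dr3] := cdiff_bihom D.
have [_ sl2 _] := csgn_bihom C.
have ll p : linear (lact (b := T) p) by exact: lact_linr.
have rl p : linear ((@ract _ T)^~ p) by exact: ract_linl.
split=> // [p|x p].
  apply: tens_lin_ext => [c x y|c x y|m n]; rewrite ?ll ?dlin ?ll //.
  by rewrite /= tens_lactE !ctens_diffE (linD (tens_lact_linr p)) !tens_lactE dl2 sl2.
move: x; apply: tens_lin_ext => [c x y|c x y|m n]; rewrite ?rl ?dlin ?rl //.
by rewrite /= tens_ractE !ctens_diffE (linD (tens_ract_linl p)) !tens_ractE dr3.
Qed.

Fact ctens_sgn_bihom : is_bihom ctens_sgn.
Proof.
have [_ sl2 _] := csgn_bihom C; have [_ _ sr3] := csgn_bihom D.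
have ll p : linear (lact (b := T) p) by exact: lact_linr.
have rl p : linear ((@ract _ T)^~ p) by exact: ract_linl.
split=> // [p|x p].
  apply: tens_lin_ext => [c x y|c x y|m n]; rewrite ?ll ?slin ?ll //.
  by rewrite /= tens_lactE !ctens_sgnE /= !tens_lactE sl2.
move: x; apply: tens_lin_ext => [c x y|c x y|m n]; rewrite ?rl ?slin ?rl //.
by rewrite /= tens_ractE !ctens_sgnE /= !tens_ractE sr3.
Qed.

Fact csgn_cpiece (B : cplx k) i d (x : B) : cpiece i d x -> cpiece i d (csgn x).
Proof.
move=> hx; rewrite (csgn_piece hx) -[_ *: _]addr0.
by apply: cpieceP => //; apply: cpiece0.
Qed.

Fact ctens_diff_piece i d x : ctens_piece i d x -> ctens_piece (i + 1) d (ctens_diff x).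
Proof.
apply: (lspan_map dlin); [by move=> *; apply: lspanP | exact: lspan0 |].
move=> _ [i1 [i2 [d1 [d2 [m [n [-> -> hm hn ->]]]]]]].
rewrite ctens_diffE -[pure _ (cdiff m) n]scale1r; apply: lspanP; apply: lspan_incl.
  exists (i1 + 1), i2, d1, d2, (cdiff m), n; split=> //; first by rewrite addrAC.
  exact: cdiff_piece.
exists i1, (i2 + 1), d1, d2, (csgn m), (cdiff n); split=> //; first by rewrite addrA.
  exact: csgn_cpiece.
exact: cdiff_piece.
Qed.

Fact ctens_sgn_piece i d x : ctens_piece i d x -> ctens_sgn x = ((-1) ^ i : k) *: x.
Proof.
elim=> [|c {}x y [i1 [i2 [d1 [d2 [m [n [ei _ hm hn ->]]]]]]] _ IH].
  by rewrite scaler0 (lin0 slin).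
rewrite slin IH scalerDr ctens_sgnE; congr (_ + _).
rewrite (csgn_piece hm) (csgn_piece hn) ei expfzDr ?oppr_eq0 ?oner_eq0 //.
have [pl pr _] := pure_balanced A C D.
by rewrite (linZ (pl _)) (linZ (pr _)) !scalerA mulrC.
Qed.

Fact ctens_diffK x : ctens_diff (ctens_diff x) = 0.
Proof.
have [dl1 _ _] := cdiff_bihom C; have [dr1 _ _] := cdiff_bihom D.
have [pl pr _] := pure_balanced A C D.
move: x; apply: tens_ind => [|x y hx hy|m n]; first by rewrite !(lin0 dlin).
  by rewrite !(linD dlin) hx hy addr0.
rewrite ctens_diffE (linD dlin) !ctens_diffE !cdiffK csgnK.
rewrite (lin0 (pl n)) add0r (lin0 (pr _)) addr0 csgn_diff (linN (pl _)).
exact: addNr.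
Qed.

Fact ctens_sgnK x : ctens_sgn (ctens_sgn x) = x.
Proof.
move: x; apply: tens_ind => [|x y hx hy|m n]; first by rewrite !(lin0 slin).
  by rewrite !(linD slin) hx hy.
by rewrite !ctens_sgnE !csgnK.
Qed.

Fact ctens_sgn_diff x : ctens_sgn (ctens_diff x) = - ctens_diff (ctens_sgn x).
Proof.
have [pl pr _] := pure_balanced A C D.
move: x; apply: tens_ind => [|x y hx hy|m n].
- by rewrite (lin0 dlin) (lin0 slin) (lin0 dlin) oppr0.
- by rewrite !(linD dlin, linD slin) hx hy opprD.
rewrite ctens_diffE ctens_sgnE (linD slin) !ctens_sgnE ctens_diffE !csgn_diff.
by rewrite (linN (pl _)) (linN (pr _)) opprD.
Qed.

Definition ctensor : cplx k :=
  Cplx ctens_piece0 ctens_pieceP ctens_diff_bihom ctens_sgn_bihom ctens_diff_piece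
       ctens_sgn_piece ctens_diffK ctens_sgnK ctens_sgn_diff.
End CTensor.

Section Rouquier.
Variable k : fieldType.

(* The action on R of the simple reflections of S_3, s = 0 and t = 1 in 'I_2; *)
(* R^u is the ring of invariants of the reflection u.                         *)
Definition reflection (u : 'I_2) (p : polyR k) : polyR k :=
  p \mPo [tuple (if v == u then - 'X_u else 'X_u + 'X_v : polyR k) | v < 2].
Definition invariant (u : 'I_2) (p : polyR k) : Prop := reflection u p = p.

(* B_u = R (x)_(R^u) R(1) *)
Definition bs (u : 'I_2) : gbimod k :=
  gtensor (invariant u) (regular k) (gshift 1 (regular k)).

Notation "p '*o[' u ] q" :=
  (pure (M := regular k) (N := regular k) (invariant u) p q) (at level 40).

Definition bs_mult (u : 'I_2) : bs u -> gshift 1 (regular k) :=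
  tens_lift (M := regular k) (N := regular k) (fun p q => p * q : polyR k).

Fact bs_mult_bal (u : 'I_2) :
  balanced (M := regular k) (N := regular k) (invariant u)
    (fun p q => p * q : polyR k).
Proof.
split=> [q|p|p a q _]; [exact: mul_linl | exact: mul_linr |].
by rewrite /= mulrA.
Qed.

Fact bs_mult_ghom u : is_ghom (@bs_mult u).
Proof.
have lm : linear (@bs_mult u) by exact: (tens_lift_lin (bs_mult_bal u)).
have mE p q : bs_mult (p *o[u] q) = p * q by exact: (tens_liftE (bs_mult_bal u)).
have ll p : linear (lact (b := bs u) p) by exact: lact_linr.
have rl p : linear ((@ract _ (bs u))^~ p) by exact: ract_linl.
split; first split=> // [p|x p].
- apply: tens_lin_ext => [c x y|c x y|m n].
  + by rewrite ll lm.
  + by rewrite lm lact_linr.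
  by rewrite /= tens_lactE !mE /= mulrA.
- move: x; apply: tens_lin_ext => [c x y|c x y|m n].
  + by rewrite rl lm.
  + by rewrite lm (ract_linl (b := regular k)).
  by rewrite /= tens_ractE !mE /= mulrA.
move=> d; apply: (lspan_map lm).
- by move=> c x y; apply: (@pieceP k (gshift 1 (regular k)) d).
- exact: (@piece0 k (gshift 1 (regular k)) d).
move=> _ [d1 [d2 [p [q [-> hp hq ->]]]]]; rewrite mE /= -addrA.
exact: regular_pieceM.
Qed.

(* The image of 1 under R(-1) -> B_u; it is central ([bs_unit_central]), so    *)
(* left multiples of it define a bimodule map.                                *)
Definition bs_unit (u : 'I_2) : bs u :=
  2^-1 *: ('X_u *o[u] 1 + 1 *o[u] 'X_u).

Definition bs_comult (u : 'I_2) (p : gshift (-1) (regular k)) : bs u :=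
  lact (b := bs u) p (bs_unit u).

Lemma reflection_central u (g : polyR k) : invariant u g ->
  forall x y : polyR k, (x * g) *o[u] y = x *o[u] (g * y).
Proof.
move=> hg x y; have [_ _ pb] := pure_balanced (invariant u) (regular k) (regular k).
exact: (pb x g y hg).
Qed.

Lemma reflection_inv1 u v : v != u -> (2 : k) != 0 ->
  invariant u ('X_v + 2^-1 *: 'X_u).
Proof.
move=> nvu n2; rewrite /invariant /reflection comp_mpolyD comp_mpolyZ.
rewrite !comp_mpolyXU -!tnth_nth !tnth_mktuple (negbTE nvu) eqxx.
rewrite scalerN addrAC -{1}['X_u]scale1r -scalerBl addrC; congr (_ + _ *: _).
by apply: (mulfI n2); rewrite mulrBr mulr1 mulfV // mulr2n addrK.
Qed.

Lemma reflection_inv2 u : invariant u ('X_u ^+ 2).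
Proof.
rewrite /invariant /reflection rmorphXn /=.
by rewrite comp_mpolyXU -tnth_nth tnth_mktuple eqxx sqrrN.
Qed.

Lemma central_gen (B : bimod k) (x : B) :
  (forall v, ract x 'X_v = lact 'X_v x) -> forall p, ract x p = lact p x.
Proof.
move=> hX; elim/mpolyind => [|c m q _ _ hq].
  by rewrite (lin0 (ract_linr x)) (lin0 (lact_linl x)).
rewrite ract_linr lact_linl hq; congr (_ *: _ + _).
rewrite mpolyXE_id; elim/big_rec: _ => [|i q' _ IH]; first by rewrite ract1 lact1.
elim: (m i) => [|e IHe]; first by rewrite expr0 mul1r.
by rewrite exprS -mulrA ractM lactM hX -lractC IHe.
Qed.

Fact bs_unit_central u p : ract (b := bs u) (bs_unit u) p = lact (b := bs u) p (bs_unit u).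
Proof.
have [n2|n2] := eqVneq (2 : k) 0.
  rewrite /bs_unit n2 invr0 scale0r.
  by rewrite (lin0 (ract_linl (b := bs u) p)) (lin0 (lact_linr (b := bs u) p)).
have [pl pr _] := pure_balanced (invariant u) (regular k) (regular k).
have rl q := ract_linl (b := bs u) q; have ll q := lact_linr (b := bs u) q.
have lr x := ract_linr (b := bs u) x; have lla x := lact_linl (b := bs u) x.
pose comm q := ract (b := bs u) (bs_unit u) q = lact (b := bs u) q (bs_unit u).
apply: central_gen p.
have comm_u : comm 'X_u.
  rewrite /comm /bs_unit (linZ (rl _)) (linZ (ll _)) (linD (rl _)) (linD (ll _)).
  rewrite /= !tens_lactE !tens_ractE /= mul1r mulr1 addrC; congr (_ *: (_ + _)).
  have := reflection_central (reflection_inv2 u) 1 1.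
  by rewrite mul1r mulr1 expr2 => ->.
have comm_inv g : invariant u g -> comm g.
  move=> hg; rewrite /comm /bs_unit (linZ (rl _)) (linZ (ll _)) (linD (rl _)) (linD (ll _)).
  rewrite /= !tens_lactE !tens_ractE /= mul1r mulr1.
  have e1 := reflection_central hg 'X_u 1; have e2 := reflection_central hg 1 'X_u.
  rewrite mulr1 in e1; rewrite mul1r in e2.
  by rewrite -e1 [_ * g]mulrC e2 [g * _]mulrC.
move=> v; have [->//|nvu] := eqVneq v u.
have -> : 'X_v = (- 2^-1) *: 'X_u + ('X_v + 2^-1 *: 'X_u) :> polyR k.
  by rewrite scaleNr addrCA addNr addr0.
rewrite lr lla comm_u; congr (_ + _).
exact/comm_inv/reflection_inv1.
Qed.

Fact bs_comult_ghom u : is_ghom (@bs_comult u).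
Proof.
split; first split.
- by move=> c p q; apply: (lact_linl (b := bs u)).
- by move=> p q; apply: (lactM (b := bs u)).
- move=> p q; rewrite /bs_comult -(lractC (b := bs u)) bs_unit_central.
  exact: (lactM (b := bs u)).
move=> d p hp; rewrite /bs_comult /bs_unit (linZ (lact_linr (b := bs u) _)).
rewrite (linD (lact_linr (b := bs u) _)) /= !tens_lactE /= mulr1 scalerDr.
apply: lspanD; last rewrite -[_ *: _]addr0; last apply: lspanD; last exact: lspan0.
  exists (d - 1 + 2), (-1), (p * 'X_u), 1; split=> //=.
  - by rewrite -!addrA addr0.
  - exact: (regular_pieceM hp (@regular_pieceX k u)).
  - by rewrite addNr; apply: regular_piece1.
exists (d - 1), 1, p, 'X_u; split=> //=; first by rewrite subrK.
exact: regular_pieceX.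
Qed.

Definition rouquier (u : 'I_2) : cplx k := two_term 0 (bs_mult_ghom u).
Definition rouquier_inv (u : 'I_2) : cplx k := two_term (-1) (bs_comult_ghom u).

(* sigma_1 = s = 0 and sigma_2 = t = 1 *)
Definition whitehead_cplx : cplx k :=
  let s : 'I_2 := 0 in let t : 'I_2 := 1 in
  ctensor (ctensor (ctensor (ctensor
    (rouquier_inv s) (rouquier_inv s)) (rouquier t)) (rouquier_inv s)) (rouquier t).
End Rouquier.

(* A subquotient [cyc] / [bdy] of a k-space V. *)
Record subquot (k : fieldType) (V : lmodType k) := Subquot {
  cyc : V -> Prop;
  bdy : V -> Prop
}.

Definition has_dim (k : fieldType) (V : lmodType k) (S : subquot V) (n : nat) : Prop :=
  exists2 e : 'I_n -> V, forall j, cyc S (e j)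
    & forall z, cyc S z ->
      exists! c : {ffun 'I_n -> k}, bdy S (z - \sum_j c j *: e j).

(* The cohomology at i of a complex of subquotients of V whose differential   *)
(* is induced by delta : V -> V.                                              *)
Definition cohomology (k : fieldType) (V : lmodType k) (S : int -> subquot V)
    (delta : V -> V) (i : int) : subquot V :=
  {| cyc := fun x => cyc (S i) x /\ bdy (S (i + 1)) (delta x);
     bdy := fun x => exists2 y, cyc (S (i - 1)) y & bdy (S i) (x - delta y) |}.

(* A projective resolution of M in the category of graded R^e-modules. *)
Record proj_resolution (k : fieldType) (M : gbimod k) := ProjResolution {
  rterm : nat -> gbimod k;
  rdiff : forall a, rterm a.+1 -> rterm a;
  raug : rterm 0 -> M;
  rterm_graded : forall a, is_graded (rterm a);
  rterm_projective : forall a, is_gprojective (rterm a);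
  rdiff_ghom : forall a, is_ghom (@rdiff a);
  raug_ghom : is_ghom raug;
  raug_surj : forall y, exists x, raug x = y;
  raug_exact : forall x, raug x = 0 <-> exists y, x = rdiff y;
  rdiff_exact : forall a (x : rterm a.+1), rdiff x = 0 <-> exists y, x = rdiff y
}.

Section HHH.
Variables (k : fieldType) (P : proj_resolution (regular k)).

Definition ext_bdy (M : gbimod k) (a : nat) : (rterm P a -> M) -> Prop :=
  match a return (rterm P a -> M) -> Prop with
  | 0 => fun f => forall x, f x = 0
  | b.+1 => fun f =>
      exists2 g : rterm P b -> M, is_ghom g & forall x, f x = g (rdiff x)
  end.

(* Ext^a(R, M) in graded R^e-modules, as a subquotient of the k-space of all  *)
(* functions from the a-th term of the resolution to M.                       *)
Definition ext (M : gbimod k) (a : nat) : subquot (rterm P a -> M) :=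
  {| cyc := fun f => is_ghom f /\ forall x : rterm P a.+1, f (rdiff x) = 0;
     bdy := @ext_bdy M a |}.

(* HH^a(M)_d = Ext^a(R, M(d)) *)
Definition HH (M : gbimod k) (a : nat) (d : int) : subquot (rterm P a -> M) :=
  ext (gshift d M) a.

Definition HHH (C : cplx k) (a : nat) (i d : int) : subquot (rterm P a -> C) :=
  cohomology (V := (rterm P a -> C : lmodType k))
    (fun j => HH (cterm C j) a d) (fun f x => cdiff (f x)) i.
End HHH.

(* [p a i d] is the coefficient of A^a T^i Q^d.  The first clause only says   *)
(* that the Ext groups exist; the second computes them from an arbitrary      *)
(* projective resolution.                                                     *)
Definition has_poincare_series (k : fieldType) (C : cplx k)
    (p : nat -> int -> int -> nat) : Prop :=
  inhabited (proj_resolution (regular k)) /\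
  forall (P : proj_resolution (regular k)) (a : nat) (i d : int),
    has_dim (HHH P C a i d) (p a i d).

(* The series A^a T^i Q^d, and A^a T^i Q^d / (1 - Q^2) expanded in powers     *)
(* Q^(d + 2n), n >= 0.                                                        *)
Definition mono (a : nat) (i d : int) : nat -> int -> int -> nat :=
  fun a' i' d' => nat_of_bool [&& a' == a, i' == i & d' == d].
Definition geom (a : nat) (i d : int) : nat -> int -> int -> nat :=
  fun a' i' d' =>
    nat_of_bool [&& a' == a, i' == i, d <= d' & (2 %| d' - d)%Z].

(* Main.v *)
Require Import Defs.
From HB Require Import structures.
From Stdlib Require Import BinNums.
From Stdlib Require BinPos BinInt QArith FMapPositive.
From mathcomp Require Import all_boot all_order all_algebra.
From mathcomp Require Import boolp functions.
From mathcomp Require Import freeg mpoly ssrZ.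

Set Implicit Arguments.
Unset Strict Implicit.
Unset Printing Implicit Defensive.

Import GRing.Theory.
Local Open Scope ring_scope.

(** The proof computes the cohomology of a double complex by Gaussian
    elimination and checks the outcome by evaluation.

    Resolutions.  Chain maps between two projective resolutions exist and are
    unique up to homotopy, so the answer is the same for all of them
    ([HHH_resolution_equiv]).  As an algebra R^e is polynomial in the left
    variables and the differences of right and left variables, and R is the
    quotient by the two differences; the Koszul complex on these is a
    resolution ([koszul]), and HH^a(M) becomes the cohomology of
    M -> M^2 -> M, whose maps are given by the commuting operators
    m |-> m alpha_v - alpha_v m ([koszul_HHH_equiv]).

    Coordinates.  Every p in R is uniquely dem0 p + alpha_u dem1 p with
    u-invariant coefficients, so B_u is free as a left R-module on 1 (x) 1 and
    1 (x) alpha_u.  Each Rouquier complex thus has left rank 3, and a tensor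
    product of such complexes is left free with words in these generators as
    a basis: a scalar between two letters moves to the left as a right
    multiplication on the letters before it.  The five-fold tensor product has
    rank 243, and its right multiplications and differential are matrices over
    R with rational coefficients ([tens_model], [whitehead_model]).  Together with the Koszul
    generators this is a double complex of free R-modules of rank
    4 * 243 = 972, with the Koszul map phi in the direction of a and D in the
    direction of i ([koszul_dbl_equiv]).

    Elimination.  The Hochschild cohomology of the Bott-Samelson bimodules in
    the complex is free over R, so cancelling pairs of generators joined by
    an invertible coefficient of phi leaves 264 generators on which phi
    vanishes.  The cohomology of the double complex is then that of the map
    induced by D on these 264 generators ([contract_equiv]).  Cancelling
    invertible coefficients again leaves 32 generators and a differential
    with linear coefficients.  After a change of basis it is a sum of seven
    Koszul complexes R -> R^2 -> R, each with cohomology k, and of two maps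
    R -> R given by alpha_s + alpha_t, each with cohomology
    R / (alpha_s + alpha_t), of series 1 / (1 - Q^2); [blocks] lists them
    ([block_homology_dim]).  They are the nine summands of the series.

    Nothing is proved about the elimination procedure.  It only supplies the
    maps of a deformation retraction, and the identities that these have to
    satisfy are equations between explicit matrices ([contraction_check],
    [homotopy_check]), which are evaluated ([certificateP]). *)

(** * Subquotients and kernels *)

Section Subspaces.
Variables (k : fieldType).

Definition subspace (V : lmodType k) (S : V -> Prop) : Prop :=
  S 0 /\ forall c x y, S x -> S y -> S (c *: x + y).

Lemma subspaceD (V : lmodType k) (S : V -> Prop) x y :
  subspace S -> S x -> S y -> S (x + y).
Proof. by case=> _ SP Sx Sy; rewrite -[x]scale1r; apply: SP. Qed.

Lemma subspaceN (V : lmodType k) (S : V -> Prop) x : subspace S -> S x -> S (- x).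
Proof. by case=> S0 SP Sx; rewrite -scaleN1r -[_ *: _]addr0; apply: SP. Qed.

Lemma subspaceB (V : lmodType k) (S : V -> Prop) x y :
  subspace S -> S x -> S y -> S (x - y).
Proof. by move=> Ss Sx Sy; apply: subspaceD => //; apply: subspaceN. Qed.

Lemma subspace_sum (V : lmodType k) (S : V -> Prop) (I : Type) (r : seq I)
    (c : I -> k) (F : I -> V) :
  subspace S -> (forall i, S (F i)) -> S (\sum_(i <- r) c i *: F i).
Proof.
move=> [S0 SP] SF; elim: r => [|i r IH]; first by rewrite big_nil.
by rewrite big_cons; apply: SP.
Qed.

Lemma lin_sum (U V : lmodType k) (f : U -> V) (I : Type) (r : seq I)
    (c : I -> k) (F : I -> U) : linear f ->
  f (\sum_(i <- r) c i *: F i) = \sum_(i <- r) c i *: f (F i).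
Proof.
move=> lf; elim: r => [|i r IH]; first by rewrite !big_nil lin0.
by rewrite !big_cons lf IH.
Qed.

Lemma lin_sub (U V : lmodType k) (f : U -> V) x y : linear f -> f (x - y) = f x - f y.
Proof. by move=> lf; rewrite linD // linN. Qed.

Lemma lin_bigsum (U V : lmodType k) (f : U -> V) (I : Type) (r : seq I) (F : I -> U) :
  linear f -> f (\sum_(i <- r) F i) = \sum_(i <- r) f (F i).
Proof.
move=> lf; elim: r => [|i r IH]; first by rewrite !big_nil lin0.
by rewrite !big_cons linD // IH.
Qed.

(** One half of an isomorphism of subquotients: F induces a map of quotients of
    which the map induced by G is a left inverse.  The conditions on G
    alone belong to the other half. *)
Record sq_inverse (U V : lmodType k) (S : subquot U) (T : subquot V)
    (F : U -> V) (G : V -> U) : Prop := SqInverse {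
  sqi_lin : linear F;
  sqi_cyc : forall x, cyc S x -> cyc T (F x);
  sqi_bdy : forall x, bdy S x -> bdy T (F x);
  sqi_homotopy : forall x, cyc S x -> bdy S (G (F x) - x)
}.

Definition sq_equiv (U V : lmodType k) (S : subquot U) (T : subquot V) : Prop :=
  [/\ subspace (bdy S), subspace (bdy T)
    & exists F G, sq_inverse S T F G /\ sq_inverse T S G F].

(** A basis modulo boundaries is transported back along G; its coordinates are
    read off after applying F. *)
Lemma has_dim_equiv (U V : lmodType k) (S : subquot U) (T : subquot V) n :
  sq_equiv S T -> has_dim T n -> has_dim S n.
Proof.
move=> [sS sT [F [G [[lF Fc Fb GF] [lG Gc Gb FG]]]]] [e eT eP].
exists (G \o e) => [j|z zS]; first exact: Gc.
have [c [cP cU]] := eP _ (Fc _ zS); exists c; split=> [|c'].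
  have := subspaceB sS (Gb _ cP) (GF _ zS).
  by rewrite lin_sub // lin_sum //= opprB addrC addrA subrK.
move=> /Fb; rewrite lin_sub // lin_sum // => h; apply: cU.
have sF : bdy T (\sum_j c' j *: (F (G (e j)) - e j)).
  by apply: subspace_sum => // j; apply: FG.
have := subspaceD sT h sF.
rewrite -addrA -sumrN -big_split /= => h2.
have E : \sum_j c' j *: e j = - \sum_j (- (c' j *: F (G (e j))) + c' j *: (F (G (e j)) - e j)).
  by rewrite -sumrN; apply: eq_bigr => j _; rewrite scalerBr addKr opprK.
by rewrite E opprK.
Qed.

End Subspaces.

Section Bihom.
Variables (k : fieldType).
Implicit Types M N L : gbimod k.

Lemma ghom_lin M N (f : M -> N) : is_ghom f -> linear f.
Proof. by case=> -[]. Qed.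

Lemma ghom_comp M N L (f : M -> N) (g : N -> L) :
  is_ghom f -> is_ghom g -> is_ghom (g \o f).
Proof.
move=> [[fl f2 f3] f4] [[gl g2 g3] g4]; split; first split=> /=.
- by move=> c x y /=; rewrite fl gl.
- by move=> p x /=; rewrite f2 g2.
- by move=> x p /=; rewrite f3 g3.
by move=> d x /f4/g4.
Qed.

Lemma ghom_id M : is_ghom (fun x : M => x).
Proof. by []. Qed.

Lemma ghomP M N (f g : M -> N) c : is_ghom f -> is_ghom g ->
  is_ghom (fun x => c *: f x + g x).
Proof.
move=> [[fl f2 f3] f4] [[gl g2 g3] g4]; split; first split=> /=.
- by move=> a x y /=; rewrite fl gl !scalerDr !scalerA addrACA [c * a]mulrC.
- by move=> p x /=; rewrite f2 g2 lact_linr.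
- by move=> x p /=; rewrite f3 g3 ract_linl.
by move=> d x hx; apply: pieceP; [apply: f4 | apply: g4].
Qed.

Lemma ghomB M N (f g : M -> N) : is_ghom f -> is_ghom g -> is_ghom (fun x => f x - g x).
Proof.
move=> hf hg; have := ghomP (-1) hg hf.
congr is_ghom; apply: funext => x; by rewrite scaleN1r addrC.
Qed.

Lemma ghom0 M N : is_ghom (fun _ : M => 0 : N).
Proof.
split; first split=> [c x y|p x|x p].
- by rewrite scaler0 addr0.
- by rewrite (lin0 (lact_linr _)).
- by rewrite (lin0 (ract_linl _)).
by move=> d x _; apply: piece0.
Qed.

(** Graded projectivity lifts through surjections only.  Factoring maps through
    the kernel of the next map, as a graded bimodule, turns exactness into a
    surjection. *)
Section Kernel.
Variables (M N : gbimod k) (f : M -> N).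
Hypothesis hf : is_ghom f.

Definition kerp : {pred M} := fun x => `[< f x = 0 >].
Lemma kerpP x : reflect (f x = 0) (x \in kerp).
Proof. exact: asboolP. Qed.
Lemma kerp_submod : submod_closed kerp.
Proof.
have lf := ghom_lin hf.
split=> [|c x y /kerpP hx /kerpP hy]; apply/kerpP; first exact: lin0.
by rewrite lf hx hy scaler0 addr0.
Qed.
HB.instance Definition _ := GRing.isSubmodClosed.Build k M kerp kerp_submod.
Definition kert := {x : M | x \in kerp}.
HB.instance Definition _ := SubChoice.on kert.
HB.instance Definition _ := [SubChoice_isSubLmodule of kert by <:].

Fact ker_lactP p (x : kert) : lact p (val x) \in kerp.
Proof.
have [[lf fl _] _] := hf; apply/kerpP; case: x => x /= /kerpP hx.
by rewrite fl hx (lin0 (lact_linr _)).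
Qed.
Fact ker_ractP (x : kert) p : ract (val x) p \in kerp.
Proof.
have [[lf _ fr] _] := hf; apply/kerpP; case: x => x /= /kerpP hx.
by rewrite fr hx (lin0 (ract_linl _)).
Qed.
Definition ker_lact p (x : kert) : kert := Sub (lact p (val x)) (ker_lactP p x).
Definition ker_ract (x : kert) p : kert := Sub (ract (val x) p) (ker_ractP x p).

Fact ker_lact_linl x : linear (ker_lact^~ x).
Proof. by move=> c p q; apply: val_inj; apply: lact_linl. Qed.
Fact ker_lact_linr p : linear (ker_lact p).
Proof. by move=> c x y; apply: val_inj; apply: lact_linr. Qed.
Fact ker_ract_linl p : linear (ker_ract^~ p).
Proof. by move=> c x y; apply: val_inj; apply: ract_linl. Qed.
Fact ker_ract_linr x : linear (ker_ract x).
Proof. by move=> c p q; apply: val_inj; apply: ract_linr. Qed.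
Fact ker_lact1 x : ker_lact 1 x = x.
Proof. by apply: val_inj; apply: lact1. Qed.
Fact ker_lactM p q x : ker_lact (p * q) x = ker_lact p (ker_lact q x).
Proof. by apply: val_inj; apply: lactM. Qed.
Fact ker_ract1 x : ker_ract x 1 = x.
Proof. by apply: val_inj; apply: ract1. Qed.
Fact ker_ractM x p q : ker_ract x (p * q) = ker_ract (ker_ract x p) q.
Proof. by apply: val_inj; apply: ractM. Qed.
Fact ker_lractC p x q : ker_lact p (ker_ract x q) = ker_ract (ker_lact p x) q.
Proof. by apply: val_inj; apply: lractC. Qed.

Definition ker_bimod : bimod k :=
  Bimod ker_lact_linl ker_lact_linr ker_ract_linl ker_ract_linr
        ker_lact1 ker_lactM ker_ract1 ker_ractM ker_lractC.

Definition kernel : gbimod k :=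
  @GBimod k ker_bimod (fun d x => piece d (val x : M))
    (fun d => @piece0 k M d) (fun d c x y => @pieceP k M d c (val x) (val y)).

Definition kernel_val (x : kernel) : M := val (x : kert).

Lemma kernel_val_ghom : is_ghom kernel_val. Proof. by []. Qed.

Lemma kernel_lift (P : gbimod k) (g : P -> M) : is_ghom g -> (forall x, f (g x) = 0) ->
  exists2 h : P -> kernel, is_ghom h & forall x, kernel_val (h x) = g x.
Proof.
move=> [[gl g2 g3] g4] fg.
exists (fun x => Sub (g x) (introT (kerpP _) (fg x)) : kert) => [|x]; last exact: SubK.
split; first split=> [c x y|p x|x p]; try by apply: val_inj; rewrite /= ?gl ?g2 ?g3.
by move=> d x; apply: g4.
Qed.

Lemma kernel_graded : is_graded M -> is_graded N -> is_graded kernel.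
Proof.
have [[lf fl fr] f4] := hf.
move=> [M1 M2 M3 M4] [_ _ _ N4]; split.
- by move=> d e p x hp hx; apply: (M1 d e p (val (x : kert))).
- by move=> d e p x hp hx; apply: (M2 d e p (val (x : kert))).
- move=> x; have [s [g [gP xE]]] := M3 (val (x : kert)).
  (* s may list a degree several times; exactness in each degree needs a
     decomposition over distinct degrees. *)
  pose u := undup s; pose g' d := (count_mem d s)%:R *: g d.
  have xE' : val (x : kert) = \sum_(d <- u) g' d.
    rewrite xE -big_undup_iterop_count; apply: eq_bigr => d _.
    by rewrite /g' scaler_nat.
  have gP' d : piece d (g' d) by rewrite /g' -[_ *: _]addr0; apply: pieceP => //; apply: piece0.
  have f0 d : d \in u -> f (g' d) = 0.
    apply: (N4 u (fun d => f (g' d))); first exact: undup_uniq.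
      by move=> e; apply: f4.
    rewrite -lin_bigsum // -xE'; case: (x : kert) => y; exact: kerpP.
  pose G d : kernel := if d \in u =P true is ReflectT h
    then Sub (g' d) (introT (kerpP _) (f0 d h)) : kert else 0.
  have GE d : d \in u -> kernel_val (G d) = g' d.
    by rewrite /G; case: eqP => // h _; rewrite /kernel_val SubK.
  exists u, G; split=> [d|].
    rewrite /G; case: eqP => h; last exact: piece0.
    by rewrite /= ?SubK; apply: gP'.
  apply: val_inj; rewrite xE'.
  have -> : val (\sum_(d <- u) G d : kert) = \sum_(d <- u) kernel_val (G d).
    by have [[lv _ _] _] := kernel_val_ghom; apply: (lin_bigsum _ _ lv).
  by rewrite !big_seq; apply: eq_bigr => d hd; rewrite GE.
move=> s g us gP g0 d ds; apply: val_inj.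
apply: (M4 s (fun d => val (g d : kert)) us gP _ d ds).
have [[lv _ _] _] := kernel_val_ghom.
by rewrite -(lin_bigsum s g lv) g0.
Qed.
End Kernel.
End Bihom.

(** The lifting step of the comparison theorem: a map into the cycles of an exact
    L -> M -> N lifts to L, because both L and P map to the kernel of d'. *)
Lemma projective_lift (k : fieldType) (P L M N : gbimod k) (d : L -> M) (d' : M -> N)
    (f : P -> M) :
  is_gprojective P -> is_graded L -> is_graded M -> is_graded N ->
  is_ghom d -> is_ghom d' -> is_ghom f ->
  (forall x, d' x = 0 <-> exists y, x = d y) -> (forall x, d' (f x) = 0) ->
  exists2 h : P -> L, is_ghom h & forall x, d (h x) = f x.
Proof.
move=> Pp gL gM gN hd hd' hf ex df.
have [f' hf' f'E] := kernel_lift hd' hf df.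
have dd y : d' (d y) = 0 by apply/ex; exists y.
have [e he eE] := kernel_lift hd' hd dd.
have [|h hh hE] := Pp _ _ e f' gL (kernel_graded hd' gM gN) he hf'.
  move=> y; have /ex[x xE] : d' (kernel_val y) = 0.
    by case: y => y hy; apply/(kerpP d').
  by exists x; apply: val_inj; rewrite [LHS]eE.
by exists h => // x; rewrite -eE hE f'E.
Qed.

(** * Comparison of projective resolutions *)

Section Comparison.
Variables (k : fieldType) (N : gbimod k).
Hypothesis gN : is_graded N.
Implicit Types P Q : proj_resolution N.

Lemma rdiffK P a (x : rterm P a.+2) : rdiff (rdiff x) = 0.
Proof. by apply/rdiff_exact; exists x. Qed.

Lemma raug_rdiff P (x : rterm P 1) : raug (rdiff x) = 0.
Proof. by apply/raug_exact; exists x. Qed.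

Section ChainMap.
Variables P Q : proj_resolution N.

Let chain_step a (f : rterm P a -> rterm Q a) (g : rterm P a.+1 -> rterm Q a.+1) :=
  [/\ is_ghom f, is_ghom g & forall x, rdiff (g x) = f (rdiff x)].

(** Each component is lifted from the two before it, so the recursion carries
    two consecutive components and the square that they satisfy. *)
Lemma chain_map_exists : exists f : forall a, rterm P a -> rterm Q a,
  [/\ forall a, is_ghom (f a), forall x, raug (f 0%N x) = raug x
    & forall a x, rdiff (f a.+1 x) = f a (rdiff x)].
Proof.
have [f0 hf0 f0E] : exists2 h : rterm P 0 -> rterm Q 0,
    is_ghom h & forall x, raug (h x) = raug x.
  exact: (@rterm_projective _ _ P 0 _ _ _ _ (rterm_graded Q 0) gN (raug_ghom Q) (raug_ghom P)
            (@raug_surj _ _ Q)).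
have [f1 hf1 f1E] : exists2 h : rterm P 1 -> rterm Q 1,
    is_ghom h & forall x, rdiff (h x) = f0 (rdiff x).
  apply: (projective_lift (@rterm_projective _ _ P 1) (rterm_graded Q 1) (rterm_graded Q 0)
            gN (rdiff_ghom Q 0) (raug_ghom Q) (ghom_comp (rdiff_ghom P 0) hf0)).
    exact: raug_exact.
  by move=> x /=; rewrite f0E raug_rdiff.
have step a (fg : {fg : (rterm P a -> rterm Q a) * (rterm P a.+1 -> rterm Q a.+1) |
    chain_step fg.1 fg.2}) : {h : rterm P a.+2 -> rterm Q a.+2 | chain_step (sval fg).2 h}.
  case: fg => -[f g] /= [hf hg fgE]; apply: cid.
  have [|x /=|h hh hE] := projective_lift (@rterm_projective _ _ P a.+2) (rterm_graded Q a.+2)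
    (rterm_graded Q a.+1) (rterm_graded Q a) (rdiff_ghom Q a.+1) (rdiff_ghom Q a)
    (ghom_comp (rdiff_ghom P a.+1) hg).
  - exact: rdiff_exact.
  - by rewrite fgE rdiffK lin0 //; apply: ghom_lin.
  by exists h.
pose fix F a : {fg : (rterm P a -> rterm Q a) * (rterm P a.+1 -> rterm Q a.+1) |
    chain_step fg.1 fg.2} :=
  match a with
  | 0 => exist (fun fg => chain_step fg.1 fg.2) (f0, f1) (And3 hf0 hf1 f1E)
  | b.+1 => let h := step b (F b) in
            exist (fun fg => chain_step fg.1 fg.2) ((sval (F b)).2, sval h) (svalP h)
  end.
exists (fun a => (sval (F a)).1); split=> [a|//|a x]; first by case: (svalP (F a)).
by case: (svalP (F a)) => _ _ ->.
Qed.
End ChainMap.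

Section Homotopy.
Variables P Q : proj_resolution N.
Variables f g : forall a, rterm P a -> rterm Q a.
Hypothesis hf : forall a, is_ghom (@f a).
Hypothesis hg : forall a, is_ghom (@g a).
Hypothesis augE : forall x, raug (f (a := 0) x) = raug (g (a := 0) x).
Hypothesis df : forall a x, rdiff (f (a := a.+1) x) = f (rdiff x).
Hypothesis dg : forall a x, rdiff (g (a := a.+1) x) = g (rdiff x).

(** The homotopy is built degree by degree; the invariant is that f - g - h d
    already takes values in cycles, which is what the next lift needs. *)
Lemma chain_homotopy_exists : exists h : forall a, rterm P a -> rterm Q a.+1,
  [/\ forall a, is_ghom (h a), forall x, f (a := 0) x - g (a := 0) x = rdiff (h 0%N x)
    & forall a x, f (a := a.+1) x - g (a := a.+1) x = rdiff (h a.+1 x) + h a (rdiff x)].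
Proof.
pose ok a (h : rterm P a -> rterm Q a.+1) :=
  is_ghom h /\ forall x : rterm P a.+1, rdiff (h (rdiff x)) = f (rdiff x) - g (rdiff x).
have [h0 hh0 h0E] : exists2 h : rterm P 0 -> rterm Q 1,
    is_ghom h & forall x, rdiff (h x) = f x - g x.
  apply: (projective_lift (@rterm_projective _ _ P 0) (rterm_graded Q 1) (rterm_graded Q 0)
            gN (rdiff_ghom Q 0) (raug_ghom Q) (ghomB (hf 0) (hg 0))).
    exact: raug_exact.
  by move=> x /=; rewrite (lin_sub _ _ (ghom_lin (raug_ghom Q))) augE subrr.
have step a (h : {h | @ok a h}) : {h' : rterm P a.+1 -> rterm Q a.+2 |
    ok a.+1 h' /\ forall x, f x - g x = rdiff (h' x) + sval h (rdiff x)}.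
  case: h => h /= [hh hE]; apply: cid.
  have [|x /=|h' hh' h'E] := projective_lift (@rterm_projective _ _ P a.+1) (rterm_graded Q a.+2)
    (rterm_graded Q a.+1) (rterm_graded Q a) (rdiff_ghom Q a.+1) (rdiff_ghom Q a)
    (ghomB (ghomB (hf a.+1) (hg a.+1)) (ghom_comp (rdiff_ghom P a) hh)).
  - exact: rdiff_exact.
  - have lr := ghom_lin (rdiff_ghom Q a).
    by rewrite !(lin_sub _ _ lr) df dg hE subrr.
  exists h'; split=> [|x]; last by rewrite h'E /= subrK.
  split=> // x; rewrite h'E /= rdiffK (lin0 (ghom_lin hh)) subr0 //.
have ok0 : ok 0 h0 by split.
pose fix F a : {h | @ok a h} :=
  match a with
  | 0 => exist _ h0 ok0
  | b.+1 => let h := step b (F b) in exist _ (sval h) (proj1 (svalP h))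
  end.
exists (fun a => sval (F a)); split=> [a|x|a x]; first by case: (svalP (F a)).
  by rewrite /= h0E.
exact: (proj2 (svalP (step a (F a)))).
Qed.
End Homotopy.
End Comparison.

Section Independence.
Variables (k : fieldType).
Hypothesis gR : is_graded (regular k).
Variables P Q : proj_resolution (regular k).
Variables (C : cplx k).

Lemma ext_bdy_subspace (R : proj_resolution (regular k)) (M : gbimod k) a :
  subspace (@ext_bdy k R M a).
Proof.
case: a => [|a]; split=> //=.
- by move=> c f g f0 g0 x; rewrite !fctE f0 g0 scaler0 addr0.
- exists (fun _ => 0) => //; exact: ghom0.
- move=> c f g [f' hf fE] [g' hg gE]; exists (fun x => c *: f' x + g' x); first exact: ghomP.
  by move=> x; rewrite !fctE fE gE.
Qed.

Lemma cdiff_ghom i d : is_ghom (M := gshift d (cterm C i)) (N := gshift d (cterm C (i + 1)))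
  (@cdiff k C).
Proof. by split; [apply: cdiff_bihom | move=> e x; apply: cdiff_piece]. Qed.

Lemma HHH_bdy_subspace (R : proj_resolution (regular k)) a i d :
  subspace (bdy (HHH R C a i d)).
Proof.
have lD := ghom_lin (cdiff_ghom 0 0).
have sb := ext_bdy_subspace R (gshift d (cterm C i)) a.
split.
  exists 0; first split=> /=; first exact: ghom0.
    by move=> x.
  suff -> : (0 : rterm R a -> C) - (fun x => cdiff ((0 : rterm R a -> C) x)) = 0 by case: sb.
  by apply: funext => x; rewrite !fctE (lin0 lD) subr0.
move=> c f g [f' [hf df] fE] [g' [hg dg] gE].
exists (c *: f' + g').
  split=> /=; first exact: ghomP.
  by move=> x; rewrite !fctE df dg scaler0 addr0.
have -> : c *: f + g - (fun x => cdiff ((c *: f' + g') x)) =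
    c *: (f - (fun x => cdiff (f' x))) + (g - (fun x => cdiff (g' x))).
  apply: funext => x; rewrite !fctE lD scalerBr opprD.
  by rewrite addrACA.
by case: sb => _; apply.
Qed.

Section OneWay.
Variables R S : proj_resolution (regular k).
Variables (u : forall a, rterm R a -> rterm S a) (v : forall a, rterm S a -> rterm R a).
Hypothesis hu : forall a, is_ghom (@u a).
Hypothesis hv : forall a, is_ghom (@v a).
Hypothesis au : forall x, raug (u (a := 0) x) = raug x.
Hypothesis av : forall x, raug (v (a := 0) x) = raug x.
Hypothesis du : forall a x, rdiff (u (a := a.+1) x) = u (rdiff x).
Hypothesis dv : forall a x, rdiff (v (a := a.+1) x) = v (rdiff x).

Lemma ext_bdy_comp (M : gbimod k) a (f : rterm S a -> M) :
  ext_bdy f -> ext_bdy (f \o u (a := a)).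
Proof.
case: a f => [f f0 x|a f [g hg fE]]; first exact: f0.
exists (g \o u (a := a)); first exact: ghom_comp.
by move=> x /=; rewrite fE du.
Qed.

(** Precomposing with u and then with v changes a cocycle f by f o (u v - id).
    This is a boundary of Ext itself, by the homotopy between u v and the
    identity, so no boundary for the differential of C is involved. *)
Lemma HHH_comp_inverse a i d :
  sq_inverse (HHH S C a i d) (HHH R C a i d)
    (fun f => f \o u (a := a)) (fun f => f \o v (a := a)).
Proof.
have ext_cyc (j : int) (f : rterm S a -> C) :
    cyc (HH S (cterm C j) a d) f -> cyc (HH R (cterm C j) a d) (f \o u (a := a)).
  move=> [hf df]; split; first exact: ghom_comp hf.
  by move=> x /=; rewrite -du df.
split=> //.
- move=> f [fc fb]; split; first exact: ext_cyc.
  exact: (ext_bdy_comp fb).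
- move=> f [g gc fb]; exists (g \o u (a := a)); first exact: ext_cyc.
  exact: (ext_bdy_comp fb).
move=> f [[hf df] _].
have lf := ghom_lin hf; have lD := ghom_lin (cdiff_ghom 0 0).
have [h [hh h0 hS]] := chain_homotopy_exists gR (fun a => ghom_comp (hv a) (hu a))
  (fun a => ghom_id (rterm S a))
  (fun x => etrans (au (v x)) (av x))
  (fun a x => etrans (du (v x)) (congr1 (u (a := a)) (dv x)))
  (fun a (x : rterm S a.+1) => erefl (rdiff x)).
exists 0; first by split=> //; exact: ghom0.
have -> : (f \o u (a := a)) \o v (a := a) - f - (fun x => cdiff ((0 : rterm S a -> C) x)) =
    (fun x => f (u (v x) - x)).
  by apply: funext => x; rewrite !fctE (lin0 lD) subr0 (lin_sub _ _ lf).
case: a f hf df lf h0 hS {ext_cyc} => [|a] f hf df lf h0 hS /=.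
  by move=> x; have := h0 x; rewrite /= => ->.
exists (f \o h a); first exact: ghom_comp hf.
by move=> x; have := hS a x; rewrite /= => ->; rewrite linD // df add0r.
Qed.
End OneWay.

Lemma HHH_resolution_equiv a i d : sq_equiv (HHH P C a i d) (HHH Q C a i d).
Proof.
have [u [hu au du]] := chain_map_exists gR Q P.
have [v [hv av dv]] := chain_map_exists gR P Q.
split; [exact: HHH_bdy_subspace|exact: HHH_bdy_subspace|].
by exists (fun f => f \o u a), (fun f => f \o v a); split; apply: HHH_comp_inverse.
Qed.
End Independence.

(** * Polynomials *)

Section Polynomials.
Variables (k : fieldType) (n : nat).
Implicit Types (p q : {mpoly k[n]}) (m : 'X_{1..n}).

Lemma mpoly_gen_ind (P : {mpoly k[n]} -> Prop) :
  P 0 -> P 1 -> (forall c p q, P p -> P q -> P (c *: p + q)) ->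
  (forall i p, P p -> P ('X_i * p)) -> forall p, P p.
Proof.
move=> P0 P1 PD PX; apply: mpolyind => // c m p _ _; apply: PD.
rewrite mpolyXE_id; elim/big_rec: _ => // i q _ Pq.
by elim: (m i) => [|e IH]; rewrite ?mul1r // exprS -mulrA; apply: PX.
Qed.

(** Linear extension from the monomials; homogeneous parts, division by a variable
    and the action of R^e on a bimodule are all defined through it. *)
Definition mlin (V : lmodType k) (F : 'X_{1..n} -> V) (p : {mpoly k[n]}) : V :=
  \sum_(m <- msupp p) p@_m *: F m.

Lemma mlin_widen (V : lmodType k) (F : 'X_{1..n} -> V) p (s : seq 'X_{1..n}) :
  uniq s -> {subset msupp p <= s} -> mlin F p = \sum_(m <- s) p@_m *: F m.
Proof.
move=> us sub; rewrite (bigID (mem (msupp p))) /= [X in _ + X]big1 ?addr0; last first.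
  by move=> m /memN_msupp_eq0 ->; rewrite scale0r.
rewrite -big_filter; apply: perm_big; apply: uniq_perm.
- exact: msupp_uniq.
- exact: filter_uniq.
by move=> m; rewrite mem_filter; case: (boolP (m \in msupp p)) => // /sub ->.
Qed.

Lemma mlin_linear (V : lmodType k) (F : 'X_{1..n} -> V) : linear (mlin F).
Proof.
move=> c p q; pose s := undup (msupp p ++ msupp q ++ msupp (c *: p + q)).
have us : uniq s := undup_uniq _.
rewrite !(mlin_widen F us); try by move=> m; rewrite mem_undup !mem_cat => ->; rewrite ?orbT.
rewrite scaler_sumr -big_split /=; apply: eq_bigr => m _.
by rewrite mcoeffD mcoeffZ scalerDl scalerA.
Qed.

Lemma mlinX (V : lmodType k) (F : 'X_{1..n} -> V) m : mlin F 'X_[m] = F m.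
Proof. by rewrite /mlin msuppX big_seq1 mcoeffX eqxx scale1r. Qed.

Lemma mpoly_lin_ext (V : lmodType k) (f g : {mpoly k[n]} -> V) :
  linear f -> linear g -> (forall m, f 'X_[m] = g 'X_[m]) -> f =1 g.
Proof.
move=> lf lg e; apply: mpolyind => [|c m p _ _ IH]; first by rewrite !lin0.
by rewrite lf lg e IH.
Qed.

Definition homdeg (d : int) p : Prop := forall m, m \in msupp p -> (2 * mdeg m)%:Z = d.

Lemma homdeg0 d : homdeg d 0. Proof. by move=> m; rewrite msupp0. Qed.

Lemma homdegP d c p q : homdeg d p -> homdeg d q -> homdeg d (c *: p + q).
Proof.
move=> hp hq m /msuppD_le; rewrite mem_cat => /orP[/msuppZ_le|]; first exact: hp.
exact: hq.
Qed.

Lemma homdegZ d c p : homdeg d p -> homdeg d (c *: p).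
Proof. by move=> hp m /msuppZ_le; apply: hp. Qed.

Lemma homdegD d p q : homdeg d p -> homdeg d q -> homdeg d (p + q).
Proof. by move=> hp hq; rewrite -[p]scale1r; apply: homdegP. Qed.

Lemma homdegM d e p q : homdeg d p -> homdeg e q -> homdeg (d + e) (p * q).
Proof.
move=> hp hq m /msuppM_le /allpairsP[[m1 m2] /= [/hp <- /hq <- ->]].
by rewrite mdegD mulnDr PoszD.
Qed.

Lemma homdegX m : homdeg (2 * mdeg m)%:Z 'X_[m].
Proof. by move=> m' /mem_msuppXP <-. Qed.

Lemma homdegU i : homdeg 2 'X_i.
Proof. by have := @homdegX U_(i); rewrite mdeg1. Qed.

Lemma homdeg1 : homdeg 0 1.
Proof. by move=> m; rewrite msupp1 inE => /eqP ->; rewrite mdeg0. Qed.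

Lemma homdeg_sum d (I : Type) (r : seq I) (P : pred I) (F : I -> {mpoly k[n]}) :
  (forall i, P i -> homdeg d (F i)) -> homdeg d (\sum_(i <- r | P i) F i).
Proof. by move=> hF; apply: big_ind => //; [exact: homdeg0 | move=> *; exact: homdegD]. Qed.

Lemma homdeg_exp p e : homdeg 2 p -> homdeg (2 * e)%:Z (p ^+ e).
Proof.
move=> hp; elim: e => [|e IH]; first exact: homdeg1.
by rewrite exprS mulnS PoszD; apply: homdegM.
Qed.

Definition hpart (d : int) p : {mpoly k[n]} :=
  mlin (fun m => if (2 * mdeg m)%:Z == d then 'X_[m] else 0) p.

Lemma hpart_coeff d p m : (hpart d p)@_m = if (2 * mdeg m)%:Z == d then p@_m else 0.
Proof.
rewrite /hpart; move: p; apply: mpolyind => [|c m' p _ _ IH].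
  by rewrite (lin0 (mlin_linear _)) !mcoeff0 if_same.
rewrite mlin_linear mcoeffD mcoeffZ IH mlinX mcoeffD mcoeffZ mcoeffX.
have [->|ne] := eqVneq m' m; first by case: ifP; rewrite ?mcoeffX ?eqxx // mcoeff0 mulr0 addr0.
by case: ifP; rewrite ?mcoeffX ?(negPf ne) ?mcoeff0 mulr0 !add0r.
Qed.

Lemma hpart_homdeg d p : homdeg d (hpart d p).
Proof. by move=> m; rewrite mcoeff_msupp hpart_coeff; case: (eqVneq _ d) => // _; rewrite eqxx. Qed.

(** The degrees needed for all entries of a vector are collected in one list, as
    the decomposition of an element of a graded module requires. *)
Lemma homdeg_decompose (I : finType) (v : I -> {mpoly k[n]}) (e : int) :
  exists2 s : seq int, uniq s & forall i, v i = \sum_(d <- s) hpart (d - e) (v i).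
Proof.
exists (undup (flatten [seq [seq (2 * mdeg m)%:Z + e | m <- msupp (v i)] | i <- enum I])).
  exact: undup_uniq.
move=> i; apply/mpolyP => m; rewrite raddf_sum /=.
have [|nz] := eqVneq (v i)@_m 0 => [z|].
  by rewrite z big1 // => d _; rewrite hpart_coeff z if_same.
rewrite (bigD1_seq ((2 * mdeg m)%:Z + e)) ?undup_uniq //=; last first.
  rewrite mem_undup; apply/flatten_mapP; exists i; first exact: mem_enum.
  by apply/mapP; exists m => //; rewrite mcoeff_msupp.
rewrite hpart_coeff addrK eqxx big1 ?addr0 // => d ne.
by rewrite hpart_coeff eq_sym subr_eq (negPf ne).
Qed.

Lemma homdeg_direct (s : seq int) (f : int -> {mpoly k[n]}) (e : int) :
  uniq s -> (forall d, homdeg (d - e) (f d)) -> \sum_(d <- s) f d = 0 ->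
  forall d, d \in s -> f d = 0.
Proof.
move=> us hf f0 d ds; apply/mpolyP => m; rewrite mcoeff0.
have [E|ne] := eqVneq (2 * mdeg m)%:Z (d - e); last first.
  by apply: contraNeq ne; rewrite -mcoeff_msupp => /hf ->.
have := congr1 (mcoeff m) f0; rewrite raddf_sum mcoeff0 /= (bigD1_seq d) //= big1 ?addr0 //.
move=> d' ne; apply: contraNeq ne; rewrite -mcoeff_msupp => /hf.
by rewrite E => /addIr ->.
Qed.

Definition mdivX (i : 'I_n) (p : {mpoly k[n]}) : {mpoly k[n]} :=
  mlin (fun m => if (0 < m i)%N then 'X_[m - U_(i)] else 0) p.

Lemma mdivX_linear i : linear (mdivX i). Proof. exact: mlin_linear. Qed.

Lemma mdivXE i p : 'X_i * mdivX i p = mlin (fun m => if (0 < m i)%N then 'X_[m] else 0) p.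
Proof.
move: p; apply: mpoly_lin_ext => [c p q||m].
- by rewrite mdivX_linear mulrDr scalerAr.
- exact: mlin_linear.
rewrite /mdivX !mlinX; case: ifP => h; last by rewrite mulr0.
rewrite -mpolyXD addmC submK //; apply/mnm_lepP => j; rewrite mnm1E.
by case: eqP => // <-.
Qed.

Lemma mdivX_coeff i p m :
  ('X_i * mdivX i p)@_m = if (0 < m i)%N then p@_m else 0.
Proof.
rewrite mdivXE; move: p; apply: mpolyind => [|c m' p _ _ IH].
  by rewrite (lin0 (mlin_linear _)) !mcoeff0 if_same.
rewrite mlin_linear mcoeffD mcoeffZ IH mlinX mcoeffD mcoeffZ mcoeffX.
have [->|ne] := eqVneq m' m; first by case: ifP; rewrite ?mcoeffX ?eqxx // mcoeff0 mulr0 addr0.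
by do 2!case: ifP => _; rewrite ?mcoeffX ?(negPf ne) ?mcoeff0 mulr0 !add0r.
Qed.

Lemma mdivXK i p : (forall m, m \in msupp p -> 0 < m i)%N -> 'X_i * mdivX i p = p.
Proof.
move=> h; rewrite mdivXE [RHS]mpolyE; apply: eq_big_seq => m hm.
by rewrite h.
Qed.

Lemma mdivX_homdeg i d p : homdeg d p -> homdeg (d - 2) (mdivX i p).
Proof.
move=> hp; rewrite /mdivX /mlin big_seq; apply: homdeg_sum => m hm; apply: homdegZ.
case: ifP => h; last exact: homdeg0.
rewrite -(hp m hm) => m' /mem_msuppXP <-.
have le : (U_(i) <= m)%MM by apply/mnm_lepP => j; rewrite mnm1E; case: eqP => // <-.
by rewrite -{2}(submK le) mdegD mdeg1 mulnDr PoszD addrK.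
Qed.

Lemma mcoeffMU i p m : ('X_i * p)@_m = if (0 < m i)%N then p@_(m - U_(i)) else 0.
Proof.
case: ifP => h.
  have le : (U_(i) <= m)%MM by apply/mnm_lepP => j; rewrite mnm1E; case: eqP => // <-.
  by rewrite -{1}(submK le) addmC mulrC mcoeffMX.
apply: contraFeq h; rewrite -mcoeff_msupp => /msuppM_le /allpairsP[[m1 m2] /= [/mem_msuppXP <- _ ->]].
by rewrite mnmDE mnm1E eqxx.
Qed.

Lemma X_neq0 (i : 'I_n) : 'X_i != 0 :> {mpoly k[n]}.
Proof.
by apply/eqP => /(congr1 (mcoeff U_(i))); rewrite mcoeffX eqxx mcoeff0 => /eqP; rewrite oner_eq0.
Qed.

Lemma mdivX_mul i p : mdivX i ('X_i * p) = p.
Proof.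
apply: (mulfI (X_neq0 i)); apply: mdivXK => m; apply: contraLR; rewrite -eqn0Ngt => /eqP mi.
by rewrite mcoeff_msupp mcoeffMU mi eqxx.
Qed.

(** If 'X_i p = 'X_j q with i distinct from j, then 'X_j divides p.  This is the
    exactness of a Koszul complex on two variables in the middle. *)
Lemma mdivX_cofactor i j p q : i != j -> 'X_i * p = 'X_j * q -> 'X_j * mdivX j p = p.
Proof.
move=> ij E; apply: mdivXK => m hm; rewrite lt0n; apply: contraTneq hm => mj.
rewrite mcoeff_msupp negbK -(mcoeffMX p U_(i)) mulrC E addmC mcoeffMU.
by rewrite mnmDE mnm1E (negPf ij) mj.
Qed.

End Polynomials.

Lemma homdeg_comp (k : fieldType) (n n' : nat) (t : n.-tuple {mpoly k[n']}) d (p : {mpoly k[n]}) :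
  (forall i, homdeg 2 (tnth t i)) -> homdeg d p -> homdeg d (p \mPo t).
Proof.
move=> ht hp; rewrite comp_mpolyEX big_seq; apply: homdeg_sum => m hm; apply: homdegZ.
rewrite comp_mpolyX -(hp m hm) mdegE; elim/big_rec2: _ => [|i e q _ IH]; first exact: homdeg1.
by rewrite mulnDr PoszD; apply: homdegM => //; apply: homdeg_exp.
Qed.

(** * Free bimodules *)

Section Free.
Variable k : fieldType.
Notation E := {mpoly k[4]}.
Notation R := (polyR k).

(** R^e is taken as the polynomial ring in the left variables vL and the
    differences vD of right and left variables.  In these coordinates the kernel
    of multiplication R^e -> R is generated by variables. *)
Definition vL (v : 'I_2) : 'I_4 := lshift 2 v.
Definition vD (v : 'I_2) : 'I_4 := rshift 2 v.
Definition incl (p : R) : E := p \mPo [tuple 'X_(vL v) : E | v < 2].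
Definition incr (p : R) : E := p \mPo [tuple 'X_(vL v) + 'X_(vD v) : E | v < 2].

Lemma incl_lin : linear incl.
Proof. by move=> c p q; rewrite /incl comp_mpolyD comp_mpolyZ. Qed.
Lemma incr_lin : linear incr.
Proof. by move=> c p q; rewrite /incr comp_mpolyD comp_mpolyZ. Qed.
Lemma inclX v : incl 'X_v = 'X_(vL v).
Proof. by rewrite /incl comp_mpolyXU -tnth_nth tnth_mktuple. Qed.
Lemma incrX v : incr 'X_v = 'X_(vL v) + 'X_(vD v).
Proof. by rewrite /incr comp_mpolyXU -tnth_nth tnth_mktuple. Qed.
Lemma incl1 : incl 1 = 1. Proof. exact: comp_mpoly1. Qed.
Lemma incr1 : incr 1 = 1. Proof. exact: comp_mpoly1. Qed.
Lemma inclM p q : incl (p * q) = incl p * incl q. Proof. exact: rmorphM. Qed.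
Lemma incrM p q : incr (p * q) = incr p * incr q. Proof. exact: rmorphM. Qed.
Lemma incl_homdeg d p : homdeg d p -> homdeg d (incl p).
Proof. by apply: homdeg_comp => i; rewrite tnth_mktuple; apply: homdegU. Qed.
Lemma incr_homdeg d p : homdeg d p -> homdeg d (incr p).
Proof.
by apply: homdeg_comp => i; rewrite tnth_mktuple; apply: homdegD; apply: homdegU.
Qed.

Section FreeBimod.
Variables (n : nat) (e : int).
Notation F := ('I_n -> E).
Definition free_lact (p : R) (v : F) : F := fun j => incl p * v j.
Definition free_ract (v : F) (p : R) : F := fun j => incr p * v j.
Fact free_lact_linl v : linear (free_lact^~ v).
Proof. by move=> c p q; apply: funext => j; rewrite /free_lact incl_lin mulrDl -scalerAl. Qed.
Fact free_lact_linr p : linear (free_lact p).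
Proof. by move=> c v w; apply: funext => j; rewrite /free_lact !fctE mulrDr -scalerAr. Qed.
Fact free_ract_linl p : linear (free_ract^~ p).
Proof. by move=> c v w; apply: funext => j; rewrite /free_ract !fctE mulrDr -scalerAr. Qed.
Fact free_ract_linr v : linear (free_ract v).
Proof. by move=> c p q; apply: funext => j; rewrite /free_ract incr_lin mulrDl -scalerAl. Qed.
Fact free_lact1 v : free_lact 1 v = v.
Proof. by apply: funext => j; rewrite /free_lact incl1 mul1r. Qed.
Fact free_lactM p q v : free_lact (p * q) v = free_lact p (free_lact q v).
Proof. by apply: funext => j; rewrite /free_lact inclM mulrA. Qed.
Fact free_ract1 v : free_ract v 1 = v.
Proof. by apply: funext => j; rewrite /free_ract incr1 mul1r. Qed.
Fact free_ractM v p q : free_ract v (p * q) = free_ract (free_ract v p) q.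
Proof. by apply: funext => j; rewrite /free_ract incrM mulrA [incr q * _]mulrC. Qed.
Fact free_lractC p v q : free_lact p (free_ract v q) = free_ract (free_lact p v) q.
Proof. by apply: funext => j; rewrite /free_ract /free_lact mulrCA. Qed.

Definition free_bimod : bimod k :=
  Bimod free_lact_linl free_lact_linr free_ract_linl free_ract_linr
        free_lact1 free_lactM free_ract1 free_ractM free_lractC.

Definition free_piece (d : int) (v : F) : Prop := forall j, homdeg (d - e) (v j).
Fact free_piece0 d : free_piece d 0. Proof. by move=> j; apply: homdeg0. Qed.
Fact free_pieceP d c v w : free_piece d v -> free_piece d w -> free_piece d (c *: v + w).
Proof. by move=> hv hw j; rewrite !fctE; apply: homdegP. Qed.
Definition free : gbimod k := @GBimod k free_bimod free_piece free_piece0 free_pieceP.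

Lemma free_graded : is_graded free.
Proof.
split=> [d e' p v hp hv j|d e' p v hp hv j|v|s f us fP f0 d ds].
- by rewrite -addrA; apply: homdegM => //; apply: incl_homdeg.
- by rewrite -addrA; apply: homdegM => //; apply: incr_homdeg.
- have [s us sE] := homdeg_decompose v e.
  exists s, (fun d j => hpart (d - e) (v j)); split=> [d j|]; first exact: hpart_homdeg.
  by apply: funext => j; rewrite sE fct_sumE.
apply: funext => j; apply: (homdeg_direct us (f := fun d => f d j) (fun d => fP d j)) => //.
by have := congr1 (fun v : F => v j) f0; rewrite fct_sumE.
Qed.

Definition gen (j : 'I_n) : free := fun i => (i == j)%:R.
Lemma gen_piece j : piece e (gen j).
Proof.
move=> i; rewrite /gen subrr; case: (i == j); [exact: homdeg1 | exact: homdeg0].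
Qed.
End FreeBimod.

Section Eact.
Variable M : bimod k.
Definition ad (v : 'I_2) (x : M) : M := ract x 'X_v - lact 'X_v x.
Lemma ad_lin v : linear (ad v).
Proof.
move=> c x y; rewrite /ad ract_linl lact_linr scalerBr opprD.
by rewrite addrACA.
Qed.
Lemma ad_comm v w x : ad v (ad w x) = ad w (ad v x).
Proof.
rewrite /ad !(lin_sub _ _ (ract_linl _)) !(lin_sub _ _ (lact_linr _)).
rewrite -!ractM -!lactM -!lractC ['X_w * 'X_v]mulrC.
by rewrite !opprD !opprK addrACA.
Qed.

Lemma ad_lact v p x : ad v (lact p x) = lact p (ad v x).
Proof.
rewrite /ad (lin_sub _ _ (lact_linr p)) lractC; congr (_ - _).
by rewrite -!lactM mulrC.
Qed.

(** The monomials of R^e act by left multiplications and by the operators ad, all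
    of which commute. *)
Definition mact (m : 'X_{1..4}) (x : M) : M :=
  lact ('X_0 ^+ m (vL 0) * 'X_1 ^+ m (vL 1))
    (iter (m (vD 0)) (ad 0) (iter (m (vD 1)) (ad 1) x)).

Lemma iter_lin (f : M -> M) e : linear f -> linear (iter e f).
Proof. by move=> lf; elim: e => // e IH c x y; rewrite !iterS IH lf. Qed.

Lemma mact_lin m : linear (mact m).
Proof.
move=> c x y; rewrite /mact (iter_lin _ (ad_lin 1)) (iter_lin _ (ad_lin 0)).
by rewrite lact_linr.
Qed.

Lemma ord2 (v : 'I_2) : v = 0 \/ v = 1.
Proof.
by case: v => -[|[|]] //= h; [left | right]; apply: val_inj.
Qed.

Lemma mactL v m x : mact (U_(vL v) + m) x = lact 'X_v (mact m x).
Proof.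
rewrite /mact -lactM !mnmDE !mnm1E.
by case: (ord2 v) => ->; rewrite /= !add0n ?add1n exprS; [rewrite mulrA | rewrite mulrCA].
Qed.

Lemma mactD v m x : mact (U_(vD v) + m) x = ad v (mact m x).
Proof.
rewrite /mact ad_lact !mnmDE !mnm1E; congr (lact _ _).
case: (ord2 v) => -> //=.
by elim: (m (vD 0)) => //= e ->; rewrite ad_comm.
Qed.

Definition eact (p : E) (x : M) : M := mlin (mact^~ x) p.

Lemma eact_linl x : linear (eact^~ x). Proof. exact: mlin_linear. Qed.

Lemma eact_linr p : linear (eact p).
Proof.
move=> c x y; rewrite /eact /mlin scaler_sumr -big_split; apply: eq_bigr => m _ /=.
by rewrite mact_lin scalerDr !scalerA mulrC.
Qed.

Lemma eact1 x : eact 1 x = x.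
Proof. by rewrite /eact -mpolyX0 mlinX /mact !mnm0E mulr1 lact1. Qed.

Lemma eactL v p x : eact ('X_(vL v) * p) x = lact 'X_v (eact p x).
Proof.
move: p; apply: mpoly_lin_ext => [c p q|c p q|m].
- by rewrite mulrDr -scalerAr eact_linl.
- by rewrite eact_linl lact_linr.
by rewrite -mpolyXD /eact !mlinX mactL.
Qed.

Lemma eactD v p x : eact ('X_(vD v) * p) x = ad v (eact p x).
Proof.
move: p; apply: mpoly_lin_ext => [c p q|c p q|m].
- by rewrite mulrDr -scalerAr eact_linl.
- by rewrite eact_linl ad_lin.
by rewrite -mpolyXD /eact !mlinX mactD.
Qed.

Lemma eact_incl q p x : eact (incl q * p) x = lact q (eact p x).
Proof.
move: q; apply: mpoly_gen_ind => [||c q r Pq Pr|v q Pq].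
- by rewrite (lin0 incl_lin) mul0r (lin0 (eact_linl x)) (lin0 (lact_linl _)).
- by rewrite incl1 mul1r lact1.
- by rewrite incl_lin mulrDl -scalerAl eact_linl Pq Pr lact_linl.
by rewrite inclM inclX -mulrA eactL Pq lactM.
Qed.

Lemma eact_incr q p x : eact (incr q * p) x = ract (eact p x) q.
Proof.
move: q; apply: mpoly_gen_ind => [||c q r Pq Pr|v q Pq].
- by rewrite (lin0 incr_lin) mul0r (lin0 (eact_linl x)) (lin0 (ract_linr _)).
- by rewrite incr1 mul1r ract1.
- by rewrite incr_lin mulrDl -scalerAl eact_linl Pq Pr ract_linr.
rewrite incrM incrX -mulrA mulrDl (linD (eact_linl x)) eactL eactD Pq mulrC ractM.
by rewrite /ad addrC subrK.
Qed.
End Eact.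

Lemma eact_bihom (M N : bimod k) (f : M -> N) p x :
  is_bihom f -> f (eact p x) = eact p (f x).
Proof.
move=> [fl f2 f3]; move: p; apply: mpoly_gen_ind => [||c q r Pq Pr|i q Pq].
- by rewrite !(lin0 (eact_linl _)) (lin0 fl).
- by rewrite !eact1.
- by rewrite !eact_linl fl Pq Pr.
case: (@split_ordP 2 2 i) => v ->; rewrite -1?/(vL v) -1?/(vD v).
  by rewrite !eactL f2 Pq.
by rewrite !eactD /ad (lin_sub _ _ fl) f2 f3 Pq.
Qed.

Section FreeHom.
Variables (n : nat) (e : int).
Notation F := (free n e).

Lemma eact_free p (v : F) : eact p v = (fun j => p * v j : E).
Proof.
move: p; apply: mpoly_gen_ind => [||c q r Pq Pr|i q Pq].
- by rewrite (lin0 (eact_linl _)); apply: funext => j; rewrite mul0r.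
- by rewrite eact1; apply: funext => j; rewrite mul1r.
- by rewrite eact_linl Pq Pr; apply: funext => j; rewrite !fctE mulrDl -scalerAl.
case: (@split_ordP 2 2 i) => w ->; rewrite -1?/(vL w) -1?/(vD w); apply: funext => j.
  by rewrite eactL Pq /= /free_lact inclX mulrA.
by rewrite eactD Pq /ad !fctE /= /free_lact /free_ract incrX inclX mulrDl addrAC subrr add0r mulrA.
Qed.

Lemma free_genE (v : F) : v = \sum_j eact (v j) (gen e j).
Proof.
apply: funext => i; rewrite fct_sumE (bigD1 i) //= big1 ?addr0.
  by rewrite eact_free /gen eqxx mulr1.
by move=> j ne; rewrite eact_free /gen eq_sym (negPf ne) mulr0.
Qed.

Lemma bihom_freeE (M : bimod k) (f : F -> M) v :
  is_bihom f -> f v = \sum_j eact (v j) (f (gen e j)).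
Proof.
move=> hf; rewrite {1}(free_genE v) (lin_bigsum _ _ (let: And3 fl _ _ := hf in fl)).
by apply: eq_bigr => j _; rewrite eact_bihom.
Qed.

Definition free_hom (M : bimod k) (x : 'I_n -> M) (v : F) : M := \sum_j eact (v j) (x j).

Lemma free_hom_gen (M : bimod k) (x : 'I_n -> M) j : free_hom x (gen e j) = x j.
Proof.
rewrite /free_hom (bigD1 j) //= big1 ?addr0 => [|i ne].
  by rewrite /gen eqxx eact1.
by rewrite /gen (negPf ne) (lin0 (eact_linl _)).
Qed.

Lemma free_hom_bihom (M : bimod k) (x : 'I_n -> M) : is_bihom (free_hom x).
Proof.
split=> [c v w|p v|v p]; rewrite /free_hom.
- by rewrite scaler_sumr -big_split; apply: eq_bigr => j _; apply: eact_linl.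
- by rewrite (lin_bigsum _ _ (lact_linr p)); apply: eq_bigr => j _; apply: eact_incl.
- by rewrite (lin_bigsum _ _ (ract_linl p)); apply: eq_bigr => j _; apply: eact_incr.
Qed.

(** A term of a complex satisfies these two axioms of a graded bimodule, but its
    pieces do not span the carrier, which is the whole complex. *)
Definition graded_actions (M : gbimod k) : Prop :=
  (forall d f p (x : M), regular_piece d p -> piece f x -> piece (d + f) (lact p x)) /\
  (forall d f p (x : M), regular_piece d p -> piece f x -> piece (d + f) (ract x p)).

Lemma piece_sum (M : gbimod k) d (I : Type) (r : seq I) (P : pred I) (x : I -> M) :
  (forall i, P i -> piece d (x i)) -> piece d (\sum_(i <- r | P i) x i).
Proof.
move=> h; apply: big_ind => //; first exact: piece0.
by move=> y z hy hz; rewrite -[y]scale1r; apply: pieceP.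
Qed.

Lemma pieceZ (M : gbimod k) d c (x : M) : piece d x -> piece d (c *: x).
Proof. by move=> hx; rewrite -[_ *: _]addr0; apply: pieceP => //; apply: piece0. Qed.

Lemma ad_piece (M : gbimod k) d v (x : M) : graded_actions M ->
  piece d x -> piece (2 + d) (ad v x).
Proof.
move=> [aL aR] hx; rewrite /ad -scaleN1r [_ + _ *: _]addrC; apply: pieceP.
  by apply: aL => //; apply: regular_pieceX.
by apply: aR => //; apply: regular_pieceX.
Qed.

Lemma eact_piece (M : gbimod k) d f p (x : M) : graded_actions M ->
  homdeg d p -> piece f x -> piece (d + f) (eact p x).
Proof.
move=> aM hp hx; rewrite /eact /mlin big_seq; apply: piece_sum => m hm; apply: pieceZ.
have ad_iter v i (y : M) g : piece g y -> piece ((2 * i)%:Z + g) (iter i (ad v) y).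
  move=> hy; elim: i => [|i IH]; first by rewrite muln0 add0r.
  by rewrite mulnS PoszD -addrA; apply: ad_piece.
have -> : d = ((2 * m (vL 0))%:Z + (2 * m (vL 1))%:Z) + ((2 * m (vD 0))%:Z + (2 * m (vD 1))%:Z).
  rewrite -(hp m hm) mdegE !big_ord_recr big_ord0 /= add0n -!PoszD -!mulnDr !addnA.
  by congr (2 * (m _ + m _ + m _ + m _))%:Z; apply: val_inj.
rewrite -addrA; case: aM => aL _; apply: aL.
  by apply: regular_pieceM; apply: homdeg_exp; apply: homdegU.
by rewrite -addrA; apply: (ad_iter); apply: (ad_iter).
Qed.

Lemma free_hom_ghom (M : gbimod k) (x : 'I_n -> M) : graded_actions M ->
  (forall j, piece e (x j)) -> is_ghom (free_hom x).
Proof.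
move=> aM hx; split; first exact: free_hom_bihom.
move=> d v hv; apply: piece_sum => j _.
by rewrite -[d](subrK e); apply: eact_piece.
Qed.

(** A preimage of a homogeneous y decomposes into homogeneous parts, and the part
    in the degree of y maps to y, the images of the other parts being zero. *)
Lemma surj_piece (M N : gbimod k) (g : M -> N) d y :
  is_graded M -> is_graded N -> is_ghom g -> (forall y, exists x, g x = y) -> piece d y ->
  exists2 x, piece d x & g x = y.
Proof.
move=> [_ _ M3 _] [_ _ _ N4] [[gl _ _] gP] sur hy.
have [x gx] := sur y; have [s [f [fP xE]]] := M3 x.
(* The decomposition may list the degree d several times. *)
pose c := (count_mem d s)%:R : k.
exists (c *: f d); first exact: pieceZ.
pose u := undup (d :: s).
pose h e := g ((count_mem e s)%:R *: f e) - (if e == d then y else 0).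
have hP e' : piece e' (h e').
  rewrite /h -scaleN1r [_ + _ *: _]addrC; apply: pieceP; last by apply: gP; apply: pieceZ.
  by case: eqP => [->|_]; [exact: hy | exact: piece0].
have : h d = 0.
  apply: (N4 u h (undup_uniq _) hP); last by rewrite mem_undup inE eqxx.
  have us : uniq u := undup_uniq _.
  have du : d \in u by rewrite mem_undup inE eqxx.
  rewrite /h sumrB [X in _ - X](bigD1_seq d) //= eqxx [X in _ - (_ + X)]big1 ?addr0; last first.
    by move=> i /negPf ->.
  rewrite -(lin_bigsum _ _ gl) -gx xE; apply/eqP; rewrite subr_eq0; apply/eqP; congr g.
  rewrite -[RHS]big_undup_iterop_count.
  rewrite [LHS](bigID (mem s)) /= [X in _ + X]big1 ?addr0; last first.
    by move=> i /count_memPn ->; rewrite scale0r.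
  rewrite -big_filter (perm_big (undup s)) /=.
    by apply: eq_bigr => i _; rewrite scaler_nat.
  apply: uniq_perm; [exact: filter_uniq | exact: undup_uniq|].
  by move=> i; rewrite mem_filter !mem_undup inE; case: (boolP (i \in s)); rewrite ?orbT.
by rewrite /h eqxx => /eqP; rewrite subr_eq0 => /eqP.
Qed.
End FreeHom.
End Free.

(** * The Koszul resolution *)

Section Koszul.
Variable k : fieldType.
Notation E := {mpoly k[4]}.
Notation R := (polyR k).

Lemma regular_graded : is_graded (regular k).
Proof.
split=> [d e p x|d e p x|p|s f us fP f0 d ds].
- exact: regular_pieceM.
- by rewrite addrC => hp hx; apply: regular_pieceM.
- have [s us sE] := homdeg_decompose (fun _ : 'I_1 => p) 0.
  exists s, (fun d => hpart (d - 0) p); split; last exact: (sE 0).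
  by move=> d; have := @hpart_homdeg k 2 (d - 0) p; rewrite subr0.
by apply: (homdeg_direct us (e := 0)) f0 d ds => d; rewrite subr0; apply: fP.
Qed.

(** A map out of a free bimodule is determined by the images of the generators,
    and these lift to homogeneous elements. *)
Lemma free_projective n e : is_gprojective (free k n e).
Proof.
move=> M N g f gM gN hg hf sur.
have /choice[x xP] j : exists x : M, piece e x /\ g x = f (gen k e j).
  have [|x hx gx] := surj_piece gM gN hg sur (y := f (gen k e j)) (d := e).
    by apply: (proj2 hf); apply: gen_piece.
  by exists x.
exists (free_hom x).
  apply: free_hom_ghom => [|j]; last by case: (xP j).
  by case: gM => M1 M2 _ _; split.
move=> v; rewrite (bihom_freeE _ (proj1 hf)) /free_hom (lin_bigsum _ _ (ghom_lin hg)).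
by apply: eq_bigr => j _; rewrite (eact_bihom _ _ (proj1 hg)) (proj2 (xP j)).
Qed.

Definition krank (a : nat) : nat := match a with 0 => 1 | 1 => 2 | 2 => 1 | _ => 0 end.
Definition kterm (a : nat) : gbimod k := free k (krank a) (2 * a)%:Z.

Definition kdiff (a : nat) : kterm a.+1 -> kterm a :=
  match a return kterm a.+1 -> kterm a with
  | 0 => fun (v : 'I_2 -> E) (_ : 'I_1) => 'X_(vD 0) * v 0 + 'X_(vD 1) * v 1
  | 1 => fun (v : 'I_1 -> E) (j : 'I_2) =>
           if j == 0 then - ('X_(vD 1) * v 0) else 'X_(vD 0) * v 0
  | _ => fun _ => 0
  end.

Definition aug (p : E) : R :=
  p \mPo [tuple if fintype.split (i : 'I_(2 + 2)) is inl v then 'X_v else 0 : R | i < 4].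
Definition kaug (v : kterm 0) : regular k := aug (v 0).

Lemma aug_lin : linear aug.
Proof. by move=> c p q; rewrite /aug comp_mpolyD comp_mpolyZ. Qed.
Lemma augM p q : aug (p * q) = aug p * aug q. Proof. exact: rmorphM. Qed.
Lemma aug1 : aug 1 = 1. Proof. exact: comp_mpoly1. Qed.
Lemma augL v : aug 'X_(vL v) = 'X_v.
Proof. by rewrite /aug comp_mpolyXU -tnth_nth tnth_mktuple (unsplitK (inl v)). Qed.
Lemma augD v : aug 'X_(vD v) = 0.
Proof. by rewrite /aug comp_mpolyXU -tnth_nth tnth_mktuple (unsplitK (inr v)). Qed.

Lemma aug_homdeg d p : homdeg d p -> homdeg d (aug p).
Proof.
apply: homdeg_comp => i; rewrite tnth_mktuple; case: (fintype.split _) => v; [exact: homdegU|].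
exact: homdeg0.
Qed.

Lemma aug_incl p : aug (incl p) = p.
Proof.
move: p; apply: mpoly_gen_ind => [||c p q hp hq|v p hp].
- by rewrite (lin0 (@incl_lin k)) (lin0 aug_lin).
- by rewrite incl1 aug1.
- by rewrite incl_lin aug_lin hp hq.
by rewrite inclM augM inclX augL hp.
Qed.

Lemma aug_incr p : aug (incr p) = p.
Proof.
move: p; apply: mpoly_gen_ind => [||c p q hp hq|v p hp].
- by rewrite (lin0 (@incr_lin k)) (lin0 aug_lin).
- by rewrite incr1 aug1.
- by rewrite incr_lin aug_lin hp hq.
by rewrite incrM augM incrX (linD aug_lin) augL augD addr0 hp.
Qed.

(** Modulo the differences vD every element of R^e comes from the left copy of R;
    this gives exactness at the first Koszul term. *)
Lemma augE p : exists a b, p = incl (aug p) + ('X_(vD 0) * a + 'X_(vD 1) * b).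
Proof.
move: p; apply: mpoly_gen_ind => [||c p q [a [b hp]] [a' [b' hq]]|i p [a [b hp]]].
- by exists 0, 0; rewrite (lin0 aug_lin) (lin0 (@incl_lin k)) !mulr0 !addr0.
- by exists 0, 0; rewrite aug1 incl1 !mulr0 !addr0.
- exists (c *: a + a'), (c *: b + b'); rewrite {1}hp {1}hq aug_lin incl_lin !mulrDr -!scalerAr.
  by rewrite !scalerDr addrACA; congr (_ + _); rewrite addrACA.
rewrite augM; case: (@split_ordP 2 2 i) => v ->.
  exists ('X_(vL v) * a), ('X_(vL v) * b).
  by rewrite augL inclM inclX {1}hp !mulrDr ![_ * ('X_(vL v) * _)]mulrCA.
rewrite [aug _](augD v) mul0r (lin0 (@incl_lin k)).
by case: (ord2 v) => ->; [exists p, 0 | exists 0, p]; rewrite mulr0 ?addr0 ?add0r ?add0r.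
Qed.

Fact kaug_ghom : is_ghom kaug.
Proof.
split; last by move=> d v hv; apply: aug_homdeg; have := hv 0; rewrite subr0.
split=> [c v w|p v|v p]; rewrite /kaug; first exact: aug_lin.
- by rewrite augM aug_incl.
- by rewrite augM aug_incr mulrC.
Qed.

Fact kaug_surj y : exists x, kaug x = y.
Proof. by exists (fun _ => incl y); apply: aug_incl. Qed.

Lemma vD_neq : vD 0 != vD 1. Proof. by []. Qed.

Fact kdiff_ghom a : is_ghom (@kdiff a).
Proof.
case: a => [|[|a]] /=; last exact: ghom0.
  split; last first.
    move=> d v hv j; rewrite subr0.
    by apply: homdegD; rewrite -[d](subrK 2) addrC; apply: homdegM (hv _); apply: homdegU.
  split=> [c v w|p v|v p]; apply: funext => j; rewrite ?fctE /= ?/free_lact ?/free_ract.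
  - by rewrite !mulrDr -!scalerAr scalerDr addrACA.
  - by rewrite mulrDr ![incl p * ('X_ _ * _)]mulrCA.
  - by rewrite mulrDr ![incr p * ('X_ _ * _)]mulrCA.
split; last first.
  move=> d v hv j; have -> : d - 2 = 2 + (d - 4) by rewrite addrCA.
  have h i : homdeg (2 + (d - 4)) ('X_i * v 0) by apply: homdegM (hv 0); apply: homdegU.
  by case: ifP => _ //; rewrite -scaleN1r; apply: homdegZ.
split=> [c v w|p v|v p]; apply: funext => j; rewrite ?fctE /= ?/free_lact ?/free_ract.
- by case: ifP => _; rewrite mulrDr -scalerAr // opprD scalerN.
- by case: ifP => _; rewrite ?mulrN mulrCA.
- by case: ifP => _; rewrite ?mulrN mulrCA.
Qed.

Fact kaug_exact x : kaug x = 0 <-> exists y : kterm 1, x = kdiff y.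
Proof.
split=> [h|[y ->]]; last first.
  by rewrite /kaug /= (linD aug_lin) !augM !augD !mul0r addr0.
have [a [b xE]] := augE (x 0).
exists (fun j : 'I_2 => if j == 0 then a else b); apply: funext => j.
by rewrite (ord1 j) xE -/(kaug x) h (lin0 (@incl_lin k)) add0r.
Qed.

(** A relation 'X_i p = 'X_j q between two variables is a multiple of the obvious
    one, because the variables divide the cofactors. *)
Fact kdiff_exact a (x : kterm a.+1) : kdiff x = 0 <-> exists y : kterm a.+2, x = kdiff y.
Proof.
case: a x => [|[|a]] x /=; last first.
- by split=> // _; exists 0; apply: funext => -[].
- split=> [h|[y ->]]; last by apply: funext => j /=; rewrite ?fctE; case: ifP => _; rewrite mulr0 ?oppr0.
  exists 0; apply: funext => j; rewrite (ord1 j); apply: (mulfI (X_neq0 k (vD 0))).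
  by have := congr1 (fun v : 'I_2 -> E => v 1) h; rewrite mulr0.
split=> [h|[y ->]]; last by apply: funext => j /=; rewrite mulrN mulrCA addNr.
have e : 'X_(vD 0) * x 0 = 'X_(vD 1) * - x 1.
  by rewrite mulrN; apply/eqP; rewrite -addr_eq0; apply/eqP; apply: (congr1 (fun v : 'I_1 -> E => v 0) h).
have eq0 := mdivX_cofactor vD_neq e.
exists (fun _ => - mdivX (vD 1) (x 0)); apply: funext => j.
have [->|->] /= := ord2 j; first by rewrite mulrN opprK eq0.
apply: (mulfI (X_neq0 k (vD 1))); rewrite -[LHS]opprK -mulrN -e -{1}eq0.
by rewrite !mulrN mulrCA.
Qed.

Definition koszul : proj_resolution (regular k) :=
  @ProjResolution k (regular k) kterm kdiff kaug
    (fun a => free_graded _ _ _) (fun a => @free_projective _ _) kdiff_ghom kaug_ghom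
    kaug_surj kaug_exact kdiff_exact.

Section Cochains.
Variable M : bimod k.
(** A bimodule map from the Koszul resolution is the tuple of its values on
    generators, and the Koszul differential acts on tuples through ad. *)
Definition kcodiff (a : nat) : ('I_(krank a) -> M) -> ('I_(krank a.+1) -> M) :=
  match a return ('I_(krank a) -> M) -> ('I_(krank a.+1) -> M) with
  | 0 => fun x j => ad j (x 0)
  | 1 => fun x _ => ad 0 (x 1) - ad 1 (x 0)
  | _ => fun _ => 0
  end.

Lemma kcodiff_lin a : linear (@kcodiff a).
Proof.
case: a => [|[|a]] c x y; apply: funext => j /=; rewrite !fctE.
- exact: ad_lin.
- by rewrite !ad_lin scalerBr opprD addrACA.
- by rewrite scaler0 addr0.
Qed.

Lemma bihom_kdiff a (f : kterm a -> M) : is_bihom f ->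
  (fun j => f (kdiff (gen k _ j))) = kcodiff (fun j => f (gen k _ j)).
Proof.
move=> hf; have fl : linear f by case: hf.
case: a f hf fl => [|[|a]] f hf fl; last by apply: funext => -[].
  apply: funext => j.
  rewrite (bihom_freeE _ hf) /= big_ord_recl big_ord0 addr0 -[LHS]/(eact _ _).
  have -> : 'X_(vD 0) * gen k 2 j 0 + 'X_(vD 1) * gen k 2 j 1 = 'X_(vD j) * 1.
    by have [->|->] := ord2 j; rewrite /gen /= mulr0 ?addr0 ?add0r.
  by rewrite eactD eact1.
apply: funext => j.
rewrite (bihom_freeE _ hf) /= !big_ord_recl big_ord0 addr0 (ord1 j) /gen /=.
by rewrite !(linN (eact_linl _)) !eactD !eact1 addrC.
Qed.
End Cochains.

Definition koszul_HH (M : gbimod k) (a : nat) (d : int) : subquot ('I_(krank a) -> M) :=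
  {| cyc := fun x => (forall j, piece ((2 * a)%:Z + d) (x j)) /\ kcodiff x = 0;
     bdy := match a return ('I_(krank a) -> M) -> Prop with
            | 0 => fun x => x = 0
            | b.+1 => fun x => exists2 y : 'I_(krank b) -> M,
                (forall j, piece ((2 * b)%:Z + d) (y j)) & x = kcodiff y
            end |}.

Definition koszul_HHH (C : cplx k) (a : nat) (i d : int) : subquot ('I_(krank a) -> C) :=
  cohomology (V := ('I_(krank a) -> C : lmodType k))
    (fun j => koszul_HH (cterm C j) a d) (fun x j => cdiff (x j)) i.

Lemma free_bihom_ext n e (M : bimod k) (f g : free k n e -> M) :
  is_bihom f -> is_bihom g -> (forall j, f (gen k e j) = g (gen k e j)) -> f =1 g.
Proof.
move=> hf hg h v; rewrite (bihom_freeE _ hf) (bihom_freeE _ hg).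
by apply: eq_bigr => j _; rewrite h.
Qed.

Lemma free_hom_lin n e (M : bimod k) :
  linear (fun x : 'I_n -> M => free_hom x : free k n e -> M).
Proof.
move=> c x y; apply: funext => v; rewrite ?fctE /free_hom scaler_sumr -big_split.
by apply: eq_bigr => j _ /=; rewrite ?fctE eact_linr.
Qed.

Lemma bihom_comp (M N L : bimod k) (f : M -> N) (g : N -> L) :
  is_bihom f -> is_bihom g -> is_bihom (g \o f).
Proof.
move=> [fl f2 f3] [gl g2 g3]; split.
- by move=> c x y /=; rewrite fl gl.
- by move=> p x /=; rewrite f2 g2.
- by move=> x p /=; rewrite f3 g3.
Qed.

Lemma free_hom_kcodiff (M : bimod k) a (x : 'I_(krank a) -> M) (v : kterm a.+1) :
  free_hom (kcodiff x) v = free_hom x (kdiff v).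
Proof.
have hx : is_bihom (free_hom x : kterm a -> M) := free_hom_bihom _ x.
move: v; apply: free_bihom_ext.
- exact: free_hom_bihom.
- exact: bihom_comp (proj1 (kdiff_ghom a)) hx.
move=> j; rewrite free_hom_gen.
have := congr1 (fun y => y j) (bihom_kdiff hx) => /= ->.
by congr (kcodiff _ j); apply: funext => i; rewrite free_hom_gen.
Qed.

Lemma graded_actions_shift n (M : gbimod k) : graded_actions M -> graded_actions (gshift n M).
Proof.
by move=> [aL aR]; split=> d f p x hp hx; rewrite /= -addrA; [apply: aL | apply: aR].
Qed.

Section KoszulHHH.
Variable C : cplx k.
Hypothesis aC : forall i, graded_actions (cterm C i).

Lemma koszul_bdy_subspace (M : gbimod k) a d : subspace (bdy (koszul_HH M a d)).
Proof.
case: a => [|a]; split=> /=.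
- by [].
- by move=> c x y -> ->; rewrite scaler0 addr0.
- by exists 0; [move=> j; apply: piece0 | rewrite (lin0 (@kcodiff_lin M a))].
move=> c x y [x' hx ->] [y' hy ->]; exists (c *: x' + y').
  by move=> j; rewrite ?fctE; apply: pieceP.
by rewrite kcodiff_lin.
Qed.

Lemma cdiff_fun_lin (T : Type) : linear (fun (x : T -> C) t => cdiff (x t)).
Proof.
by move=> c x y; apply: funext => t; have [dl _ _] := cdiff_bihom C; rewrite ?fctE dl.
Qed.

Lemma koszul_HHH_bdy_subspace a i d : subspace (bdy (koszul_HHH C a i d)).
Proof.
have [b0 bP] := koszul_bdy_subspace (cterm C i) a d.
have lD := @cdiff_fun_lin 'I_(krank a).
split.
  exists 0; last by rewrite (lin0 lD) subr0.
  by split; [move=> j; apply: (@piece0 k (cterm C _)) | exact: (lin0 (@kcodiff_lin _ a))].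
move=> c x y [x' [px dx] bx] [y' [py dy] b_y]; exists (c *: x' + y').
  split; first by move=> j; rewrite ?fctE; apply: (@pieceP k (cterm C _)).
  by rewrite (@kcodiff_lin C a) dx dy scaler0 addr0.
have -> : c *: x + y - (fun t => cdiff ((c *: x' + y') t)) =
    c *: (x - (fun t => cdiff (x' t))) + (y - (fun t => cdiff (y' t))).
  by rewrite lD scalerBr opprD addrACA.
exact: bP.
Qed.

Lemma koszul_HHH_equiv a i d :
  sq_equiv (HHH koszul C a i d) (koszul_HHH C a i d).
Proof.
have D_bihom := cdiff_bihom C.
pose F (f : kterm a -> C) := fun j => f (gen k (2 * a)%:Z j).
pose G (x : 'I_(krank a) -> C) : kterm a -> C := free_hom x.
have FG x : F (G x) = x by apply: funext => j; rewrite /F /G free_hom_gen.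
have F_bdy (M : gbimod k) b (f : kterm b -> M) : @ext_bdy k koszul (gshift d M) b f ->
    bdy (koszul_HH M b d) (fun j => f (gen k (2 * b)%:Z j)).
  case: b f => [|b] f /=; first by move=> f0; apply: funext => j; apply: f0.
  move=> [g [hg gP] fE]; exists (fun j => g (gen k (2 * b)%:Z j)).
    by move=> j; apply: gP; apply: gen_piece.
  by rewrite -(bihom_kdiff hg); apply: funext => j; rewrite fE.
have G_bdy (M : gbimod k) b (x : 'I_(krank b) -> M) : graded_actions M ->
    bdy (koszul_HH M b d) x -> @ext_bdy k koszul (gshift d M) b (free_hom x).
  move=> aM; case: b x => [|b] x /=.
    by move=> -> v; rewrite (lin0 (@free_hom_lin _ _ M)).
  move=> [y yP ->]; exists (free_hom y : kterm b -> M); last exact: free_hom_kcodiff.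
  by apply: free_hom_ghom => //; apply: graded_actions_shift.
have F_cyc j f : cyc (HH koszul (cterm C j) a d) f -> cyc (koszul_HH (cterm C j) a d) (F f).
  move=> [[hf fP] df]; split=> [t|]; first by apply: fP; apply: gen_piece.
  by rewrite /F -(bihom_kdiff hf); apply: funext => t; apply: df.
have G_cyc j x : cyc (koszul_HH (cterm C j) a d) x -> cyc (HH koszul (cterm C j) a d) (G x).
  move=> [xP dx]; split.
    by apply: free_hom_ghom => //; apply: graded_actions_shift.
  by move=> v; rewrite /G -free_hom_kcodiff dx (lin0 (@free_hom_lin _ _ _)).
have DG x : (fun v => cdiff (G x v)) = G (fun t => cdiff (x t)).
  apply: funext; apply: free_bihom_ext => [||j]; last by rewrite /= /G !free_hom_gen.
    by apply: bihom_comp => //; apply: free_hom_bihom.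
  exact: free_hom_bihom.
have lG : linear G by apply: free_hom_lin.
split; [exact: HHH_bdy_subspace | exact: koszul_HHH_bdy_subspace|].
exists F, G; split; split.
- by [].
- by move=> f [fc fb]; split; [exact: F_cyc | exact: (F_bdy (cterm C (i + 1)) a _ fb)].
- move=> f [g gc fb]; exists (F g); first exact: F_cyc.
  exact: (F_bdy (cterm C i) a _ fb).
- move=> f [[[hf _] _] _].
  have -> : G (F f) = f.
    apply: funext; apply: (free_bihom_ext (free_hom_bihom _ _) hf) => j.
    by rewrite free_hom_gen.
  by rewrite subrr; case: (HHH_bdy_subspace C koszul a i d).
- exact: lG.
- move=> x [xc xb]; split; first exact: G_cyc.
  by rewrite DG; apply: (G_bdy (cterm C (i + 1))).
- move=> x [y yc xb]; exists (G y); first exact: G_cyc.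
  by rewrite DG -(lin_sub _ _ lG); apply: (G_bdy (cterm C i)).
- by move=> x _; rewrite FG subrr; case: (koszul_HHH_bdy_subspace a i d).
Qed.
End KoszulHHH.
End Koszul.

(** * Sparse polynomials and vectors *)

Notation Q := QArith_base.Q.
Notation Qmake := QArith_base.Qmake.
Module PM := FMapPositive.PositiveMap.

Section Sparse.
Variables (K V : Type) (cmp : K -> K -> comparison) (addv : V -> V -> V) (nz : V -> bool).

(** Addition of sparse sums sorted by cmp, used for polynomials and for vectors.
    Its value is correct for unsorted arguments as well, so sortedness never has
    to be proved; it matters only for finding cancellations. *)
Fixpoint sadd (s t : seq (K * V)) {struct s} : seq (K * V) :=
  let fix aux (t : seq (K * V)) : seq (K * V) :=
    match s, t with
    | [::], _ => t
    | _, [::] => s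
    | (a, v) :: s', (b, w) :: t' =>
      match cmp a b with
      | Lt => (a, v) :: sadd s' t
      | Gt => (b, w) :: aux t'
      | Eq => let u := addv v w in if nz u then (a, u) :: sadd s' t' else sadd s' t'
      end
    end in aux t.

Lemma sadd_sum (W : zmodType) (F : K -> V -> W) s t :
  (forall a b, cmp a b = Eq -> a = b) -> (forall a v w, F a (addv v w) = F a v + F a w) ->
  (forall a v, ~~ nz v -> F a v = 0) ->
  \sum_(x <- sadd s t) F x.1 x.2 = \sum_(x <- s) F x.1 x.2 + \sum_(x <- t) F x.1 x.2.
Proof.
move=> cmpP FD F0; elim: s t => [|[a v] s IHs] t.
  by case: t => [|x t] /=; rewrite !big_nil ?add0r.
elim: t => [|[b w] t IHt]; first by rewrite /= big_nil addr0.
rewrite /=; case: (cmp a b) (@cmpP a b) => [/(_ erefl) ab|_|_].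
- subst b; have E : F a (addv v w) = F a v + F a w := FD _ _ _.
  case: ifP => [_|/negbT/F0 nzE]; rewrite !big_cons /= IHs.
    by rewrite E addrACA.
  by rewrite addrACA -E nzE add0r.
- by rewrite big_cons IHs !big_cons /= addrA.
- by move: IHt; rewrite !big_cons /= => ->; rewrite addrCA.
Qed.
End Sparse.

(** Integers, the bulk of the coefficients, bypass the reduction of fractions. *)
Definition cadd (a b : Q) : Q :=
  match a, b with
  | Qmake n xH, Qmake m xH => Qmake (BinInt.Z.add n m) xH
  | _, _ => Qreduction.Qred (QArith_base.Qplus a b) end.
Definition cmul (a b : Q) : Q :=
  match a, b with
  | Qmake n xH, Qmake m xH => Qmake (BinInt.Z.mul n m) xH
  | _, _ => Qreduction.Qred (QArith_base.Qmult a b) end.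
Definition cnz (a : Q) : bool := if a is Qmake Z0 _ then false else true.
Definition qnat (p : positive) : Q := Qmake (Zpos p) xH.
Definition qopp (a : Q) : Q := Qmake (BinInt.Z.opp (QArith_base.Qnum a)) (QArith_base.Qden a).
Definition qhalf : Q := Qmake (Zpos xH) (xO xH).

Definition poly := seq ((nat * nat) * Q).
Definition mcmp (a b : nat * nat) : comparison :=
  if PeanoNat.Nat.compare a.1 b.1 is Eq then PeanoNat.Nat.compare a.2 b.2
  else PeanoNat.Nat.compare a.1 b.1.
Definition padd : poly -> poly -> poly := sadd mcmp cadd cnz.
Definition mshift (m : nat * nat) (c : Q) (p : poly) : poly :=
  [seq ((addn m.1 t.1.1, addn m.2 t.1.2), cmul c t.2) | t <- p].
Definition pmul (p q : poly) : poly :=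
  foldr (fun t acc => padd (mshift t.1 t.2 q) acc) [::] p.
Definition pcst (c : Q) : poly := [:: ((O, O), c)].
Definition pX (u : bool) : poly := [:: ((if u then (O, S O) else (S O, O)), qnat xH)].

Definition svec := seq (positive * poly).
Definition vadd : svec -> svec -> svec := sadd BinPos.Pos.compare padd (fun p => ~~ nilp p).
(** The case singled out is p = 1, where nothing has to be multiplied. *)
Definition vscale (p : poly) (s : svec) : svec :=
  match p with
  | [:: ((O, O), Qmake (Zpos xH) xH)] => s
  | _ => [seq (t.1, pmul p t.2) | t <- s] end.
Arguments vscale : simpl never.
(** A matrix is the function giving its columns. *)
Definition app (A : positive -> svec) (s : svec) : svec :=
  foldr (fun t acc => vadd (vscale t.2 (A t.1)) acc) [::] s.
Definition svar (j : positive) : svec := [:: (j, pcst (qnat xH))].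
Definition vopp (s : svec) : svec := vscale (pcst (qopp (qnat xH))) s.
Definition reidx (f : positive -> positive) (s : svec) : svec := [seq (f t.1, t.2) | t <- s].

Section Semantics.
Variable k : fieldType.
Hypothesis char0 : [pchar k] =i pred0.

Definition zk (z : Z) : k := (int_of_Z z)%:~R.
Definition qk (q : Q) : k := zk (QArith_base.Qnum q) / zk (Zpos (QArith_base.Qden q)).

Lemma zkD a b : zk (BinInt.Z.add a b) = zk a + zk b.
Proof. by rewrite /zk -intrD; congr (_%:~R); apply: (rmorphD int_of_Z a b). Qed.
Lemma zkM a b : zk (BinInt.Z.mul a b) = zk a * zk b.
Proof. by rewrite /zk -intrM; congr (_%:~R); apply: (rmorphM int_of_Z a b). Qed.
Lemma zk_pos p : zk (Zpos p) != 0.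
Proof.
rewrite /zk /= -pmulrn.
have [n ->] := Pnat.Pos2Nat.is_succ p.
by rewrite ((pcharf0P _).1 char0).
Qed.
Lemma zkN a : zk (BinInt.Z.opp a) = - zk a.
Proof. by rewrite /zk -rmorphN; congr (_%:~R); apply: (rmorphN int_of_Z a). Qed.

Lemma qk_eq a b : QArith_base.Qeq a b -> qk a = qk b.
Proof.
move=> /(congr1 zk); rewrite !zkM => h; rewrite /qk.
by apply/eqP; rewrite eqr_div ?zk_pos // h.
Qed.

Lemma qk_red a : qk (Qreduction.Qred a) = qk a.
Proof. by apply: qk_eq; apply: Qreduction.Qred_correct. Qed.

Lemma qkD a b : qk (cadd a b) = qk a + qk b.
Proof.
have E : qk (QArith_base.Qplus a b) = qk a + qk b.
  case: a b => [n d] [m e]; rewrite /qk /= zkD !zkM -[Zpos (BinPos.Pos.mul d e)]/(BinInt.Z.mul (Zpos d) (Zpos e)).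
  by rewrite zkM addf_div ?zk_pos.
rewrite -E; case: a b {E} => [n [d|d|]] [m [e|e|]]; rewrite /cadd ?qk_red //.
by apply: qk_eq; rewrite /QArith_base.Qeq /= !BinInt.Z.mul_1_r.
Qed.

Lemma qkM a b : qk (cmul a b) = qk a * qk b.
Proof.
have E : qk (QArith_base.Qmult a b) = qk a * qk b.
  case: a b => [n d] [m e]; rewrite /qk /= !zkM -[Zpos (BinPos.Pos.mul d e)]/(BinInt.Z.mul (Zpos d) (Zpos e)).
  by rewrite zkM mulf_div.
by rewrite -E; case: a b {E} => [n [d|d|]] [m [e|e|]]; rewrite /cmul ?qk_red.
Qed.

Lemma qk1 : qk (qnat xH) = 1.
Proof. by rewrite /qk /= divr1. Qed.
Lemma qkN a : qk (qopp a) = - qk a.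
Proof. by rewrite /qk /= zkN mulNr. Qed.
Lemma qk_half : qk qhalf = 2^-1.
Proof. by rewrite /qk /= div1r. Qed.
Lemma cnzP a : ~~ cnz a -> qk a = 0.
Proof. by case: a => -[|p|p] d //= _; rewrite /qk mul0r. Qed.

Lemma mcmpP a b : mcmp a b = Eq -> a = b.
Proof.
case: a b => [a a'] [b b']; rewrite /mcmp /=.
case E: (PeanoNat.Nat.compare a b) => //; move/PeanoNat.Nat.compare_eq: E => -> /=.
by move/PeanoNat.Nat.compare_eq ->.
Qed.

Notation R := (polyR k).
Definition mono_k (m : nat * nat) : R := 'X_0 ^+ m.1 * 'X_1 ^+ m.2.
Definition peval (p : poly) : R := \sum_(t <- p) qk t.2 *: mono_k t.1.

Lemma peval_nil : peval [::] = 0. Proof. exact: big_nil. Qed.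

Lemma pevalD p q : peval (padd p q) = peval p + peval q.
Proof.
apply: (@sadd_sum _ _ mcmp cadd cnz R (fun m c => qk c *: mono_k m) p q mcmpP).
  by move=> m c d; rewrite qkD scalerDl.
by move=> m c /cnzP ->; rewrite scale0r.
Qed.

Lemma peval_shift m c p : peval (mshift m c p) = qk c *: mono_k m * peval p.
Proof.
rewrite /peval big_map mulr_sumr; apply: eq_bigr => t _.
rewrite qkM -scalerAl -scalerAr scalerA; congr (_ *: _).
by rewrite /mono_k !exprD mulrACA.
Qed.

Lemma pevalM p q : peval (pmul p q) = peval p * peval q.
Proof.
elim: p => [|t p IH] /=; first by rewrite !peval_nil mul0r.
by rewrite pevalD IH peval_shift [peval (t :: p)]big_cons mulrDl.
Qed.

Lemma peval_cst c : peval (pcst c) = (qk c)%:MP.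
Proof. by rewrite /peval big_seq1 /mono_k !expr0 mulr1 -mul_mpolyC mulr1. Qed.
Lemma peval1 : peval (pcst (qnat xH)) = 1.
Proof. by rewrite peval_cst qk1. Qed.
Lemma pevalN1 : peval (pcst (qopp (qnat xH))) = -1.
Proof. by rewrite peval_cst qkN qk1 rmorphN rmorph1. Qed.
Definition ord_of (u : bool) : 'I_2 := if u then 1 else 0.
Lemma pevalX u : peval (pX u) = 'X_(ord_of u).
Proof. by rewrite /peval big_seq1 qk1 scale1r /mono_k; case: u; rewrite ?expr0 ?expr1 ?mul1r ?mulr1. Qed.

Section Vectors.
Variables (M : bimod k).
Implicit Types (e : positive -> M) (s : svec).
(** The combination of the family e, in an arbitrary bimodule, with coefficients s
    acting on the left. *)
Definition sv e s : M := \sum_(t <- s) lact (peval t.2) (e t.1).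

Lemma sv_nil e : sv e [::] = 0. Proof. exact: big_nil. Qed.
Lemma sv_cons e (t : positive * poly) s : sv e (t :: s) = lact (peval t.2) (e t.1) + sv e s.
Proof. exact: big_cons. Qed.

Lemma svD e s (t : svec) : sv e (vadd s t) = sv e s + sv e t.
Proof.
apply: (@sadd_sum _ _ BinPos.Pos.compare padd _ M (fun j p => lact (peval p) (e j))).
- exact: BinPos.Pos.compare_eq.
- by move=> j p q; rewrite pevalD (linD (lact_linl _)).
by move=> j p; rewrite negbK => /nilP ->; rewrite peval_nil (lin0 (lact_linl _)).
Qed.

Lemma svZ e p s : sv e (vscale p s) = lact (peval p) (sv e s).
Proof.
have E : sv e [seq (t.1, pmul p t.2) | t <- s] = lact (peval p) (sv e s).
  rewrite /sv big_map (lin_bigsum _ _ (lact_linr _)); apply: eq_bigr => t _ /=.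
  by rewrite pevalM lactM.
rewrite /vscale; case: p E => [|[[[|m] [|m']] [[|[d|d|]|d] [d'|d'|]]] [|t p]] E //=.
by rewrite peval1 lact1.
Qed.

Lemma sv_var e j : sv e (svar j) = e j.
Proof. by rewrite sv_cons sv_nil addr0 peval1 lact1. Qed.

Lemma sv_app e A s : sv e (app A s) = sv (fun j => sv e (A j)) s.
Proof.
elim: s => [|t s IH] /=; first by rewrite !sv_nil.
by rewrite svD svZ IH sv_cons.
Qed.

Lemma sv_opp e s : sv e (vopp s) = - sv e s.
Proof. by rewrite svZ pevalN1 (linN (lact_linl _)) lact1. Qed.

Lemma sv_reidx e f s : sv e (reidx f s) = sv (e \o f) s.
Proof. by rewrite /sv big_map. Qed.

End Vectors.

End Semantics.

(** * Complexes with a left basis *)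

Fact positive_eqP : Equality.axiom BinPos.Pos.eqb.
Proof. by move=> a b; apply: (iffP idP) => /BinPos.Pos.eqb_eq. Qed.
HB.instance Definition _ := hasDecEq.Build positive positive_eqP.

Definition tabulate (T : Type) (ix : seq positive) (f : positive -> T) : PM.t T :=
  foldr (fun j m => PM.add j (f j) m) (PM.empty _) ix.

Lemma tabulateE (T : Type) ix (f : positive -> T) j :
  PM.find j (tabulate ix f) = if j \in ix then Some (f j) else None.
Proof.
elim: ix => [|i ix IH] /=; first by rewrite PM.gempty.
rewrite inE; have [->|ne] := eqVneq j i; first by rewrite PM.gss.
by rewrite PM.gso //; apply/eqP.
Qed.

Definition look (m : PM.t svec) (j : positive) : svec :=
  if PM.find j m is Some s then s else [::].
(** A column table stored in a binary trie, so that columns are computed once.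
    Outside ix its columns are empty, which lets matrices be composed on vectors
    without any condition on their support. *)
Definition memo ix f := look (tabulate ix f).

Lemma memoE ix f j : memo ix f j = if j \in ix then f j else [::].
Proof. by rewrite /memo /look tabulateE; case: ifP. Qed.

(** A complex with a finite basis as a left R-module: degrees of the basis vectors
    (cohomological, internal), matrices of right multiplication by the two
    variables, and the matrix of the differential. *)
Record mdata := MData {
  m_ix : seq positive;
  m_deg : positive -> int * int;
  m_r : bool -> positive -> svec;
  m_d : positive -> svec
}.

(** Basis vectors of an iterated tensor product are words in the letters 1, 2, 3,
    one for each factor, read as digits in base 4. *)
Definition enc (j l : positive) : positive :=
  match l with xH => xI (xO j) | xO _ => xO (xI j) | xI _ => xI (xI j) end.
Definition dec (m : positive) : positive * positive :=
  match m with
  | xI (xO j) => (j, xH) | xO (xI j) => (j, xO xH) | xI (xI j) => (j, xI xH)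
  | _ => (m, xH) end.
Definition three : seq positive := [:: xH; xO xH; xI xH].

Lemma encK j l : l \in three -> dec (enc j l) = (j, l).
Proof. by rewrite !inE => /or3P[] /eqP ->. Qed.

(** Right multiplication by the polynomial q, from the matrices r of right
    multiplication by the variables. *)
Definition rho (r : bool -> positive -> svec) (q : poly) (s : svec) : svec :=
  foldr (fun t acc => vadd (vscale (pcst t.2)
     (iter t.1.2 (app (r true)) (iter t.1.1 (app (r false)) s))) acc) [::] q.

(** Coordinates of e_j (x) s for a vector s of the second factor: a coefficient q
    of s passes through the tensor sign, e_j (x) q f = e_j q (x) f, and becomes a
    right multiplication on e_j. *)
Definition tens_right r (s : svec) (j : positive) : svec :=
  foldr (fun t acc => vadd (reidx (enc^~ t.1) (rho r t.2 (svar j))) acc) [::] s.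

Definition mtens (M N : mdata) : mdata :=
  let ix := [seq enc j l | j <- m_ix M, l <- m_ix N] in
  let r0 := memo ix (fun m => tens_right (m_r M) (m_r N false (dec m).2) (dec m).1) in
  let r1 := memo ix (fun m => tens_right (m_r M) (m_r N true (dec m).2) (dec m).1) in
  let d := memo ix (fun m => let: (j, l) := dec m in
    vadd (reidx (enc^~ l) (m_d M j))
      (vscale (pcst (if odd `|(m_deg M j).1| then qopp (qnat xH) else qnat xH))
        (tens_right (m_r M) (m_d N l) j))) in
  {| m_ix := ix;
     m_deg := fun m => let: (j, l) := dec m in
       ((m_deg M j).1 + (m_deg N l).1, (m_deg M j).2 + (m_deg N l).2);
     m_r := fun v => if v then r1 else r0;
     m_d := d |}.

Section Models.
Variable k : fieldType.
Hypothesis char0 : [pchar k] =i pred0.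
Notation R := (polyR k).

(** M describes C with respect to the left basis e with coordinates co.  Basis
    vectors are zero outside the index set, so that the formulas for right
    multiplication and for the differential hold at every index. *)
Record is_model (C : cplx k) (M : mdata) (e : positive -> C) (co : C -> positive -> R) : Prop :=
  IsModel {
  mo_uniq : uniq (m_ix M);
  mo_lin : forall j, linear (co^~ j);
  mo_lact : forall p x j, co (lact p x) j = p * co x j;
  mo_decomp : forall x, x = \sum_(j <- m_ix M) lact (co x j) (e j);
  mo_dual : forall i j, i \in m_ix M -> j \in m_ix M -> co (e i) j = (i == j)%:R;
  mo_out : forall j, j \notin m_ix M -> e j = 0;
  mo_r : forall v j, ract (e j) 'X_(ord_of v) = sv e (m_r M v j);
  mo_d : forall j, cdiff (e j) = sv e (m_d M j);
  mo_piece : forall i d x, cpiece i d x <-> forall j, j \in m_ix M ->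
    if (m_deg M j).1 == i then regular_piece (d - (m_deg M j).2) (co x j) else co x j = 0;
  mo_ract : forall i d f q x, regular_piece f q -> cpiece i d x ->
    cpiece (c0 := C) i (f + d) (ract x q)
}.

Lemma lact_cst (B : bimod k) c (x : B) : lact c%:MP x = c *: x.
Proof. by rewrite -[c%:MP]mulr1 mul_mpolyC (linZ (lact_linl x)) lact1. Qed.

Section One.
Variables (C : cplx k) (M : mdata) (e : positive -> C) (co : C -> positive -> R).
Hypothesis mo : is_model M e co.

Lemma mo_basis_piece q d j : j \in m_ix M -> regular_piece d q ->
  cpiece (m_deg M j).1 (d + (m_deg M j).2) (lact q (e j)).
Proof.
move=> hj hq; apply/(mo_piece mo) => i hi; rewrite (mo_lact mo) (mo_dual mo) //.
have [<-|ne] := eqVneq j i; first by rewrite eqxx mulr1 addrK.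
by rewrite mulr0; case: ifP => // _; apply: regular_piece0.
Qed.

Lemma mo_sgn j : j \in m_ix M -> csgn (e j) = ((-1) ^ (m_deg M j).1 : k) *: e j.
Proof.
move=> hj; have := mo_basis_piece hj (@regular_piece1 k).
by rewrite lact1 => /csgn_piece.
Qed.

Lemma mo_lactp d i f q (x : C) : regular_piece f q -> cpiece i d x -> cpiece i (f + d) (lact q x).
Proof.
move=> hq /(mo_piece mo) hx; apply/(mo_piece mo) => j hj; have := hx j hj.
rewrite (mo_lact mo); case: ifP => _; last by move=> ->; rewrite mulr0.
by rewrite -addrA; apply: regular_pieceM.
Qed.

Lemma rhoE q s : sv e (rho (m_r M) q s) = ract (sv e s) (peval k q).
Proof.
have step v t : sv e (app (m_r M v) t) = ract (sv e t) 'X_(ord_of v).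
  rewrite (sv_app char0) /sv (lin_bigsum _ _ (ract_linl _)); apply: eq_bigr => u _.
  by rewrite -/(sv _ _) -(mo_r mo) lractC.
have steps v n t : sv e (iter n (app (m_r M v)) t) = ract (sv e t) ('X_(ord_of v) ^+ n).
  by elim: n => [|n IH] /=; rewrite ?expr0 ?ract1 // step IH exprSr ractM.
elim: q => [|t q IH] /=; first by rewrite !(sv_nil, peval_nil) (lin0 (ract_linr _)).
rewrite (svD char0) IH (svZ char0) peval_cst [peval k (t :: q)]big_cons (linD (ract_linr _)).
congr (_ + _).
rewrite !steps /mono_k (linZ (ract_linr _)) ractM lact_cst.
by [].
Qed.
End One.

Section TensorModel.
Variables (C D : cplx k) (M N : mdata).
Variables (e : positive -> C) (co : C -> positive -> R).
Variables (f : positive -> D) (cn : D -> positive -> R).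
Hypothesis mC : is_model M e co.
Hypothesis mD : is_model N f cn.
Hypothesis N_ix : {subset m_ix N <= three}.
Hypothesis N_r : forall v l, all (fun t => t.1 \in m_ix N) (m_r N v l).
Hypothesis N_d : forall l, all (fun t => t.1 \in m_ix N) (m_d N l).

Notation A := (fun _ : R => True).
Notation T := (mtens M N).
Notation bT := (tensor A C D).

Let bal := pure_balanced A C D.
Let pl n : linear (fun m => pure A m n : bT). Proof. by case: bal. Qed.
Let pr m : linear (fun n => pure A m n : bT). Proof. by case: bal. Qed.

Lemma pure_mid (m : C) q (n : D) : pure A m (lact q n) = pure A (ract m q) n :> bT.
Proof. by case: bal => _ _ ->. Qed.

Definition tens_basis (m : positive) : ctensor C D :=
  if m \in m_ix T then pure A (e (dec m).1) (f (dec m).2) else 0.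

Definition tens_coord (x : ctensor C D) (m : positive) : R :=
  tens_lift (T := R : lmodType k)
    (fun (c : C) (n : D) => co (ract c (cn n (dec m).2)) (dec m).1) x.

Lemma tens_coord_bal m : balanced (T := R : lmodType k) A
  (fun (c : C) (n : D) => co (ract c (cn n (dec m).2)) (dec m).1).
Proof.
split=> [n a x y|c a x y|c a n _].
- by rewrite ract_linl (mo_lin mC).
- by rewrite (mo_lin mD) ract_linr (mo_lin mC).
- by rewrite (mo_lact mD) ractM.
Qed.

Lemma tens_coordE c n m :
  tens_coord (pure A c n) m = co (ract c (cn n (dec m).2)) (dec m).1.
Proof. exact: (tens_liftE (tens_coord_bal m)). Qed.

Lemma tens_coord_lin m : linear (tens_coord^~ m).
Proof. exact: (tens_lift_lin (tens_coord_bal m)). Qed.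

Lemma tens_ixP m : reflect (exists j l, [/\ j \in m_ix M, l \in m_ix N & m = enc j l])
  (m \in m_ix T).
Proof.
apply: (iffP allpairsP) => [[[j l] /= [hj hl ->]]|[j [l [hj hl ->]]]]; first by exists j, l.
by exists (j, l).
Qed.

Lemma decE j l : l \in m_ix N -> dec (enc j l) = (j, l).
Proof. by move/N_ix; apply: encK. Qed.

Lemma tens_basisE j l : l \in m_ix N -> tens_basis (enc j l) = pure A (e j) (f l).
Proof.
move=> hl; rewrite /tens_basis decE //; case: tens_ixP => [//|h] /=.
have hj : j \notin m_ix M by apply: contra_notN h => hj; exists j, l.
by rewrite (mo_out mC hj) (lin0 (pl _)).
Qed.

Lemma tens_ix_uniq : uniq (m_ix T).
Proof.
apply: allpairs_uniq; [exact: (mo_uniq mC) | exact: (mo_uniq mD)|].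
move=> [j l] [j' l'] /allpairsP[[a b] /= [_ hb [-> ->]]] /allpairsP[[a' b'] /= [_ hb' [-> ->]]].
by move=> /(congr1 dec); rewrite !decE.
Qed.

Lemma big_tens_ix (V : zmodType) (F : positive -> V) :
  \sum_(m <- m_ix T) F m = \sum_(j <- m_ix M) \sum_(l <- m_ix N) F (enc j l).
Proof. by rewrite big_allpairs_dep. Qed.

Lemma lact_pure p (c : C) (n : D) : lact (b := bT) p (pure A c n) = pure A (lact p c) n.
Proof. exact: tens_lactE. Qed.
Lemma ract_pure p (c : C) (n : D) : ract (b := bT) (pure A c n) p = pure A c (ract n p).
Proof. exact: tens_ractE. Qed.

Lemma sv_pure s n : pure A (sv e s) n = sv (fun j => pure A (e j) n : bT) s.
Proof.
rewrite /sv (lin_bigsum _ _ (pl n)); apply: eq_bigr => t _.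
by rewrite lact_pure.
Qed.

Lemma sv_tens_right s j : all (fun t => t.1 \in m_ix N) s ->
  sv tens_basis (tens_right (m_r M) s j) = pure A (e j) (sv f s).
Proof.
elim: s => [|t s IH] /=; first by rewrite !sv_nil (lin0 (pr _)).
move=> /andP[ht hs]; rewrite (svD char0) IH //.
rewrite sv_cons (linD (pr _)); congr (_ + _).
rewrite pure_mid sv_reidx -(sv_var e j) -(rhoE mC) sv_pure.
by apply: eq_bigr => u _; rewrite /= tens_basisE.
Qed.

Lemma sign_scalar (i : int) :
  ((-1) ^ i : k) = qk k (if odd `|i| then qopp (qnat xH) else qnat xH).
Proof.
have -> : ((-1) ^ i : k) = (-1) ^+ odd `|i|.
  by rewrite signr_odd; case: i => n //; rewrite /exprz -exprVn invrN1.
by case: odd; rewrite ?qkN qk1 ?expr1.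
Qed.

(** The products e_j (x) f_l form a left basis: expanding n in c (x) n over the f_l
    and moving the coefficients across turns c into right multiples of c, which
    are then expanded over the e_j. *)
Lemma tens_model : is_model (C := ctensor C D) T tens_basis tens_coord.
Proof.
have ll p : linear (lact (b := bT) p) by exact: lact_linr.
have lr p : linear ((@ract _ bT)^~ p) by exact: ract_linl.
have coord_lact p x m : tens_coord (lact (b := bT) p x) m = p * tens_coord x m.
  move: x; apply: tens_lin_ext => [c x y|c x y|c n].
  - by rewrite ll tens_coord_lin.
  - by rewrite tens_coord_lin mulrDr scalerAr.
  by rewrite lact_pure !tens_coordE -lractC (mo_lact mC).
have decomp x : x = \sum_(m <- m_ix T) lact (b := bT) (tens_coord x m) (tens_basis m).
  rewrite big_tens_ix; move: x.
  have lin_l j l : linear (fun x => lact (b := bT) (tens_coord x (enc j l)) (tens_basis (enc j l))).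
    by move=> c x y; rewrite tens_coord_lin lact_linl.
  apply: tens_lin_ext => [//|c x y|c n].
    rewrite scaler_sumr -big_split; apply: eq_bigr => j _.
    by rewrite scaler_sumr -big_split; apply: eq_bigr => l _; apply: lin_l.
  rewrite {1}(mo_decomp mD n) (lin_bigsum _ _ (pr _)) exchange_big [LHS]big_seq [RHS]big_seq.
  apply: eq_bigr => l hl; rewrite pure_mid {1}(mo_decomp mC (ract c _)) (lin_bigsum _ _ (pl _)).
  by apply: eq_bigr => j _; rewrite tens_basisE // tens_coordE decE // lact_pure.
split.
- exact: tens_ix_uniq.
- exact: tens_coord_lin.
- exact: coord_lact.
- exact: decomp.
- move=> _ _ /tens_ixP[j [l [hj hl ->]]] /tens_ixP[j' [l' [hj' hl' ->]]].
  rewrite tens_basisE // tens_coordE decE //= (mo_dual mD) //.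
  have [<-|ne] := eqVneq l l'; last first.
    rewrite (lin0 (ract_linr _)) (lin0 (mo_lin mC _)); case: eqP => // /(congr1 dec).
    by rewrite !decE // => -[_ E]; rewrite E eqxx in ne.
  rewrite ract1 (mo_dual mC) //; congr (nat_of_bool _)%:R; apply/eqP/eqP => [->//|].
  by move=> /(congr1 dec); rewrite !decE // => -[].
- by move=> m /negPf; rewrite /tens_basis => ->.
- move=> v m.
  have -> : m_r T v m = if m \in m_ix T then tens_right (m_r M) (m_r N v (dec m).2) (dec m).1 else [::].
    by case: v; apply: memoE.
  case: ifP => [|/negbT hm]; last first.
    by rewrite sv_nil /tens_basis (negPf hm) (lin0 (lr _)).
  case/tens_ixP => j [l [hj hl ->]].
  rewrite tens_basisE // decE // sv_tens_right; last exact: N_r.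
  by rewrite ract_pure (mo_r mD).
- move=> m.
  rewrite [m_d T m]memoE; case: ifP => [|/negbT hm]; last first.
    have [dl _ _] := ctens_diff_bihom C D.
    by rewrite sv_nil /tens_basis (negPf hm) [LHS](lin0 dl).
  case/tens_ixP => j [l [hj hl ->]].
  rewrite tens_basisE // decE // (svD char0) sv_reidx (svZ char0) peval_cst -sign_scalar.
  rewrite sv_tens_right; last exact: N_d.
  rewrite [LHS]ctens_diffE (mo_d mC) (mo_d mD) (mo_sgn mC hj) sv_pure lact_cst (linZ (pl _)).
  by congr (_ + _); apply: eq_bigr => t _; rewrite /= tens_basisE.
- move=> i d x; split=> [|h].
  + elim=> [|c {}x y [i1 [i2 [d1 [d2 [m [n [-> -> hm hn ->]]]]]]] _ IH] z hz.
      by rewrite (lin0 (tens_coord_lin _)); case: ifP => // _; apply: regular_piece0.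
    have := IH z hz; rewrite tens_coord_lin.
    suff : if (m_deg T z).1 == i1 + i2 then regular_piece (d1 + d2 - (m_deg T z).2)
        (tens_coord (pure A m n) z) else tens_coord (pure A m n) z = 0.
      case: ifP => _; first exact: regular_pieceP.
      by move=> -> ->; rewrite scaler0 addr0.
    case/tens_ixP: hz => j [l [hj hl ->]].
    rewrite tens_coordE /= decE //=; have := (mo_piece mD _ _ _).1 hn l hl.
    case: eqP => [->|ne] hq; last first.
      rewrite hq (lin0 (ract_linr _)) (lin0 (mo_lin mC _)).
      by case: ifP => // _; apply: regular_piece0.
    have := (mo_piece mC _ _ _).1 (mo_ract mC hq hm) j hj.
    rewrite (inj_eq (addIr i2)); case: ifP => // _.
    by rewrite opprD [d2 - _ + _]addrC -!addrA [- (m_deg N l).2 + _]addrC.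
  + rewrite (decomp x).
      rewrite big_seq; apply: (piece_sum (M := cterm (ctensor C D) i)) => m hm.
      have := h m hm; case/tens_ixP: hm => j [l [hj hl ->]].
      rewrite /= tens_basisE // decE //=; case: eqP => [<-|_ ->]; last first.
        by rewrite (lin0 (tens_lact_linl _)); apply: lspan0.
      move=> hq; apply: lspan_incl; rewrite tens_lactE.
      exists (m_deg M j).1, (m_deg N l).1, (d - (m_deg N l).2), (m_deg N l).2,
         (lact (tens_coord x (enc j l)) (e j)), (f l).
      split=> //; first by rewrite subrK.
        have := mo_basis_piece mC hj hq.
        by rewrite opprD [- _ - _]addrC addrA subrK.
      by have := mo_basis_piece mD hl (@regular_piece1 k); rewrite lact1 add0r.
- move=> i d g q x hq; elim=> [|c {}x y [i1 [i2 [d1 [d2 [m [n [-> -> hm hn ->]]]]]]] _ IH].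
    by rewrite (lin0 (lr _)); apply: lspan0.
  rewrite lr; apply: lspanD => //.
  exists i1, i2, d1, (g + d2), m, (ract n q); split=> //; first by rewrite addrCA.
    exact: (mo_ract mD).
  exact: ract_pure.
Qed.
End TensorModel.
End Models.

(** * Demazure coordinates on B_u *)

Notation i1 := xH.
Notation i2 := (xO xH).
Notation i3 := (xI xH).

(** Columns of right multiplication by alpha_v on the left basis 1 (x) 1,
    1 (x) alpha_u of B_u, placed at positions a and b.  They come from moving
    invariants across: alpha_u^2 for v = u, and alpha_v + alpha_u / 2 for v
    distinct from u. *)
Definition bs_r (u v : bool) (a b : positive) : svec * svec :=
  let x := pX u in let x2 := pmul x x in
  if u == v then (svar b, [:: (a, x2)])
  else let y := padd (pX v) (pmul (pcst qhalf) x) in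
       ([:: (a, y); (b, pcst (qopp qhalf))], [:: (a, pmul (pcst (qopp qhalf)) x2); (b, y)]).

Definition m_rouquier (u : bool) : mdata :=
  {| m_ix := three;
     m_deg := fun j => match j with xH => (0, -1) | xO _ => (0, 1) | xI _ => (1, -1) end;
     m_r := fun v j => match j with
       | i1 => (bs_r u v i1 i2).1 | i2 => (bs_r u v i1 i2).2 | i3 => [:: (i3, pX v)] | _ => [::] end;
     m_d := fun j => match j with
       | i1 => svar i3 | i2 => [:: (i3, pX u)] | _ => [::] end |}.

Definition m_rouquier_inv (u : bool) : mdata :=
  {| m_ix := three;
     m_deg := fun j => match j with xH => (-1, 1) | xO _ => (0, -1) | xI _ => (0, 1) end;
     m_r := fun v j => match j with
       | i1 => [:: (i1, pX v)] | i2 => (bs_r u v i2 i3).1 | i3 => (bs_r u v i2 i3).2 | _ => [::] end;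
     m_d := fun j => match j with
       | i1 => [:: (i2, pmul (pcst qhalf) (pX u)); (i3, pcst qhalf)] | _ => [::] end |}.

Section Demazure.
Variable k : fieldType.
Hypothesis char0 : [pchar k] =i pred0.
Notation R := (polyR k).
Variable u : 'I_2.
Notation inv := (@Defs.invariant k u).
Notation s := (reflection u).

Lemma two_neq0 : (2 : k) != 0.
Proof. by rewrite -[2]/(2%:R) ((pcharf0P _).1 char0). Qed.

Lemma refl_lin : linear (s : R -> R).
Proof. by move=> c p q; rewrite /reflection comp_mpolyD comp_mpolyZ. Qed.
Lemma reflM (p q : R) : s (p * q) = s p * s q. Proof. exact: rmorphM. Qed.
Lemma refl1 : s (1 : R) = 1. Proof. exact: comp_mpoly1. Qed.
Lemma reflX v : s ('X_v : R) = if v == u then - 'X_u else 'X_u + 'X_v.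
Proof. by rewrite /reflection comp_mpolyXU -tnth_nth tnth_mktuple. Qed.

Lemma refl_homdeg d (p : R) : homdeg d p -> homdeg d (s p).
Proof.
apply: homdeg_comp => i; rewrite tnth_mktuple; case: eqP => _.
  by rewrite -scaleN1r; apply: homdegZ; apply: homdegU.
by apply: homdegD; apply: homdegU.
Qed.

Lemma reflK (p : R) : s (s p) = p.
Proof.
move: p; apply: mpoly_gen_ind => [||c p q hp hq|v p hp].
- by rewrite !(lin0 refl_lin).
- by rewrite !refl1.
- by rewrite !refl_lin hp hq.
rewrite !reflM hp; congr (_ * _); rewrite reflX; case: eqP => [->|/eqP ne].
  by rewrite (linN refl_lin) reflX eqxx opprK.
by rewrite (linD refl_lin) !reflX eqxx (negPf ne) addKr.
Qed.

Lemma refl_sub_div (p : R) : 'X_u * mdivX u (p - s p) = p - s p.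
Proof.
suff [q ->] : exists q, p - s p = 'X_u * q by rewrite mdivX_mul.
move: p; apply: mpoly_gen_ind => [||c p q [p' hp] [q' hq]|v p [p' hp]].
- by exists 0; rewrite (lin0 refl_lin) subr0 mulr0.
- by exists 0; rewrite refl1 subrr mulr0.
- exists (c *: p' + q'); rewrite refl_lin mulrDr -scalerAr -hp -hq scalerBr opprD.
  by rewrite addrACA.
have -> : 'X_v * p - s ('X_v * p) = ('X_v - s 'X_v) * p + s 'X_v * (p - s p).
  by rewrite reflM mulrBl mulrBr addrA subrK.
rewrite hp mulrCA reflX; case: eqP => [->|_].
  by exists (p *+ 2 + - 'X_u * p'); rewrite mulrDr opprK mulrnAr mulrDl mulr2n.
exists (- p + ('X_u + 'X_v) * p'); rewrite mulrDr mulrN; congr (_ + _).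
by rewrite opprD addrCA subrr addr0 mulNr.
Qed.

(** dem1 is half the Demazure operator (p - s p) / alpha_u.  The two together are
    the coordinates of R over the u-invariants in the basis 1, alpha_u. *)
Definition dem1 (p : R) : R := 2^-1 *: mdivX u (p - s p).
Definition dem0 (p : R) : R := p - 'X_u * dem1 p.

Lemma dem1_lin : linear dem1.
Proof.
move=> c p q; rewrite /dem1 refl_lin opprD addrACA -scalerBr mdivX_linear scalerDr.
by rewrite !scalerA mulrC.
Qed.
Lemma dem0_lin : linear dem0.
Proof. by move=> c p q; rewrite /dem0 dem1_lin mulrDr -scalerAr opprD addrACA scalerBr. Qed.

Lemma dem_sum p : p = dem0 p + 'X_u * dem1 p. Proof. by rewrite subrK. Qed.

Lemma dem1_inv p : inv (dem1 p).
Proof.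
apply: (mulfI (X_neq0 k u)).
have E : 'X_u * dem1 p = 2^-1 *: (p - s p) by rewrite -scalerAr refl_sub_div.
have := congr1 s E; rewrite reflM reflX eqxx (linZ refl_lin _ (p - s p)) (lin_sub _ _ refl_lin) reflK.
by rewrite mulNr => /eqP; rewrite eqr_oppLR -scalerN opprB -E => /eqP.
Qed.

Lemma dem0_inv p : inv (dem0 p).
Proof.
rewrite /Defs.invariant (lin_sub _ _ refl_lin) reflM reflX eqxx dem1_inv mulNr opprK.
have E : 'X_u * dem1 p = 2^-1 *: (p - s p) by rewrite -scalerAr refl_sub_div.
rewrite /dem0 E; apply/eqP; rewrite eq_sym subr_eq -addrA -scalerDl.
have -> : 2^-1 + 2^-1 = 1 :> k by rewrite -mulr2n -[LHS]mulr_natr mulVf ?two_neq0.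
by rewrite scale1r addrC subrK.
Qed.

Lemma dem_uniq p a b : inv a -> inv b -> p = a + 'X_u * b -> dem0 p = a /\ dem1 p = b.
Proof.
move=> ia ib E; suff E1 : dem1 p = b by rewrite /dem0 E1 {1}E addrK.
apply: (mulfI (X_neq0 k u)).
have -> : 'X_u * dem1 p = 2^-1 *: (p - s p) by rewrite -scalerAr refl_sub_div.
rewrite E (linD refl_lin) reflM reflX eqxx ia ib mulNr opprD opprK addrACA subrr add0r.
by rewrite -mulr2n -scaler_nat scalerA mulVf ?two_neq0 // scale1r.
Qed.

Lemma invM a b : inv a -> inv b -> inv (a * b).
Proof. by move=> ia ib; rewrite /Defs.invariant reflM ia ib. Qed.
Lemma inv0 : inv (0 : R). Proof. exact: (lin0 refl_lin). Qed.
Lemma inv1 : inv (1 : R). Proof. exact: refl1. Qed.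

(** Linearity over the invariants makes p (x) q |-> p dem0 q and p dem1 q
    balanced; these are the left coordinates on B_u. *)
Lemma dem_inv_mul a p : inv a -> dem0 (a * p) = a * dem0 p /\ dem1 (a * p) = a * dem1 p.
Proof.
move=> ia; apply: dem_uniq; try by apply: invM => //; [exact: dem0_inv | exact: dem1_inv].
- by apply: invM => //; apply: dem0_inv.
- by apply: invM => //; apply: dem1_inv.
by rewrite {1}(dem_sum p) mulrDr mulrCA.
Qed.

Lemma dem1_homdeg d p : homdeg d p -> homdeg (d - 2) (dem1 p).
Proof.
move=> hp; apply: homdegZ; apply: mdivX_homdeg; rewrite -scaleN1r; apply: homdegD => //.
by apply: homdegZ; apply: refl_homdeg.
Qed.
Lemma dem0_homdeg d p : homdeg d p -> homdeg d (dem0 p).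
Proof.
move=> hp; rewrite /dem0 -scaleN1r; apply: homdegD => //; apply: homdegZ.
by rewrite -[d](subrK 2) addrC; apply: homdegM; [exact: homdegU | exact: dem1_homdeg].
Qed.

Notation B := (bs k u).
Notation pu := (pure (M := regular k) (N := regular k) (Defs.invariant u)).

Definition bs0 : B := pu 1 1.
Definition bs1 : B := pu 1 'X_u.

Lemma bs_c_bal (dem : R -> R) : linear dem -> (forall a p, inv a -> dem (a * p) = a * dem p) ->
  balanced (M := regular k) (N := regular k) (T := R : lmodType k) inv
    (fun p q => p * dem q).
Proof.
move=> ld dM; split=> [q c x y|p c x y|p a q ia] /=.
- by rewrite mulrDl scalerAl.
- by rewrite ld mulrDr scalerAr.
by rewrite dM // mulrA.
Qed.

Definition bs_c0 (x : B) : R :=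
  tens_lift (M := regular k) (N := regular k) (T := R : lmodType k) (fun p q => p * dem0 q) x.
Definition bs_c1 (x : B) : R :=
  tens_lift (M := regular k) (N := regular k) (T := R : lmodType k) (fun p q => p * dem1 q) x.

Let bal0 := bs_c_bal dem0_lin (fun a p ia => proj1 (dem_inv_mul p ia)).
Let bal1 := bs_c_bal dem1_lin (fun a p ia => proj2 (dem_inv_mul p ia)).

Lemma bs_c0E p q : bs_c0 (pu p q) = p * dem0 q. Proof. exact: (tens_liftE bal0). Qed.
Lemma bs_c1E p q : bs_c1 (pu p q) = p * dem1 q. Proof. exact: (tens_liftE bal1). Qed.
Lemma bs_c0_lin : linear bs_c0. Proof. exact: (tens_lift_lin bal0). Qed.
Lemma bs_c1_lin : linear bs_c1. Proof. exact: (tens_lift_lin bal1). Qed.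

Lemma bs_lact p q r : lact (b := B) p (pu q r) = pu (p * q) r. Proof. exact: tens_lactE. Qed.
Lemma bs_ract p q r : ract (b := B) (pu q r) p = pu q (r * p). Proof. exact: tens_ractE. Qed.

Lemma bs_c0_lact p x : bs_c0 (lact (b := B) p x) = p * bs_c0 x.
Proof.
move: x; apply: tens_lin_ext => [c x y|c x y|q r].
- by rewrite (lact_linr (b := B)) bs_c0_lin.
- by rewrite bs_c0_lin mulrDr scalerAr.
by rewrite bs_lact !bs_c0E mulrA.
Qed.
Lemma bs_c1_lact p x : bs_c1 (lact (b := B) p x) = p * bs_c1 x.
Proof.
move: x; apply: tens_lin_ext => [c x y|c x y|q r].
- by rewrite (lact_linr (b := B)) bs_c1_lin.
- by rewrite bs_c1_lin mulrDr scalerAr.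
by rewrite bs_lact !bs_c1E mulrA.
Qed.

Lemma bs_pure p q : pu p q = lact (b := B) (p * dem0 q) bs0 + lact (b := B) (p * dem1 q) bs1.
Proof.
have [_ pr _] := pure_balanced inv (regular k) (regular k).
rewrite /bs0 /bs1 !bs_lact !mulr1 {1}(dem_sum q) (linD (pr _)).
congr (_ + _).
  by have := reflection_central (dem0_inv q) p 1; rewrite mulr1 => ->.
by have := reflection_central (dem1_inv q) p 'X_u; rewrite [_ * 'X_u]mulrC => ->.
Qed.

Lemma bs_decomp x : x = lact (b := B) (bs_c0 x) bs0 + lact (b := B) (bs_c1 x) bs1.
Proof.
move: x; apply: tens_lin_ext => [//|c x y|p q].
  rewrite bs_c0_lin bs_c1_lin (lact_linl (b := B) bs0) (lact_linl (b := B) bs1).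
  by rewrite scalerDr addrACA.
by rewrite bs_c0E bs_c1E -bs_pure.
Qed.

Lemma dem_1 : dem0 1 = 1 /\ dem1 1 = 0.
Proof. by apply: dem_uniq; [exact: inv1 | exact: inv0 | rewrite mulr0 addr0]. Qed.
Lemma dem_X : dem0 'X_u = 0 /\ dem1 'X_u = 1.
Proof. by apply: dem_uniq; [exact: inv0 | exact: inv1 | rewrite mulr1 add0r]. Qed.

Lemma bs_dual : [/\ bs_c0 bs0 = 1, bs_c1 bs0 = 0, bs_c0 bs1 = 0 & bs_c1 bs1 = 1].
Proof.
have [[a b] [c d]] := (dem_1, dem_X).
by split; rewrite /bs0 /bs1 ?bs_c0E ?bs_c1E ?a ?b ?c ?d ?mulr0 ?mulr1.
Qed.

Lemma bs_ract0 v : v != u -> dem0 'X_v = 'X_v + 2^-1 *: 'X_u /\ dem1 'X_v = - 2^-1 *: 1.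
Proof.
move=> ne; apply: dem_uniq; first exact: reflection_inv1 two_neq0.
  by rewrite /Defs.invariant (linZ refl_lin) refl1.
by rewrite -scalerAr mulr1 scaleNr addrK.
Qed.

Lemma bs_ract1 v : v != u -> dem0 ('X_u * 'X_v) = - 2^-1 *: ('X_u * 'X_u) /\
  dem1 ('X_u * 'X_v) = 'X_v + 2^-1 *: 'X_u.
Proof.
move=> ne; apply: dem_uniq.
- by rewrite /Defs.invariant (linZ refl_lin) -expr2 reflection_inv2.
- exact: reflection_inv1 two_neq0.
by rewrite mulrDr -scalerAr scaleNr addrCA addNr addr0.
Qed.

Lemma bs_ract2 : dem0 ('X_u * 'X_u) = 'X_u * 'X_u /\ dem1 ('X_u * 'X_u) = 0.
Proof.
apply: dem_uniq; [|exact: inv0|by rewrite mulr0 addr0].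
by rewrite -expr2; apply: reflection_inv2.
Qed.

Lemma bs_pieceP d (x : B) :
  piece d x <-> regular_piece (d + 1) (bs_c0 x) /\ regular_piece (d - 1) (bs_c1 x).
Proof.
split.
  elim=> [|c {}x y [d1 [d2 [p [q [-> hp hq ->]]]]] _ [I0 I1]].
    by rewrite (lin0 bs_c0_lin) (lin0 bs_c1_lin); split; apply: regular_piece0.
  rewrite bs_c0_lin bs_c1_lin bs_c0E bs_c1E; split; apply: regular_pieceP => //.
    by rewrite -addrA; apply: regular_pieceM => //; apply: dem0_homdeg.
  have -> : d1 + d2 - 1 = d1 + (d2 + 1 - 2) by rewrite -!addrA.
  by apply: regular_pieceM => //; apply: dem1_homdeg.
move=> [h0 h1]; rewrite (bs_decomp x) /bs0 /bs1 !bs_lact !mulr1 -[pu (bs_c0 x) _]scale1r.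
apply: lspanP; apply: lspan_incl.
  exists (d + 1), (-1), (bs_c0 x), 1; split=> //; first by rewrite addrK.
  by rewrite /= addNr; apply: regular_piece1.
exists (d - 1), 1, (bs_c1 x), 'X_u; split=> //; first by rewrite subrK.
exact: regular_pieceX.
Qed.

Lemma bs_ract_piece d e q (x : B) : regular_piece e q -> piece d x -> piece (e + d) (ract x q).
Proof.
move=> hq; elim=> [|c {}x y [d1 [d2 [p [r [-> hp hr ->]]]]] _ IH].
  by rewrite (lin0 (ract_linl (b := B) q)); apply: piece0.
rewrite (ract_linl (b := B) q); apply: pieceP => //; apply: lspan_incl.
exists d1, (e + d2), p, (r * q); split=> //; [by rewrite addrCA| |exact: bs_ract].
by rewrite /= -addrA addrC; apply: regular_pieceM.
Qed.
End Demazure.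

(** * Left bases of the Rouquier complexes *)

Section RouquierModels.
Variable k : fieldType.
Hypothesis char0 : [pchar k] =i pred0.
Notation R := (polyR k).
Variable w : bool.
Notation u := (ord_of w).
Notation B := (bs k u).

Lemma ord_of_inj : injective ord_of. Proof. by case=> -[]. Qed.

Lemma sv1 (M : bimod k) (e : positive -> M) a p : sv e [:: (a, p)] = lact (peval k p) (e a).
Proof. by rewrite sv_cons sv_nil addr0. Qed.
Lemma sv2 (M : bimod k) (e : positive -> M) a p b q :
  sv e [:: (a, p); (b, q)] = lact (peval k p) (e a) + lact (peval k q) (e b).
Proof. by rewrite sv_cons sv1. Qed.

Lemma peval_invariant v : peval k (padd (pX v) (pmul (pcst qhalf) (pX w))) =
  'X_(ord_of v) + 2^-1 *: 'X_u.
Proof. by rewrite (pevalD char0) (pevalM char0) peval_cst !pevalX qk_half mul_mpolyC. Qed.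
Lemma peval_mhalf : peval k (pcst (qopp qhalf)) = - 2^-1 *: 1.
Proof. by rewrite peval_cst qkN qk_half -mul_mpolyC mulr1. Qed.
Lemma peval_sq : peval k (pmul (pX w) (pX w)) = 'X_u * 'X_u.
Proof. by rewrite (pevalM char0) !pevalX. Qed.
Lemma peval_mhalf_sq : peval k (pmul (pcst (qopp qhalf)) (pmul (pX w) (pX w))) =
  - 2^-1 *: ('X_u * 'X_u).
Proof. by rewrite (pevalM char0) peval_sq peval_cst qkN qk_half mul_mpolyC. Qed.

Lemma bs_r_sound (M : bimod k) (e : positive -> M) (g : B -> M) v a b :
  linear g -> (forall p x, g (lact p x) = lact p (g x)) ->
  e a = g (bs0 k u) -> e b = g (bs1 k u) ->
  sv e (bs_r w v a b).1 = g (ract (b := B) (bs0 k u) 'X_(ord_of v)) /\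
  sv e (bs_r w v a b).2 = g (ract (b := B) (bs1 k u) 'X_(ord_of v)).
Proof.
move=> lg gl ea eb.
have gE q : g (pure (M := regular k) (N := regular k) (Defs.invariant u) 1 q) =
    lact (dem0 u q) (e a) + lact (dem1 u q) (e b).
  by rewrite (bs_pure char0 u 1 q) (linD lg) !gl !mul1r ea eb.
have -> : ract (b := B) (bs0 k u) 'X_(ord_of v) =
    pure (M := regular k) (N := regular k) (Defs.invariant u) 1 'X_(ord_of v).
  by rewrite /bs0 bs_ract mul1r.
have -> : ract (b := B) (bs1 k u) 'X_(ord_of v) =
    pure (M := regular k) (N := regular k) (Defs.invariant u) 1 ('X_u * 'X_(ord_of v)).
  exact: bs_ract.
rewrite !gE {gE}.
rewrite /bs_r; have [<-|ne] := eqVneq w v.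
  have [[-> ->] [-> ->]] := (dem_X char0 u, bs_ract2 char0 u).
  by rewrite sv_var sv1 peval_sq !(lin0 (lact_linl _)) lact1 add0r addr0.
have nvu : ord_of v != u by rewrite (inj_eq ord_of_inj) eq_sym.
have [[-> ->] [-> ->]] := (bs_ract0 char0 nvu, bs_ract1 char0 nvu).
by rewrite /= !sv2 peval_invariant peval_mhalf peval_mhalf_sq.
Qed.

Lemma three_cases (P : positive -> Prop) : P i1 -> P i2 -> P i3 -> forall j, j \in three -> P j.
Proof. by move=> P1 P2 P3 j; rewrite !inE => /or3P[] /eqP ->. Qed.

Lemma big_three (V : zmodType) (F : positive -> V) :
  \sum_(j <- three) F j = F i1 + (F i2 + F i3).
Proof. by rewrite /three !big_cons big_nil addr0. Qed.

Section Positive.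
Notation C := (rouquier k u).
Definition rou_basis (j : positive) : C :=
  match j with
  | i1 => (bs0 k u, 0) | i2 => (bs1 k u, 0) | i3 => (0, 1) | _ => 0 end.
Definition rou_coord (x : C) (j : positive) : R :=
  match j with i1 => bs_c0 x.1 | i2 => bs_c1 x.1 | i3 => x.2 | _ => 0 end.

Lemma rouquier_model : is_model (C := C) (m_rouquier w) rou_basis rou_coord.
Proof.
have [l0 l1] := (bs_c0_lin char0 (u := u), bs_c1_lin char0 (u := u)).
have [d00 d10 d01 d11] := bs_dual char0 u.
have z0 := lin0 l0; have z1 := lin0 l1.
split.
- by [].
- move=> j c x y; case: j => [[j|j|]|[j|j|]|] /=; rewrite ?scaler0 ?addr0 //.
  + exact: l1.
  + exact: l0.
- move=> p x j; case: j => [[j|j|]|[j|j|]|] /=; rewrite ?mulr0 //.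
  + exact: bs_c1_lact.
  + exact: bs_c0_lact.
- move=> [x y]; rewrite big_three; congr pair => /=.
    by rewrite (lin0 (tens_lact_linr _)) addr0; apply: (bs_decomp char0 x).
  by rewrite !mulr0 !add0r mulr1.
- move=> i j hi hj; move: i hi j hj.
  by do 2![apply: three_cases]; rewrite /= ?d00 ?d01 ?d10 ?d11 ?z0 ?z1.
- by move=> j; rewrite !inE; case: j => [[j|j|]|[j|j|]|].
- have em : linear (fun x : B => (x, 0) : C).
    by move=> c x y; congr pair; rewrite /= scaler0 addr0.
  have eml p (x : B) : (lact p x, 0) = lact p ((x, 0) : C).
    by congr pair; rewrite /= mulr0.
  move=> v j; have [h1 h2] := @bs_r_sound C rou_basis (fun x => (x, 0)) v i1 i2 em eml erefl erefl.
  case: j => [[j|j|]|[j|j|]|]; rewrite ?sv_nil ?(lin0 (ract_linl _)) //.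
  + rewrite sv1 pevalX; congr pair => /=; last by rewrite mul1r mulr1.
    by rewrite (lin0 (tens_lact_linr _)) (lin0 (tens_ract_linl _)).
  + by rewrite [RHS]h2; congr pair; rewrite /= mul0r.
  + by rewrite [RHS]h1; congr pair; rewrite /= mul0r.
- have mE (p q : R) : @bs_mult k u (pure (M := regular k) (N := regular k) (Defs.invariant u) p q) = p * q.
    exact: (tens_liftE (bs_mult_bal k u)).
  have lm : linear (@bs_mult k u) by exact: (tens_lift_lin (bs_mult_bal k u)).
  move=> j; case: j => [[j|j|]|[j|j|]|]; rewrite ?sv_nil //.
  + by congr pair; rewrite /= (lin0 lm).
  + by congr pair; rewrite /= (lin0 lm).
  + by congr pair; rewrite /= (lin0 lm).
  + by congr pair; rewrite /= (lin0 lm).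
  + by congr pair; rewrite /= (lin0 lm).
  + rewrite sv1 pevalX; congr pair => /=; first by rewrite (lin0 (tens_lact_linr _)).
    by rewrite mE mul1r mulr1.
  + rewrite sv_var; congr pair => /=.
    by rewrite mE mulr1.
- move=> i d [x y]; split=> [[] /= hx hy|h].
    apply: three_cases => /=; rewrite eq_sym ?opprK ?addr0.
    + by move: hx; case: ifP => _; [move=> /(bs_pieceP char0)[] | move=> ->; rewrite z0].
    + by move: hx; case: ifP => _; [move=> /(bs_pieceP char0)[] | move=> ->; rewrite z1].
    + by move: hy; case: ifP.
  have [h1 h2 h3] := And3 (h i1 isT) (h i2 isT) (h i3 isT); split=> /=.
    move: h1 h2; rewrite /= eq_sym; case: ifP => _ h1 h2.
      by apply/(bs_pieceP char0); split=> //; move: h1; rewrite opprK.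
    by rewrite [x](bs_decomp char0) h1 h2 !(lin0 (lact_linl (b := B) _)) addr0.
  by move: h3; rewrite /= eq_sym add0r opprK.
- move=> i d f q [x y] hq [] /= hx hy; split=> /=.
    by move: hx; case: ifP => _; [apply: bs_ract_piece | move=> ->; rewrite (lin0 (tens_ract_linl _))].
  move: hy; case: ifP => _; last by move=> ->; rewrite mul0r.
  by move=> hy; rewrite mulrC -addrA; apply: regular_pieceM.
Qed.
End Positive.

Section Negative.
Notation C := (rouquier_inv k u).
Definition rouinv_basis (j : positive) : C :=
  match j with
  | i1 => (1, 0) | i2 => (0, bs0 k u) | i3 => (0, bs1 k u) | _ => 0 end.
Definition rouinv_coord (x : C) (j : positive) : R :=
  match j with i1 => x.1 | i2 => bs_c0 x.2 | i3 => bs_c1 x.2 | _ => 0 end.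

Lemma rouquier_inv_model : is_model (C := C) (m_rouquier_inv w) rouinv_basis rouinv_coord.
Proof.
have [l0 l1] := (bs_c0_lin char0 (u := u), bs_c1_lin char0 (u := u)).
have [d00 d10 d01 d11] := bs_dual char0 u.
have z0 := lin0 l0; have z1 := lin0 l1.
split.
- by [].
- move=> j c x y; case: j => [[j|j|]|[j|j|]|] /=; rewrite ?scaler0 ?addr0 //.
  + exact: l1.
  + exact: l0.
- move=> p x j; case: j => [[j|j|]|[j|j|]|] /=; rewrite ?mulr0 //.
  + exact: bs_c1_lact.
  + exact: bs_c0_lact.
- move=> [x y]; rewrite big_three; congr pair => /=.
    by rewrite !mulr0 !addr0 mulr1.
  by rewrite (lin0 (tens_lact_linr _)) add0r; apply: (bs_decomp char0 y).
- move=> i j hi hj; move: i hi j hj.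
  by do 2![apply: three_cases]; rewrite /= ?d00 ?d01 ?d10 ?d11 ?z0 ?z1.
- by move=> j; rewrite !inE; case: j => [[j|j|]|[j|j|]|].
- have em : linear (fun x : B => (0, x) : C).
    by move=> c x y; congr pair; rewrite /= scaler0 addr0.
  have eml p (x : B) : (0, lact p x) = lact p ((0, x) : C).
    by congr pair; rewrite /= mulr0.
  move=> v j; have [h1 h2] := @bs_r_sound C rouinv_basis (fun x => (0, x)) v i2 i3 em eml erefl erefl.
  case: j => [[j|j|]|[j|j|]|]; rewrite ?sv_nil ?(lin0 (ract_linl _)) //.
  + by rewrite [RHS]h2; congr pair; rewrite /= mul0r.
  + by rewrite [RHS]h1; congr pair; rewrite /= mul0r.
  + rewrite sv1 pevalX; congr pair => /=; first by rewrite mul1r mulr1.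
    by rewrite (lin0 (tens_lact_linr _)) (lin0 (tens_ract_linl _)).
- have lc : linear (@bs_comult k u) by case: (bs_comult_ghom k u) => -[].
  move=> j; case: j => [[j|j|]|[j|j|]|]; rewrite ?sv_nil //;
    try by congr pair; rewrite /= (lin0 lc).
  rewrite sv2 (pevalM char0) !peval_cst qk_half pevalX; congr pair.
    by rewrite /= !mulr0 addr0.
  rewrite [LHS]/= /bs_comult lact1 /bs_unit scalerDr /= -/(lact (b := B) _ _) !tens_lactE /= !mulr1.
  have [pl _ _] := pure_balanced (Defs.invariant u) (regular k) (regular k).
  rewrite mul_mpolyC (linZ (pl _)); congr (_ + _).
  by rewrite -[(2^-1)%:MP]mulr1 mul_mpolyC (linZ (pl _)).
- move=> i d [x y]; split=> [[] /= hx hy|h].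
    apply: three_cases => /=; rewrite eq_sym ?opprK ?addr0.
    + by move: hx; case: ifP.
    + by move: hy; case: ifP => _; [move=> /(bs_pieceP char0)[] | move=> ->; rewrite z0].
    + by move: hy; case: ifP => _; [move=> /(bs_pieceP char0)[] | move=> ->; rewrite z1].
  have [h1 h2 h3] := And3 (h i1 isT) (h i2 isT) (h i3 isT); split=> /=.
    by move: h1; rewrite /= eq_sym.
  move: h2 h3; rewrite /= eq_sym; case: ifP => _ h2 h3.
    by apply/(bs_pieceP char0); split=> //; move: h2; rewrite opprK.
  by rewrite [y](bs_decomp char0) h2 h3 !(lin0 (lact_linl (b := B) _)) addr0.
- move=> i d f q [x y] hq [] /= hx hy; split=> /=.
    move: hx; case: ifP => _; last by move=> ->; rewrite mul0r.
    by move=> hx; rewrite mulrC -addrA; apply: regular_pieceM.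
  by move: hy; case: ifP => _; [apply: bs_ract_piece | move=> ->; rewrite (lin0 (tens_ract_linl _))].
Qed.
End Negative.
End RouquierModels.

(** * Two reductions *)

Section DoubleComplex.
Variables (k : fieldType) (V : lmodType k) (P : int -> int -> int -> V -> Prop).
Variables (phi D : V -> V).

(** Bigraded pieces P a i d with phi raising a and D raising i.  The cohomology of
    phi is taken first, then that of the map induced by D. *)
Definition dbl_HH (a i d : int) : subquot V :=
  {| cyc := fun x => P a i d x /\ phi x = 0;
     bdy := fun x => exists2 z, P (a - 1) i d z & x = phi z |}.
Definition dbl_HHH (a i d : int) : subquot V := cohomology (fun j => dbl_HH a j d) D i.
Definition cplx_H (a i d : int) : subquot V :=
  {| cyc := fun x => P a i d x /\ D x = 0;
     bdy := fun x => exists2 y, P a (i - 1) d y & x = D y |}.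

Hypothesis P_sub : forall a i d, subspace (P a i d).

Lemma image_subspace (U : lmodType k) (S : U -> Prop) (f : U -> V) :
  linear f -> subspace S -> subspace (fun x => exists2 y, S y & x = f y).
Proof.
move=> lf [S0 SP]; split; first by exists 0; rewrite ?lin0.
move=> c _ _ [x Sx ->] [y Sy ->]; exists (c *: x + y); first exact: SP.
by rewrite lf.
Qed.

Lemma dbl_HHH_bdy_subspace a i d : linear phi -> linear D -> subspace (bdy (dbl_HHH a i d)).
Proof.
move=> lp lD; have [P0 PP] := P_sub a (i - 1) d.
have [b0 bP] : subspace (bdy (dbl_HH a i d)) := image_subspace lp (P_sub _ _ _).
split.
  by exists 0; [split; rewrite ?(lin0 lp) | rewrite (lin0 lD) subr0].
move=> c x y [x' [px fx] bx] [y' [py fy] b_y]; exists (c *: x' + y').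
  by split; [exact: PP | rewrite lp fx fy scaler0 addr0].
have -> : c *: x + y - D (c *: x' + y') = c *: (x - D x') + (y - D y').
  by rewrite lD scalerBr opprD addrACA.
exact: bP.
Qed.

Lemma cplx_H_bdy_subspace a i d : linear D -> subspace (bdy (cplx_H a i d)).
Proof. by move=> lD; apply: image_subspace. Qed.
End DoubleComplex.

Section Reduction.
Variables (k : fieldType) (V W : lmodType k).
Variables (P : int -> int -> int -> V -> Prop) (P' : int -> int -> int -> W -> Prop).
Hypothesis P_sub : forall a i d, subspace (P a i d).
Hypothesis P'_sub : forall a i d, subspace (P' a i d).

Section Contract.
Variables (phi D h : V -> V) (p : V -> W) (io : W -> V) (D' : W -> W).
Hypotheses (lphi : linear phi) (lD : linear D) (lh : linear h) (lp : linear p)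
  (lio : linear io) (lD' : linear D').
Hypothesis DP : forall a i d x, P a i d x -> P a (i + 1) d (D x).
Hypothesis hP : forall a i d x, P a i d x -> P (a - 1) i d (h x).
Hypothesis pP : forall a i d x, P a i d x -> P' a i d (p x).
Hypothesis ioP : forall a i d x, P' a i d x -> P a i d (io x).
Hypothesis phiD : forall a i d x, P a i d x -> phi (D x) = D (phi x).
Hypothesis pphi : forall a i d x, P a i d x -> p (phi x) = 0.
Hypothesis phiio : forall a i d x, P' a i d x -> phi (io x) = 0.
Hypothesis pio : forall a i d x, P' a i d x -> p (io x) = x.
Hypothesis iop : forall a i d x, P a i d x -> x - io (p x) = phi (h x) + h (phi x).
Hypothesis D'E : forall a i d x, P' a i d x -> D' x = p (D (io x)).

(** If (p, io, h) retracts V onto a W with zero differential with respect to phi,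
    then W is the cohomology of phi, and D induces p D io on it.  On cycles of phi
    the maps p and io commute with the differentials up to boundaries of phi. *)
Lemma contract_equiv a i d : sq_equiv (dbl_HHH P phi D a i d) (cplx_H P' D' a i d).
Proof.
have iopE b j e x : P b j e x -> io (p x) = x - (phi (h x) + h (phi x)).
  by move=> /iop <-; rewrite subKr.
have pD b j e x : P b j e x -> phi x = 0 -> p (D x) = D' (p x).
  move=> Px fx; rewrite (D'E (pP Px)) (iopE _ _ _ _ Px) fx (lin0 lh) addr0.
  rewrite (lin_sub _ _ lD) (lin_sub _ _ lp) -(phiD (hP Px)) (pphi (DP (hP Px))) subr0 //.
have Dio b j e x : P' b j e x -> D (io x) = io (D' x) + phi (h (D (io x))).
  move=> Px; rewrite (D'E Px) (iopE _ _ _ _ (DP (ioP Px))) (phiD (ioP Px)) (phiio Px).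
  by rewrite (lin0 lD) (lin0 lh) addr0 subrK.
have hD b j e x : P' b j e x -> P (b - 1) (j + 1) e (h (D (io x))).
  by move=> Px; apply/hP/DP/ioP.
split; [exact: dbl_HHH_bdy_subspace | exact: cplx_H_bdy_subspace|].
exists p, io; split; split=> //.
- move=> x [[Px fx] [w Pw Dx]]; split; first exact: pP.
  by rewrite -(pD _ _ _ _ Px fx) Dx (pphi Pw).
- move=> x [y [Py fy] [z Pz E]]; exists (p y); first exact: pP.
  have -> : x = D y + phi z by rewrite -E addrC subrK.
  by rewrite (linD lp) (pphi Pz) addr0 (pD _ _ _ _ Py fy).
- move=> x [[Px fx] _]; exists 0.
    split; last exact: lin0.
    by case: (P_sub a (i - 1) d).
  exists (- h x); first by apply: subspaceN => //; apply: hP.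
  rewrite (iopE _ _ _ _ Px) fx (lin0 lh) (lin0 lD) addr0 subr0 (linN lphi) addrAC subrr.
  by rewrite add0r.
- move=> x [Px Dx]; split; first by split; [exact: ioP | exact: phiio Px].
  exists (h (D (io x))); first exact: hD Px.
  by rewrite {1}(Dio _ _ _ _ Px) Dx (lin0 lio) add0r.
- move=> _ [y Py ->]; exists (io y); first by split; [exact: ioP | exact: phiio Py].
  exists (- h (D (io y))).
    by apply: subspaceN => //; have := hD _ _ _ _ Py; rewrite subrK.
  by rewrite {1}(Dio _ _ _ _ Py) (linN lphi) opprD addrA subrr add0r.
- move=> x [Px _]; rewrite (pio Px) subrr; exists 0; first by case: (P'_sub a (i - 1) d).
  by rewrite (lin0 lD').
Qed.
End Contract.

Section Homotopy.
Variables (D h : V -> V) (p : V -> W) (io : W -> V) (D' : W -> W).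
Hypotheses (lD : linear D) (lh : linear h) (lp : linear p) (lio : linear io) (lD' : linear D').
Hypothesis hP : forall a i d x, P a i d x -> P a (i - 1) d (h x).
Hypothesis pP : forall a i d x, P a i d x -> P' a i d (p x).
Hypothesis ioP : forall a i d x, P' a i d x -> P a i d (io x).
Hypothesis pD : forall a i d x, P a i d x -> p (D x) = D' (p x).
Hypothesis Dio : forall a i d x, P' a i d x -> D (io x) = io (D' x).
Hypothesis pio : forall a i d x, P' a i d x -> p (io x) = x.
Hypothesis iop : forall a i d x, P a i d x -> x - io (p x) = D (h x) + h (D x).

(** The second step: phi is zero by now, and D alone is retracted. *)
Lemma homotopy_equiv a i d : sq_equiv (cplx_H P D a i d) (cplx_H P' D' a i d).
Proof.
split; [exact: cplx_H_bdy_subspace | exact: cplx_H_bdy_subspace|].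
exists p, io; split; split=> //.
- by move=> x [Px Dx]; split; [exact: pP | rewrite -(pD Px) Dx lin0].
- by move=> _ [y Py ->]; exists (p y); [exact: pP | rewrite (pD Py)].
- move=> x [Px Dx]; exists (- h x); first by apply: subspaceN => //; apply: hP.
  by rewrite -opprB (iop Px) Dx (lin0 lh) addr0 (linN lD).
- by move=> x [Px Dx]; split; [exact: ioP | rewrite (Dio Px) Dx lin0].
- by move=> _ [y Py ->]; exists (io y); [exact: ioP | rewrite (Dio Py)].
- move=> x [Px _]; rewrite (pio Px) subrr; exists 0; first by case: (P'_sub a (i - 1) d).
  by rewrite (lin0 lD').
Qed.
End Homotopy.
End Reduction.

(** * Vectors with polynomial entries *)

Definition grading := positive -> option (int * int * int).
Definition grade (ix : seq positive) (deg : positive -> int * int * int) : grading :=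
  let m := tabulate ix deg in fun j => PM.find j m.
Lemma gradeE ix deg j : grade ix deg j = if j \in ix then Some (deg j) else None.
Proof. exact: tabulateE. Qed.

Definition veq (s t : svec) : bool := nilp (vadd s (vopp t)).

Definition hom_check (ix : seq positive) (A : positive -> svec) (dg dg' : grading) (da di : int) :=
  all (fun j => if dg j is Some (a, i, d) then
      all (fun t : positive * poly => if dg' t.1 is Some (a', i', d') then
         [&& a' == a + da, i' == i + di &
           all (fun m : nat * nat * Q => (2 * (m.1.1 + m.1.2))%:Z + d' == d) t.2]
         else false) (A j)
    else true) ix.

Section Vectors.
Variable k : fieldType.
Hypothesis char0 : [pchar k] =i pred0.
Notation R := (polyR k).

Notation FT := (positive -> R).
(** Families of polynomials, with R acting entrywise on both sides; the bimodule
    structure is there to reuse [sv]. *)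
Definition fv_act (p : R) (v : FT) : FT := fun j => p * v j.
Fact fv_linl v : linear (fv_act^~ v).
Proof. by move=> c p q; apply: funext => j; rewrite /fv_act ?fctE mulrDl -scalerAl. Qed.
Fact fv_linr p : linear (fv_act p).
Proof. by move=> c v w; apply: funext => j; rewrite /fv_act !fctE mulrDr -scalerAr. Qed.
Fact fv_act1 v : fv_act 1 v = v.
Proof. by apply: funext => j; rewrite /fv_act mul1r. Qed.
Fact fv_actM p q v : fv_act (p * q) v = fv_act p (fv_act q v).
Proof. by apply: funext => j; rewrite /fv_act mulrA. Qed.
Fact fv_actM' v p q : fv_act (p * q) v = fv_act q (fv_act p v).
Proof. by rewrite mulrC fv_actM. Qed.
Fact fv_actC p v q : fv_act p (fv_act q v) = fv_act q (fv_act p v).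
Proof. by rewrite -!fv_actM mulrC. Qed.
Definition fv : bimod k :=
  @Bimod k FT fv_act (fun v p => fv_act p v) fv_linl fv_linr fv_linr fv_linl
    fv_act1 fv_actM fv_act1 fv_actM' fv_actC.

Definition delta (j : positive) : fv := fun m => (j == m)%:R.
Notation vec := (sv (M := fv) delta).

Definition rlin (B : bimod k) (ix : seq positive) (A : positive -> B) (v : fv) : B :=
  \sum_(j <- ix) lact (v j) (A j).

Lemma rlin_linear (B : bimod k) ix (A : positive -> B) : linear (rlin ix A).
Proof.
move=> c v w; rewrite /rlin scaler_sumr -big_split; apply: eq_bigr => j _.
by rewrite !fctE (lact_linl (A j)).
Qed.

Lemma rlin_lact (B : bimod k) ix (A : positive -> B) p v : rlin ix A (lact p v) = lact p (rlin ix A v).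
Proof.
rewrite /rlin (lin_bigsum _ _ (lact_linr p)); apply: eq_bigr => j _.
by rewrite -lactM.
Qed.

Lemma rlin_delta (B : bimod k) ix (A : positive -> B) j : uniq ix ->
  rlin ix A (delta j) = if j \in ix then A j else 0.
Proof.
move=> us; rewrite /rlin; case: ifP => hj.
  rewrite (bigD1_seq j) //= big1 ?addr0 => [|i ne].
    by rewrite /delta eqxx lact1.
  by rewrite /delta eq_sym (negPf ne) (lin0 (lact_linl _)).
rewrite big_seq big1 // => i hi; rewrite /delta; case: eqP => [E|_]; last first.
  by rewrite (lin0 (lact_linl _)).
by rewrite E hi in hj.
Qed.

(** For maps with no value outside ix the support of the argument is irrelevant;
    tabulated matrices are of this kind. *)
Lemma rlin_vec (B : bimod k) ix (A : positive -> B) s : uniq ix ->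
  (forall j, j \notin ix -> A j = 0) -> rlin ix A (vec s) = sv A s.
Proof.
move=> us A0; rewrite /sv (lin_bigsum _ _ (rlin_linear ix A)); apply: eq_bigr => t _.
rewrite rlin_lact rlin_delta //; case: ifPn => // /A0 ->.
by [].
Qed.

Lemma rlin_comp (B : bimod k) ix ix' (A : positive -> svec) (A' : positive -> B) v :
  uniq ix' -> (forall j, j \notin ix' -> A' j = 0) ->
  rlin ix' A' (rlin ix (fun j => vec (A j)) v) = rlin ix (fun j => sv A' (A j)) v.
Proof.
move=> us A0; rewrite [X in rlin ix' A' X]/rlin (lin_bigsum _ _ (rlin_linear ix' A')) [RHS]/rlin.
apply: eq_bigr => j _.
by rewrite rlin_lact rlin_vec.
Qed.

Definition op ix (A : positive -> svec) : fv -> fv := rlin ix (fun j => vec (memo ix A j)).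

Lemma op_lin ix A : linear (op ix A). Proof. exact: rlin_linear. Qed.

Lemma vec_nil j ix A : j \notin ix -> vec (memo ix A j) = 0.
Proof. by move=> hj; rewrite memoE (negPf hj) sv_nil. Qed.

Lemma veqP (M : bimod k) (e : positive -> M) s t : veq s t -> sv e s = sv e t.
Proof.
move=> /nilP h; have := svD char0 e s (vopp t); rewrite h sv_nil sv_opp // => /esym/eqP.
by rewrite subr_eq0 => /eqP.
Qed.

Lemma rlin_eq (B : bimod k) ix (A A' : positive -> B) v :
  (forall j, j \in ix -> A j = A' j) -> rlin ix A v = rlin ix A' v.
Proof. by move=> h; rewrite /rlin !big_seq; apply: eq_bigr => j hj; rewrite h. Qed.

Lemma rlinD (B : bimod k) ix (A A' : positive -> B) v :
  rlin ix A v + rlin ix A' v = rlin ix (fun j => A j + A' j) v.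
Proof. by rewrite /rlin -big_split; apply: eq_bigr => j _; rewrite (linD (lact_linr _)). Qed.

Lemma rlinN (B : bimod k) ix (A : positive -> B) v :
  - rlin ix A v = rlin ix (fun j => - A j) v.
Proof. by rewrite /rlin -sumrN; apply: eq_bigr => j _; rewrite (linN (lact_linr _)). Qed.

Definition vpiece (dg : grading) (a i d : int) (v : fv) : Prop :=
  forall j, if dg j is Some (a', i', d')
    then if (a' == a) && (i' == i) then regular_piece (d - d') (v j) else v j = 0
    else v j = 0.

Lemma vpiece_sub dg a i d : subspace (vpiece dg a i d).
Proof.
split=> [j|c v w hv hw j].
  by case: (dg j) => [[[a' i'] d']|] //; case: ifP => // _; apply: regular_piece0.
have := hw j; have := hv j; rewrite !fctE; case: (dg j) => [[[a' i'] d']|]; last first.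
  by move=> -> ->; rewrite scaler0 addr0.
case: ifP => _; first exact: regular_pieceP.
by move=> -> ->; rewrite scaler0 addr0.
Qed.

Lemma vpiece_decomp (dg : grading) ix a i d v : uniq ix -> (forall j, dg j -> j \in ix) ->
  vpiece dg a i d v -> v = rlin ix delta v.
Proof.
move=> us cov hv; apply: funext => m; rewrite /rlin fct_sumE.
case: (boolP (m \in ix)) => [hm|hm].
  rewrite (bigD1_seq m) //= big1 ?addr0 => [|j ne].
    by rewrite /fv_act /delta eqxx mulr1.
  by rewrite /fv_act /delta (negPf ne) mulr0.
rewrite big_seq big1 => [|j hj]; last first.
  rewrite /= /fv_act /delta; case: eqP => [E|_]; rewrite ?mulr0 //.
  by rewrite -E hj in hm.
have := hv m; have := cov m; case: (dg m) => // x /(_ isT) h.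
by rewrite h in hm.
Qed.

Lemma peval_homdeg (p : poly) (e d : int) :
  all (fun m : nat * nat * Q => (2 * (m.1.1 + m.1.2))%:Z + e == d) p ->
  regular_piece (d - e) (peval k p).
Proof.
elim: p => [|m p IH] /=; first by rewrite peval_nil => _; apply: regular_piece0.
move=> /andP[/eqP hm hp]; rewrite /peval big_cons; apply: regular_pieceP; last exact: IH.
rewrite -hm addrK /mono_k mulnDr PoszD.
by apply: regular_pieceM; apply: homdeg_exp; apply: homdegU.
Qed.

Lemma hom_checkP ix A dg dg' da di a i d v :
  hom_check ix (memo ix A) dg dg' da di -> vpiece dg a i d v ->
  vpiece dg' (a + da) (i + di) d (op ix A v).
Proof.
move=> /allP hA hv; have [P0 PP] := vpiece_sub dg' (a + da) (i + di) d.
rewrite /op /rlin big_seq; elim/big_ind: _ => // [x y hx hy|j hj].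
  by rewrite -[x]scale1r; apply: PP.
have := hv j; have := hA j hj; case: (dg j) => [[[a1 i1] d1]|]; last first.
  by move=> _ ->; rewrite (lin0 (lact_linl _)).
case: ifP => [/andP[/eqP -> /eqP ->]|_ _ ->]; last by rewrite (lin0 (lact_linl _)).
elim: (memo ix A j) => [|t s IH] hs hq.
  by rewrite sv_nil (lin0 (lact_linr _)).
move: hs; rewrite sv_cons (linD (lact_linr _)) -[lact _ (lact _ _)]scale1r.
move=> /andP[ht hs]; apply: PP; last exact: IH.
rewrite -lactM => m; rewrite /= /fv_act /delta.
have [<-|_] := eqVneq t.1 m; last first.
  rewrite mulr0; case: (dg' m) => [[[a2 i2] d2]|] //.
  by case: ifP => // _; apply: regular_piece0.
case: (dg' t.1) ht => [[[a2 i2] d2]|] // /and3P[/eqP -> /eqP -> hp].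
rewrite !eqxx mulr1 /=; have := regular_pieceM hq (peval_homdeg hp).
by rewrite addrA subrK.
Qed.
End Vectors.

(** * Koszul cochains in coordinates *)

Notation i4 := (xO (xO xH)).

(** A Koszul generator is appended to the word of a basis vector as one more digit
    in base 4, with values 0 to 3.  The Koszul generators i1, i2, i3, i4 stand for
    the exterior monomials 1, s, t, st. *)
Definition kenc (s j : positive) : positive :=
  match s with xH => xO (xO j) | xO xH => xI (xO j) | xI _ => xO (xI j) | _ => xI (xI j) end.
Definition kdec (m : positive) : positive * positive :=
  match m with
  | xO (xO j) => (j, i1) | xI (xO j) => (j, i2) | xO (xI j) => (j, i3) | xI (xI j) => (j, i4)
  | _ => (m, i1) end.
Definition four : seq positive := [:: i1; i2; i3; i4].
Definition klevel (s : positive) : nat :=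
  match s with xH => O | xO (xO _) => 2 | _ => 1 end.

Definition k_ix (M : mdata) : seq positive := [seq kenc s j | s <- four, j <- m_ix M].
(** The Koszul generator of level l sits in internal degree 2l of the resolution,
    hence the shift of its dual. *)
Definition k_deg (M : mdata) (m : positive) : int * int * int :=
  let: (j, s) := kdec m in
  ((klevel s)%:Z, (m_deg M j).1, (m_deg M j).2 - (2 * klevel s)%:Z).
Definition k_phi (M : mdata) (m : positive) : svec :=
  let: (j, s) := kdec m in
  let f v := vadd (m_r M v j) [:: (j, pmul (pcst (qopp (qnat xH))) (pX v))] in
  match s with
  | i1 => vadd (reidx (kenc i2) (f false)) (reidx (kenc i3) (f true))
  | i2 => vopp (reidx (kenc i4) (f true))
  | i3 => reidx (kenc i4) (f false)
  | _ => [::] end.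
Definition k_d (M : mdata) (m : positive) : svec :=
  let: (j, s) := kdec m in reidx (kenc s) (m_d M j).

Lemma kencK s j : s \in four -> kdec (kenc s j) = (j, s).
Proof. by rewrite !inE => /or4P[] /eqP ->. Qed.

Section KoszulVectors.
Variable k : fieldType.
Hypothesis char0 : [pchar k] =i pred0.
Notation R := (polyR k).
Variables (C : cplx k) (M : mdata) (e : positive -> C) (co : C -> positive -> R).
Hypothesis mo : is_model M e co.
Notation ix := (k_ix M).
Notation dg := (grade ix (k_deg M)).
Notation phi := (op (k := k) ix (k_phi M)).
Notation D := (op (k := k) ix (k_d M)).
Notation FV := (fv k).

Definition kidx (a : nat) (t : 'I_(krank a)) : positive :=
  match a with O => i1 | 1 => if val t is O then i2 else i3 | _ => i4 end.

Lemma kidx_four a (t : 'I_(krank a)) : kidx t \in four.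
Proof. by case: a t => [|[|a]] t //=; case: (val t). Qed.

Lemma kidx_level a (t : 'I_(krank a)) : klevel (kidx t) = a.
Proof. by case: a t => [|[|[|a]]] //= t; [case: (val t) | case: t]. Qed.

Lemma kidx_inj a : injective (@kidx a).
Proof.
case: a => [|[|[|a]]] t t' //=; rewrite ?(ord1 t) ?(ord1 t') //; last by case: t.
by have [->|->] := ord2 t; have [->|->] := ord2 t'.
Qed.

Lemma kidx_surj a s : s \in four -> klevel s = a -> exists t : 'I_(krank a), kidx t = s.
Proof.
rewrite !inE => /or4P[] /eqP -> <- /=; [by exists 0 | by exists 0 | by exists 1 | by exists 0].
Qed.

Lemma k_ixP m : reflect (exists s j, [/\ s \in four, j \in m_ix M & m = kenc s j]) (m \in ix).
Proof.
apply: (iffP allpairsP) => [[[s j] /= [hs hj ->]]|[s [j [hs hj ->]]]]; first by exists s, j.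
by exists (s, j).
Qed.

Lemma mem_kenc s j : s \in four -> (kenc s j \in ix) = (j \in m_ix M).
Proof.
move=> hs; apply/k_ixP/idP => [[s' [j' [hs' hj' E]]]|hj]; last by exists s, j.
by have := congr1 kdec E; rewrite !kencK // => -[->].
Qed.

Lemma k_ix_uniq : uniq ix.
Proof.
apply: allpairs_uniq => //; first exact: (mo_uniq mo).
move=> [s j] [s' j'] /allpairsP[[a b] [ha _ E]] /allpairsP[[a' b'] [ha' _ E']].
case: E => -> ->; case: E' => -> -> /= /(congr1 kdec).
by rewrite !kencK // => -[-> ->].
Qed.

Lemma dg_kenc s j : s \in four -> j \in m_ix M ->
  dg (kenc s j) = Some ((klevel s)%:Z, (m_deg M j).1, (m_deg M j).2 - (2 * klevel s)%:Z).
Proof. by move=> hs hj; rewrite gradeE mem_kenc // hj /k_deg kencK. Qed.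

(** The part of the basis of the double complex at the Koszul generator s, as
    elements of C; [to_cochain] pairs a vector with it. *)
Definition kbasis (s m : positive) : C :=
  if (m \in ix) && ((kdec m).2 == s) then e (kdec m).1 else 0.

Lemma kbasisE s s' j : s' \in four -> kbasis s (kenc s' j) = if s' == s then e j else 0.
Proof.
move=> hs'; rewrite /kbasis kencK //= mem_kenc //; case: (boolP (j \in _)) => // hj.
by rewrite (mo_out mo hj) if_same.
Qed.

Lemma kbasis_out s m : m \notin ix -> kbasis s m = 0.
Proof. by rewrite /kbasis => /negPf ->. Qed.

Definition to_cochain (a : nat) (v : FV) : 'I_(krank a) -> C :=
  fun t => rlin ix (kbasis (kidx t)) v.
Definition of_cochain (a : nat) (x : 'I_(krank a) -> C) : FV :=
  \sum_t \sum_(j <- m_ix M) lact (co (x t) j) (delta k (kenc (kidx t) j)).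

Lemma to_cochain_lin a : linear (@to_cochain a).
Proof. by move=> c v w; apply: funext => t; apply: rlin_linear. Qed.

Lemma of_cochain_lin a : linear (@of_cochain a).
Proof.
move=> c x y; rewrite /of_cochain scaler_sumr -big_split; apply: eq_bigr => t _.
rewrite scaler_sumr -big_split; apply: eq_bigr => j _ /=.
by rewrite !fctE (mo_lin mo) (fv_linl (delta k (kenc (kidx t) j))).
Qed.

Lemma to_of_cochain a (x : 'I_(krank a) -> C) : to_cochain (of_cochain x) = x.
Proof.
apply: funext => t; rewrite /to_cochain /of_cochain (lin_bigsum _ _ (rlin_linear _ _)).
rewrite (bigD1 t) //= [X in _ + X]big1 ?addr0 => [|t' ne].
  rewrite [RHS](mo_decomp mo) (lin_bigsum _ _ (rlin_linear _ _)) big_seq [RHS]big_seq.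
  apply: eq_bigr => j hj; rewrite rlin_lact rlin_delta ?k_ix_uniq //.
  by rewrite mem_kenc ?kidx_four // hj kbasisE ?kidx_four // eqxx.
rewrite (lin_bigsum _ _ (rlin_linear _ _)) big1 // => j _.
rewrite rlin_lact rlin_delta ?k_ix_uniq // kbasisE ?kidx_four // (inj_eq (@kidx_inj a)) (negPf ne).
by rewrite if_same (lin0 (lact_linr _)).
Qed.

(** A vector of Koszul level a has no entries at generators of other levels, which
    the passage to cochains would lose. *)
Lemma of_to_cochain a i d (v : FV) : vpiece dg a%:Z i d v -> of_cochain (@to_cochain a v) = v.
Proof.
move=> hv.
have dg_ix j : dg j -> j \in ix by rewrite gradeE; case: (j \in ix).
have lf m : linear (fun p : R => of_cochain (fun t : 'I_(krank a) => lact p (kbasis (kidx t) m))).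
  move=> c p q; rewrite -of_cochain_lin; congr of_cochain; apply: funext => t.
  by rewrite !fctE lact_linl.
rewrite [RHS](vpiece_decomp k_ix_uniq dg_ix hv).
have -> : @to_cochain a v = \sum_(m <- ix) (fun t => lact (v m) (kbasis (kidx t) m)).
  by apply: funext => t; rewrite fct_sumE.
rewrite (lin_bigsum _ _ (@of_cochain_lin a)) /rlin big_seq [RHS]big_seq.
apply: eq_bigr => m hm; case/k_ixP: hm (hv m) => s [j [hs hj ->]].
rewrite dg_kenc //; case: eqP => [/eqP|_ /=]; last first.
  move=> ->; rewrite (lin0 (fv_linl _)).
  by apply: (lin0 (lf (kenc s j))).
rewrite eqz_nat => /eqP /(kidx_surj hs)[t0 Et] _.
rewrite /of_cochain (bigD1 t0) //= [X in _ + X]big1 ?addr0 => [|t ne].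
  rewrite (bigD1_seq j) ?(mo_uniq mo) //= [X in _ + X]big_seq_cond.
  rewrite [X in _ + X]big1 ?addr0 => [|j' /andP[hj' ne]].
    by rewrite kbasisE // Et eqxx (mo_lact mo) (mo_dual mo) // eqxx mulr1.
  rewrite kbasisE // Et eqxx (mo_lact mo) (mo_dual mo) // eq_sym (negPf ne) mulr0.
  by rewrite (lin0 (fv_linl _)).
rewrite big1 // => j' _; rewrite kbasisE // -Et (inj_eq (@kidx_inj a)) eq_sym (negPf ne).
by rewrite (lin0 (lact_linr _)) (lin0 (mo_lin mo _)) (lin0 (fv_linl _)).
Qed.

Lemma of_cochain_piece a i d (x : 'I_(krank a) -> C) :
  (forall t, cpiece i ((2 * a)%:Z + d) (x t)) -> vpiece dg a%:Z i d (of_cochain x).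
Proof.
move=> hx; have [P0 PP] := @vpiece_sub k dg a%:Z i d.
have PD (v w : FV) : vpiece dg a%:Z i d v -> vpiece dg a%:Z i d w -> vpiece dg a%:Z i d (v + w).
  by move=> hv hw; rewrite -[v]scale1r; apply: PP.
rewrite /of_cochain; apply: big_ind => // t _; rewrite big_seq; apply: big_ind => // j hj.
move=> m; rewrite /= /fv_act /delta.
have [<-|_] := eqVneq (kenc (kidx t) j) m; last first.
  rewrite mulr0; case: (dg m) => [[[a2 i2] d2]|] //.
  by case: ifP => // _; apply: regular_piece0.
rewrite dg_kenc ?kidx_four // kidx_level eqxx mulr1 /= opprB addrA [d + _]addrC.
exact: (mo_piece mo _ _ _).1 (hx t) j hj.
Qed.

Lemma to_cochain_piece a i d (v : FV) : vpiece dg a%:Z i d v ->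
  forall t : 'I_(krank a), cpiece i ((2 * a)%:Z + d) (to_cochain v t).
Proof.
move=> hv t; rewrite /to_cochain /rlin big_seq.
apply: (piece_sum (M := cterm C i)) => m hm; have [s [j [hs hj E]]] := k_ixP _ hm.
have := hv m; rewrite E dg_kenc // kbasisE //; case: (eqVneq s (kidx t)) => [->|_ _]; last first.
  by rewrite (lin0 (lact_linr _)); apply: (@piece0 k (cterm C i)).
rewrite kidx_level eqxx /=; case: eqP => [<-|_ ->]; last first.
  by rewrite (lin0 (lact_linl _)); apply: (@piece0 k (cterm C _)).
move=> hq; have := mo_basis_piece mo hj hq.
by rewrite opprB addrA subrK [d + _]addrC.
Qed.

Lemma ad_rlin w (A : positive -> C) (v : FV) : ad w (rlin ix A v) = rlin ix (fun m => ad w (A m)) v.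
Proof. by rewrite /rlin (lin_bigsum _ _ (ad_lin w)); apply: eq_bigr => m _; rewrite ad_lact. Qed.

Lemma kbasis_reidx s s' g : s' \in four ->
  sv (kbasis s) (reidx (kenc s') g) = if s' == s then sv e g else 0.
Proof.
move=> hs'; rewrite sv_reidx; case: ifP => hss.
  by apply: eq_bigr => t _; rewrite /= kbasisE // hss.
by rewrite /sv big1 // => t _; rewrite /= kbasisE // hss (lin0 (lact_linr _)).
Qed.

Lemma sv_ad v j :
  sv e (vadd (m_r M v j) [:: (j, pmul (pcst (qopp (qnat xH))) (pX v))]) = ad (ord_of v) (e j).
Proof.
rewrite (svD char0) sv1 -(mo_r mo) (pevalM char0) pevalN1 pevalX mulN1r.
by rewrite (linN (lact_linl _)).
Qed.

Lemma to_cochain_phi a (v : FV) : @to_cochain a.+1 (phi v) = kcodiff (@to_cochain a v).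
Proof.
apply: funext => t.
rewrite {1}/to_cochain /op rlin_comp ?k_ix_uniq //; last by move=> m; apply: kbasis_out.
have E (A : positive -> C) : (forall s j, s \in four -> j \in m_ix M ->
    sv (kbasis (kidx t)) (k_phi M (kenc s j)) = A (kenc s j)) ->
    rlin ix (fun m => sv (kbasis (kidx t)) (memo ix (k_phi M) m)) v = rlin ix A v.
  move=> h; apply: rlin_eq => m hm; rewrite memoE hm.
  by have [s [j [hs hj ->]]] := k_ixP _ hm; apply: h.
case: a t E => [|[|a]] t E; last by case: t E.
  rewrite [RHS]ad_rlin; apply: E => s j hs hj; rewrite /k_phi kencK // kbasisE //.
  move: hs; rewrite !inE => /or4P[] /eqP -> /=.
  - rewrite (svD char0) !kbasis_reidx // !sv_ad.
    by have [->|->] := ord2 t; rewrite /= ?addr0 ?add0r.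
  - rewrite (sv_opp char0) kbasis_reidx // (lin0 (ad_lin _)).
    by have [->|->] := ord2 t; rewrite /= oppr0.
  - rewrite kbasis_reidx // (lin0 (ad_lin _)).
    by have [->|->] := ord2 t.
  - by rewrite sv_nil (lin0 (ad_lin _)).
rewrite /kcodiff /to_cochain !ad_rlin rlinN rlinD; apply: E => s j hs hj.
rewrite /k_phi kencK // !kbasisE //; move: hs; rewrite !inE => /or4P[] /eqP -> /=.
- by rewrite (svD char0) !kbasis_reidx //= !(lin0 (ad_lin _)) subrr addr0.
- by rewrite (sv_opp char0) kbasis_reidx //= sv_ad (lin0 (ad_lin _)) add0r.
- by rewrite kbasis_reidx //= sv_ad (lin0 (ad_lin _)) subr0.
- by rewrite sv_nil !(lin0 (ad_lin _)) subrr.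
Qed.

Lemma to_cochain_D a (v : FV) : @to_cochain a (D v) = (fun t => cdiff (to_cochain v t)).
Proof.
apply: funext => t; have [dl d2 _] := cdiff_bihom C.
rewrite {1}/to_cochain /op rlin_comp ?k_ix_uniq //; last by move=> m; apply: kbasis_out.
rewrite /to_cochain [X in cdiff X]/rlin (lin_bigsum _ _ dl) /rlin big_seq [RHS]big_seq.
apply: eq_bigr => m hm; rewrite d2 memoE hm; congr (lact _ _).
have [s [j [hs hj ->]]] := k_ixP _ hm; rewrite /k_d kencK // kbasis_reidx // kbasisE //.
by case: ifP => _; rewrite ?(mo_d mo) // (lin0 dl).
Qed.

Lemma dg_range a i d (v : FV) : (forall s, s \in four -> (klevel s)%:Z != a) ->
  vpiece dg a i d v -> v = 0.
Proof.
move=> ha hv; apply: funext => m; have := hv m; rewrite gradeE; case: ifP => // hm.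
have [s [j [hs hj ->]]] := k_ixP _ hm; rewrite /k_deg kencK //.
by rewrite (negPf (ha s hs)).
Qed.

Lemma model_graded_actions i : graded_actions (cterm C i).
Proof.
split=> d f p x hp hx; first exact: (mo_lactp mo hp hx).
exact: (mo_ract mo hp hx).
Qed.

Hypothesis phi_hom : hom_check ix (memo ix (k_phi M)) dg dg 1 0.
Hypothesis D_hom : hom_check ix (memo ix (k_d M)) dg dg 0 1.

Let phiP a i d v : vpiece dg a i d v -> vpiece dg (a + 1) i d (phi v).
Proof. by move=> /(hom_checkP phi_hom); rewrite addr0. Qed.
Let DP a i d v : vpiece dg a i d v -> vpiece dg a (i + 1) d (D v).
Proof. by move=> /(hom_checkP D_hom); rewrite addr0. Qed.

Lemma koszul_dbl_equiv a i d :
  sq_equiv (koszul_HHH C a i d) (dbl_HHH (vpiece dg) phi D a%:Z i d).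
Proof.
have vsub := @vpiece_sub k dg.
have lG := @to_cochain_lin a; have lF := @of_cochain_lin a.
have G_inj b j f (v w : FV) : vpiece dg b%:Z j f v -> vpiece dg b%:Z j f w ->
    @to_cochain b v = to_cochain w -> v = w.
  by move=> hv hw E; rewrite -(of_to_cochain hv) E (of_to_cochain hw).
have D_of j f (x : 'I_(krank a) -> C) : (forall t, cpiece j ((2 * a)%:Z + f) (x t)) ->
    of_cochain (fun t => cdiff (x t)) = D (of_cochain x).
  move=> hx; have hF := of_cochain_piece hx.
  apply: (G_inj a (j + 1) f); [apply: of_cochain_piece => t; exact: cdiff_piece | exact: DP|].
  by rewrite to_cochain_D !to_of_cochain.
have phi_of b j f (x : 'I_(krank b) -> C) : (forall t, cpiece j ((2 * b)%:Z + f) (x t)) ->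
    of_cochain (kcodiff x) = phi (of_cochain x).
  move=> hx; have hF := of_cochain_piece hx.
  have E := to_cochain_phi b (of_cochain x); rewrite to_of_cochain in E.
  have hP := phiP hF; rewrite -PoszD addn1 in hP.
  by rewrite -E (of_to_cochain hP).
have of_bdy j x : bdy (koszul_HH (cterm C j) a d) x ->
    bdy (dbl_HH (vpiece dg) phi a%:Z j d) (of_cochain x).
  case: (a) x => [|b] x /=.
    move=> ->; exists 0; first by case: (vsub (0 - 1) j d).
    by rewrite (lin0 (@of_cochain_lin 0)) (lin0 (op_lin _ _)).
  move=> [y hy ->]; exists (of_cochain y); last exact: phi_of.
  by rewrite -addn1 PoszD addrK; apply: of_cochain_piece.
have to_bdy j v : bdy (dbl_HH (vpiece dg) phi a%:Z j d) v ->
    bdy (koszul_HH (cterm C j) a d) (to_cochain v).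
  move=> [z hz ->]; case: (a) hz => [|b] hz /=.
    have -> : z = 0 by apply: dg_range hz => s; rewrite !inE => /or4P[] /eqP ->.
    by rewrite (lin0 (op_lin _ _)) (lin0 (@to_cochain_lin 0)).
  exists (@to_cochain b z); last exact: to_cochain_phi.
  by apply: to_cochain_piece; move: hz; rewrite -addn1 PoszD addrK.
have of_cyc j x : cyc (koszul_HH (cterm C j) a d) x ->
    cyc (dbl_HH (vpiece dg) phi a%:Z j d) (of_cochain x).
  move=> [hx fx]; split; first exact: of_cochain_piece.
  by rewrite -(phi_of _ _ _ _ hx) fx (lin0 (@of_cochain_lin a.+1)).
have to_cyc j v : cyc (dbl_HH (vpiece dg) phi a%:Z j d) v ->
    cyc (koszul_HH (cterm C j) a d) (to_cochain v).
  move=> [hv fv]; split; first exact: to_cochain_piece.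
  by rewrite -to_cochain_phi fv (lin0 (@to_cochain_lin a.+1)).
split.
- exact: (koszul_HHH_bdy_subspace C).
- by apply: dbl_HHH_bdy_subspace => //; apply: op_lin.
exists (@of_cochain a), (@to_cochain a); split; split=> //.
- move=> x [xc xb]; split; first exact: of_cyc.
  by have [hx _] := xc; rewrite -(D_of _ _ _ hx); apply: of_bdy.
- move=> x [y yc xb]; exists (of_cochain y); first exact: of_cyc.
  by have [hy _] := yc; rewrite -(D_of _ _ _ hy) -(lin_sub _ _ lF); apply: of_bdy.
- move=> x _; rewrite to_of_cochain subrr.
  by case: (koszul_HHH_bdy_subspace C a i d).
- move=> v [vc vb]; split; first exact: to_cyc.
  by rewrite -to_cochain_D; apply: to_bdy.
- move=> v [y yc vb]; exists (to_cochain y); first exact: to_cyc.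
  by rewrite -to_cochain_D -(lin_sub _ _ lG); apply: to_bdy.
- move=> v [[hv _] _]; rewrite (of_to_cochain hv) subrr.
  by case: (dbl_HHH_bdy_subspace vsub a i d (op_lin ix (k_phi M)) (op_lin ix (k_d M))).
Qed.
End KoszulVectors.

(** * Checking reductions by computation *)

(** The hypotheses of [contract_equiv] on basis vectors, as comparisons of normal
    forms. *)
Definition contraction_check (ix ix' : seq positive) (dg dg' : grading)
    (phi d p io h : positive -> svec) : bool :=
  [&& uniq ix, uniq ix',
      hom_check ix d dg dg 0 1, hom_check ix p dg dg' 0 0,
      hom_check ix' io dg' dg 0 0, hom_check ix h dg dg (-1) 0,
      all (fun j => veq (app phi (d j)) (app d (phi j))) ix,
      all (fun j => veq (app p (phi j)) [::]) ix,
      all (fun j => veq (app phi (io j)) [::]) ix',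
      all (fun j => veq (app p (io j)) (svar j)) ix' &
      all (fun j => veq (vadd (svar j) (vopp (app io (p j))))
                        (vadd (app phi (h j)) (app h (phi j)))) ix].

Definition homotopy_check (ix ix' : seq positive) (dg dg' : grading)
    (d p io h d' : positive -> svec) : bool :=
  [&& uniq ix, uniq ix',
      hom_check ix p dg dg' 0 0, hom_check ix' io dg' dg 0 0, hom_check ix h dg dg 0 (-1),
      all (fun j => veq (app p (d j)) (app d' (p j))) ix,
      all (fun j => veq (app d (io j)) (app io (d' j))) ix',
      all (fun j => veq (app p (io j)) (svar j)) ix' &
      all (fun j => veq (vadd (svar j) (vopp (app io (p j))))
                        (vadd (app d (h j)) (app h (d j)))) ix].

Lemma homotopy_check_uniq ix ix' dg dg' d p io h d' :
  homotopy_check ix ix' dg dg' d p io h d' -> uniq ix'.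
Proof. by case/and3P. Qed.

Section Checks.
Variable k : fieldType.
Hypothesis char0 : [pchar k] =i pred0.
Notation FV := (fv k).
Notation vec := (sv (M := FV) (delta k)).
Notation op := (op (k := k)).

Lemma op_rlin ix ix' (A B : positive -> svec) (v : FV) : uniq ix' ->
  op ix' B (rlin ix (fun j => vec (A j)) v) = rlin ix (fun j => vec (app (memo ix' B) (A j))) v.
Proof.
move=> us; rewrite /op rlin_comp //; last by move=> j; apply: vec_nil.
by apply: rlin_eq => j _; rewrite (sv_app char0).
Qed.

Lemma rlin_veq ix (A B : positive -> svec) (v : FV) :
  all (fun j => veq (A j) (B j)) ix -> rlin ix (fun j => vec (A j)) v = rlin ix (fun j => vec (B j)) v.
Proof. by move=> /allP h; apply: rlin_eq => j /h; apply: veqP. Qed.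

Lemma rlin_nil ix (v : FV) : rlin ix (fun=> vec [::]) v = 0.
Proof. by rewrite /rlin big1 // => j _; rewrite sv_nil (lin0 (lact_linr _)). Qed.

Lemma rlin_svar ix deg a i d (v : FV) : uniq ix -> vpiece (grade ix deg) a i d v ->
  rlin ix (fun j => vec (svar j)) v = v.
Proof.
move=> us hv; rewrite [RHS](vpiece_decomp us _ hv); last first.
  by move=> j; rewrite gradeE; case: (j \in ix).
by apply: rlin_eq => j _; rewrite sv_var.
Qed.

Lemma rlin_homotopy ix (A B B' : positive -> svec) deg a i d (v : FV) : uniq ix ->
  vpiece (grade ix deg) a i d v ->
  all (fun j => veq (vadd (svar j) (vopp (A j))) (vadd (B j) (B' j))) ix ->
  v - rlin ix (fun j => vec (A j)) v = rlin ix (fun j => vec (B j)) v + rlin ix (fun j => vec (B' j)) v.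
Proof.
move=> us hv /rlin_veq h; rewrite -{1}(rlin_svar us hv) rlinN !rlinD.
rewrite -[LHS](_ : rlin ix (fun j => vec (vadd (svar j) (vopp (A j)))) v = _).
  by rewrite h; apply: rlin_eq => j _; rewrite (svD char0).
by apply: rlin_eq => j _; rewrite (svD char0) (sv_opp char0).
Qed.

Section Contraction.
Variables (ix ix' : seq positive) (deg deg' : positive -> int * int * int).
Variables (phi d p io h : positive -> svec).
Notation dg := (grade ix deg).
Notation dg' := (grade ix' deg').
(** The differential induced on the retract. *)
Definition transfer (j : positive) : svec :=
  app (memo ix p) (app (memo ix d) (memo ix' io j)).

Lemma contraction_checkP a i e :
  contraction_check ix ix' dg dg' (memo ix phi) (memo ix d) (memo ix p) (memo ix' io) (memo ix h) ->
  sq_equiv (dbl_HHH (vpiece (k := k) dg) (op ix phi) (op ix d) a i e)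
           (cplx_H (vpiece dg') (op ix' transfer) a i e).
Proof.
case/and5P => us us' hd hp /and5P[hio hh phid pphi /and3P[phiio pio iop]].
apply: (contract_equiv (@vpiece_sub k dg) (@vpiece_sub k dg') (op_lin ix phi) (op_lin ix d)
  (op_lin ix h) (op_lin ix p) (op_lin ix' io) (op_lin ix' transfer)).
- by move=> b j f v /(hom_checkP hd); rewrite addr0.
- by move=> b j f v /(hom_checkP hh); rewrite addr0.
- by move=> b j f v /(hom_checkP hp); rewrite !addr0.
- by move=> b j f v /(hom_checkP hio); rewrite !addr0.
- by move=> b j f v _; rewrite !op_rlin //; apply: rlin_veq.
- by move=> b j f v _; rewrite op_rlin // (rlin_veq v pphi) rlin_nil.
- by move=> b j f v _; rewrite op_rlin // (rlin_veq v phiio) rlin_nil.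
- by move=> b j f v hv; rewrite op_rlin // (rlin_veq v pio) (rlin_svar us' hv).
- by move=> b j f v hv; rewrite !op_rlin //; apply: rlin_homotopy hv iop.
- move=> b j f v hv; rewrite -[op ix' io v]/(rlin ix' (fun j => vec (memo ix' io j)) v) !op_rlin //.
  by apply: rlin_eq => m hm; rewrite memoE hm.
Qed.
End Contraction.

Lemma homotopy_checkP ix ix' deg deg' (d p io h d' : positive -> svec) a i e :
  homotopy_check ix ix' (grade ix deg) (grade ix' deg')
    (memo ix d) (memo ix p) (memo ix' io) (memo ix h) (memo ix' d') ->
  sq_equiv (cplx_H (vpiece (k := k) (grade ix deg)) (op ix d) a i e)
           (cplx_H (vpiece (grade ix' deg')) (op ix' d') a i e).
Proof.
case/and5P => us us' hp hio /and5P[hh pd dio pio iop].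
apply: (homotopy_equiv (@vpiece_sub k _) (@vpiece_sub k _) (op_lin ix d)
  (op_lin ix h) (op_lin ix p) (op_lin ix' io) (op_lin ix' d')).
- by move=> b j f v /(hom_checkP hh); rewrite addr0.
- by move=> b j f v /(hom_checkP hp); rewrite !addr0.
- by move=> b j f v /(hom_checkP hio); rewrite !addr0.
- by move=> b j f v _; rewrite !op_rlin //; apply: rlin_veq.
- by move=> b j f v _; rewrite !op_rlin //; apply: rlin_veq.
- by move=> b j f v hv; rewrite op_rlin // (rlin_veq v pio) (rlin_svar us' hv).
- by move=> b j f v hv; rewrite !op_rlin //; apply: rlin_homotopy hv iop.
Qed.
End Checks.

(** * Sums of Koszul blocks *)

Arguments pmul : simpl never.
Arguments padd : simpl never.

(** (lin, (a, i, d)): a map R -> R given by alpha_s + alpha_t if lin holds, a Koszul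
    complex R -> R^2 -> R otherwise; (a, i, d) is the degree of the last
    generator. *)
Definition block := (bool * (nat * int * int))%type.

(** The generators are named after exterior monomials: i4 is the last one, i1 the
    first one of a Koszul complex, and i3 the first one of a map R -> R. *)
Definition kpos (lin : bool) : seq positive := if lin then [:: i3; i4] else four.

Section BlockData.
Variables (bl : positive -> block) (bs : seq positive).
Definition b_ix : seq positive := [seq kenc s b | b <- bs, s <- kpos (bl b).1].
Definition b_deg (m : positive) : int * int * int :=
  let: (b, s) := kdec m in
  let: (_, (a, i, d)) := bl b in
  match s with i1 => (a%:Z, i - 2, d + 4) | i4 => (a%:Z, i, d) | _ => (a%:Z, i - 1, d + 2) end.
Definition p_sum : poly := padd (pX false) (pX true).
Definition b_diff (m : positive) : svec :=
  let: (b, s) := kdec m in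
  if (bl b).1 then if s is i3 then [:: (kenc i4 b, p_sum)] else [::]
  else match s with
    | i1 => [:: (kenc i2 b, pX false); (kenc i3 b, pX true)]
    | i2 => [:: (kenc i4 b, pX true)]
    | i3 => [:: (kenc i4 b, pmul (pcst (qopp (qnat xH))) (pX false))]
    | _ => [::] end.
End BlockData.

Definition block_series (x : block) : nat -> int -> int -> nat :=
  let: (lin, (a, i, d)) := x in if lin then geom a i d else mono a i d.

Section Blocks.
Variable k : fieldType.
Hypothesis char0 : [pchar k] =i pred0.
Notation R := (polyR k).
Notation FV := (fv k).
Notation vec := (sv (M := FV) (delta k)).
Variables (bl : positive -> block) (bs : seq positive).
Hypothesis bs_uniq : uniq bs.
Notation ix := (b_ix bl bs).
Notation dg := (grade ix (b_deg bl)).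
Notation D := (op (k := k) ix (b_diff bl)).

Notation X := ('X_0 : R).
Notation Y := ('X_1 : R).

Lemma kpos_four lin : {subset kpos lin <= four}.
Proof. by case: lin => // s; rewrite !inE => /orP[] /eqP ->. Qed.

Lemma b_ixP m : reflect (exists b s, [/\ b \in bs, s \in kpos (bl b).1 & m = kenc s b]) (m \in ix).
Proof.
apply: (iffP allpairsPdep) => [[b [s [hb hs ->]]]|[b [s [hb hs ->]]]]; by exists b, s.
Qed.

Lemma mem_b_ix b s : s \in four -> (kenc s b \in ix) = (b \in bs) && (s \in kpos (bl b).1).
Proof.
move=> hs; apply/b_ixP/andP => [[b' [s' [hb hs' E]]]|[hb hs']]; last by exists b, s.
by have := congr1 kdec E; rewrite !kencK ?(kpos_four hs') // => -[-> ->].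
Qed.

Lemma b_dg b s : b \in bs -> s \in kpos (bl b).1 -> dg (kenc s b) = Some (b_deg bl (kenc s b)).
Proof. by move=> hb hs; rewrite gradeE mem_b_ix ?hb ?hs // (kpos_four hs). Qed.

Lemma kenc_neq s s' b b' : s \in four -> s' \in four -> b != b' -> kenc s b != kenc s' b'.
Proof.
move=> hs hs'; apply: contra_neq => /(congr1 kdec); rewrite !kencK // => -[->].
by [].
Qed.

Lemma vec_coord (s : svec) m :
  vec s m = \sum_(t <- s) (if t.1 == m then peval k t.2 else 0).
Proof.
rewrite /sv fct_sumE; apply: eq_bigr => t _; rewrite /= /fv_act /delta.
by case: eqP; rewrite ?mulr1 ?mulr0.
Qed.

Lemma D_coord (x : FV) b s : b \in bs -> s \in kpos (bl b).1 ->
  D x (kenc s b) = \sum_(s' <- kpos (bl b).1) x (kenc s' b) * vec (b_diff bl (kenc s' b)) (kenc s b).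
Proof.
move=> hb hs; rewrite /D /rlin fct_sumE.
under eq_big_seq => m hm do rewrite memoE hm.
rewrite big_allpairs_dep (bigD1_seq b) //= [Y in _ + Y]big1 ?addr0 // => b' ne.
rewrite big_seq big1 // => s' /kpos_four hs'; rewrite /fv_act vec_coord.
suff -> : \sum_(t <- b_diff bl (kenc s' b')) (if t.1 == kenc s b then peval k t.2 else 0) = 0.
  by rewrite mulr0.
have ke r : r \in four -> (kenc r b' == kenc s b) = false.
  by move=> hr; apply: negbTE; apply: kenc_neq => //; apply: kpos_four hs.
rewrite /b_diff kencK //; move: hs'; rewrite !inE => /or4P[] /eqP ->; case: (bl b').1;
  by rewrite !(big_cons, big_nil) ?ke ?addr0.
Qed.

Lemma kos_coord (x : FV) b : b \in bs -> ~~ (bl b).1 ->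
  [/\ D x (kenc i1 b) = 0, D x (kenc i2 b) = X * x (kenc i1 b),
      D x (kenc i3 b) = Y * x (kenc i1 b)
    & D x (kenc i4 b) = Y * x (kenc i2 b) - X * x (kenc i3 b)].
Proof.
move=> hb /negPf lb.
have E s : s \in four -> D x (kenc s b) =
    \sum_(s' <- four) x (kenc s' b) * vec (b_diff bl (kenc s' b)) (kenc s b).
  by move=> hs; rewrite D_coord ?lb.
split; rewrite E // /four !big_cons big_nil !vec_coord /b_diff !kencK //= lb
  !(big_cons, big_nil) /= ?eqxx /=.
all: rewrite ?(pevalM char0) ?pevalN1 ?pevalX ?mulN1r.
- by rewrite !(mulr0, addr0).
- by rewrite !(mulr0, addr0) mulrC.
- by rewrite !(mulr0, addr0, add0r) mulrC.
- by rewrite !(mulr0, addr0, add0r) mulrN mulrC [X in _ - X]mulrC.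
Qed.

Lemma lin_coord (x : FV) b : b \in bs -> (bl b).1 ->
  D x (kenc i3 b) = 0 /\ D x (kenc i4 b) = (X + Y) * x (kenc i3 b).
Proof.
move=> hb lb.
have E s : s \in [:: i3; i4] -> D x (kenc s b) =
    \sum_(s' <- [:: i3; i4]) x (kenc s' b) * vec (b_diff bl (kenc s' b)) (kenc s b).
  by move=> hs; rewrite D_coord ?lb.
split; rewrite E // !big_cons big_nil !vec_coord /b_diff !kencK //= lb
  !(big_cons, big_nil) /= ?eqxx /=.
  by rewrite !(mulr0, addr0).
by rewrite (pevalD char0) !pevalX !(mulr0, addr0) mulrC.
Qed.
End Blocks.

(** * Division *)

Section Division.
Variable k : fieldType.
Notation R := (polyR k).
Notation X := ('X_0 : R).
Notation Y := ('X_1 : R).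

(** A polynomial without constant term lies in the ideal of the two variables: drop
    the multiples of Y, and what remains is divisible by X.  Hence the cohomology
    of a Koszul block is detected by the constant coefficient. *)
Lemma mdivX_ideal (z : R) : z@_0 = 0 ->
  z = Y * mdivX 1 z + X * mdivX 0 (z - Y * mdivX 1 z).
Proof.
move=> z0; rewrite [W in _ + W]mdivXK; first by rewrite addrC subrK.
move=> m.
rewrite mcoeff_msupp mcoeffB mdivX_coeff; case: ifP => [_|m1]; first by rewrite subrr eqxx.
rewrite subr0; apply: contraNT; rewrite -eqn0Ngt => /eqP m0.
suff -> : m = 0%MM by rewrite z0.
apply/mnmP => i; rewrite mnm0E; have [->|->] := ord2 i; first exact: m0.
by apply/eqP; rewrite eqn0Ngt m1.
Qed.

(** Evaluation at a point of the line X + Y = 0; on homogeneous polynomials it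
    detects the class modulo X + Y. *)
Definition ev (p : R) : k := p.@[fun i : 'I_2 => if i == 0 then -1 else 1].

Lemma ev_lin : linear (ev : R -> k^o).
Proof. by move=> c p q; rewrite /ev mevalD mevalZ. Qed.
Lemma evM p q : ev (p * q) = ev p * ev q. Proof. exact: mevalM. Qed.
Lemma evX : ev X = -1. Proof. by rewrite /ev mevalXU. Qed.
Lemma evY : ev Y = 1. Proof. by rewrite /ev mevalXU. Qed.
Lemma evYn n : ev (Y ^+ n) = 1.
Proof. by rewrite /ev rmorphXn /= mevalXU expr1n. Qed.

Lemma sum_div_monomial a b : exists2 q : R, homdeg ((2 * (a + b))%:Z - 2) q &
  X ^+ a * Y ^+ b = (X + Y) * q + (-1) ^+ a *: Y ^+ (a + b).
Proof.
elim: a => [|a [q hq E]]; first by exists 0; [exact: homdeg0 | rewrite mulr0 add0r mul1r scale1r].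
have hY : homdeg (2 * (a + b))%:Z (Y ^+ (a + b) : R) by apply: homdeg_exp; apply: homdegU.
exists (X * q + (-1) ^+ a *: Y ^+ (a + b)).
  rewrite addSn mulnS PoszD addrAC subrr add0r; apply: homdegD; last exact: homdegZ.
  by rewrite -[(2 * (a + b))%:Z](subrK 2) addrC; apply: homdegM => //; apply: homdegU.
have -> : X ^+ a.+1 * Y ^+ b = (X + Y) * (X * q) + (-1) ^+ a *: (X * Y ^+ (a + b)).
  by rewrite exprS -mulrA E mulrDr mulrCA scalerAr.
rewrite mulrDr -addrA -scalerAr exprS mulN1r scaleNr addSn [Y ^+ _.+1]exprS (mulrDl X Y (Y ^+ _)) scalerDr.
by rewrite addrK.
Qed.

(** Replacing X by -Y monomial by monomial leaves a multiple of Y^e, whose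
    coefficient is the value at X = -1, Y = 1. *)
Lemma sum_div (e : nat) (z : R) : homdeg (2 * e)%:Z z ->
  exists2 q : R, homdeg ((2 * e)%:Z - 2) q & z = (X + Y) * q + ev z *: Y ^+ e.
Proof.
move=> hz.
suff H s : {in s, forall m, mdeg m = e} -> exists2 q : R, homdeg ((2 * e)%:Z - 2) q &
    \sum_(m <- s) z@_m *: 'X_[m] = (X + Y) * q + ev (\sum_(m <- s) z@_m *: 'X_[m]) *: Y ^+ e.
  have := H (msupp z); rewrite -mpolyE; apply.
  by move=> m /hz [] /eqP; rewrite eqn_mul2l => /eqP.
elim: s => [|m s IH] hs.
  by exists 0; rewrite ?big_nil ?(lin0 ev_lin) ?scale0r ?mulr0 ?addr0 //; apply: homdeg0.
have [q hq E] : exists2 q : R, homdeg ((2 * e)%:Z - 2) q &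
    \sum_(m <- s) z@_m *: 'X_[m] = (X + Y) * q + ev (\sum_(m <- s) z@_m *: 'X_[m]) *: Y ^+ e.
  by apply: IH => x hx; apply: hs; rewrite inE hx orbT.
have me : e = (m (0 : 'I_2)%R + m (1 : 'I_2)%R)%N.
  by rewrite -(hs m) ?inE ?eqxx // mdegE !big_ord_recr big_ord0 /= add0n; congr (m _ + m _)%N; apply: val_inj.
have mE : 'X_[m] = X ^+ m 0 * Y ^+ m 1 :> R.
  rewrite mpolyXE_id !big_ord_recr big_ord0 /= mul1r.
  by congr ('X_ _ ^+ m _ * 'X_ _ ^+ m _); apply: val_inj.
have evm : ev 'X_[m] = (-1) ^+ m 0.
  by rewrite mE evM evYn mulr1 /ev rmorphXn /= -/(ev X) evX.
have [q' hq' E'] := sum_div_monomial (m 0) (m 1); rewrite -me in hq' E'.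
exists (z@_m *: q' + q); first exact: homdegP.
rewrite !big_cons; set S := \sum_(m <- s) _ in E *.
have -> : ev (z@_m *: 'X_[m] + S) = z@_m * (-1) ^+ m 0 + ev S by rewrite ev_lin evm.
by rewrite mE E' {1}E scalerDr scalerDl mulrDr -scalerAr scalerA addrACA.
Qed.

Lemma homdeg_even (n : nat) d (z : {mpoly k[n]}) : homdeg d z ->
  z = 0 \/ exists e : nat, d = (2 * e)%:Z.
Proof.
move=> hz; have [->|nz] := eqVneq z 0; [by left | right].
by exists (mdeg (mlead z)); rewrite (hz _ (mlead_supp nz)).
Qed.

Lemma homdeg_const (n : nat) d (z : {mpoly k[n]}) : homdeg d z -> d != 0 -> z@_0 = 0.
Proof.
move=> hz; apply: contraNeq; rewrite -mcoeff_msupp => /hz <-.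
by rewrite mdeg0.
Qed.
End Division.

(** * Cohomology of a sum of blocks *)

Section BlockHomology.
Variable k : fieldType.
Hypothesis char0 : [pchar k] =i pred0.
Notation R := (polyR k).
Notation FV := (fv k).
Variables (bl : positive -> block) (bs : seq positive).
Notation ix := (b_ix bl bs).
Notation dg := (grade ix (b_deg bl)).
Notation D := (op (k := k) ix (b_diff bl)).
Hypothesis bs_uniq : uniq bs.
Hypothesis ix_uniq : uniq ix.
Hypothesis D_hom : hom_check ix (memo ix (b_diff bl)) dg dg 0 1.
Notation X := ('X_0 : R).
Notation Y := ('X_1 : R).

Lemma i4_kpos lin : i4 \in kpos lin. Proof. by case: lin. Qed.

(** The class of a cycle is read off at the last generator of each block: modulo
    (X, Y) for a Koszul block, modulo X + Y for the other ones. *)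
Definition top_functional (b : positive) (x : FV) : k :=
  if (bl b).1 then ev (x (kenc i4 b)) else (x (kenc i4 b))@_0.

Lemma top_functional_lin b : linear (top_functional b : FV -> k^o).
Proof.
move=> c x y; rewrite /top_functional !fctE; case: ifP => _; first exact: ev_lin.
by rewrite mcoeffD mcoeffZ.
Qed.

Variables (a : nat) (i d : int).
Notation P := (vpiece (k := k) dg).

Lemma piece_top (x : FV) b : P a%:Z i d x -> b \in bs ->
  let: (_, (a0, i0, d0)) := bl b in
  if (a0 == a) && (i0 == i) then regular_piece (d - d0) (x (kenc i4 b)) else x (kenc i4 b) = 0.
Proof.
move=> hx hb; have := hx (kenc i4 b).
rewrite b_dg ?i4_kpos // /b_deg kencK //; case: (bl b) => [lin [[a0 i0] d0]].
by rewrite eqz_nat.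
Qed.

(** The generating cycle of block b in internal degree d, meaningful when the block
    contributes in that degree; for a Koszul block the exponent is then 0. *)
Definition top_cycle (b : positive) : FV :=
  let: (_, (_, _, d0)) := bl b in lact (Y ^+ `|d - d0|./2) (delta k (kenc i4 b)).

Lemma block_series_nz b : block_series (bl b) a i d != 0%N ->
  let: (lin, (a0, i0, d0)) := bl b in
  [/\ a0 = a, i0 = i, d - d0 = (2 * `|d - d0|./2)%:Z & ~~ lin -> d = d0].
Proof.
rewrite /block_series; case: (bl b) => [[] [[a0 i0] d0]]; rewrite /geom /mono eqb0 negbK.
  case/and4P => /eqP -> /eqP -> le dv; split=> //.
  rewrite -Num.Theory.subr_ge0 in le.
  have [q Eq] := dvdzP dv; rewrite -[LHS]gez0_abs //; congr Posz.
  by rewrite Eq abszM muln2 doubleK mul2n.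
by case/and3P => /eqP -> /eqP -> /eqP ->; rewrite subrr.
Qed.

Lemma top_functional_cycle b b' : b' \in bs -> block_series (bl b) a i d != 0%N ->
  top_functional b' (top_cycle b) = (b == b')%:R.
Proof.
move=> hb' /block_series_nz; rewrite /top_functional /top_cycle.
case Eb: (bl b) => [lin [[a0 i0] d0]] [_ _ _ hlin].
have -> : lact (Y ^+ `|d - d0|./2) (delta k (kenc i4 b)) (kenc i4 b') =
    Y ^+ `|d - d0|./2 * (b == b')%:R :> R.
  by rewrite /= /fv_act /delta.
have [<-|ne] := eqVneq b b'; last first.
  by rewrite mulr0 mcoeff0 (lin0 (@ev_lin k)) if_same.
rewrite mulr1 evYn Eb /=; case: lin hlin {Eb} => // /(_ isT) ->.
by rewrite subrr /= expr0 mcoeff1 eqxx.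
Qed.

Lemma top_cycle_piece b : b \in bs -> block_series (bl b) a i d != 0%N ->
  P a%:Z i d (top_cycle b).
Proof.
move=> hb /block_series_nz; rewrite /top_cycle.
case Eb: (bl b) => [lin [[a0 i0] d0]] [<- <- E _] m; rewrite /= /fv_act /delta.
have [<-|_] := eqVneq (kenc i4 b) m; last first.
  rewrite mulr0; case: (dg m) => [[[a2 i2] d2]|] //.
  by case: ifP => // _; apply: regular_piece0.
rewrite b_dg ?i4_kpos // /b_deg kencK // Eb !eqxx mulr1 /= {1}E.
by apply: homdeg_exp; apply: homdegU.
Qed.

Lemma D_top_cycle b : b \in bs -> D (top_cycle b) = 0.
Proof.
move=> hb; rewrite /top_cycle; case Eb: (bl b) => [lin [[a0 i0] d0]].
rewrite /op rlin_lact rlin_delta // mem_b_ix // hb i4_kpos memoE mem_b_ix // hb i4_kpos.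
rewrite /b_diff kencK // Eb /=; case: lin {Eb}; by rewrite sv_nil (lin0 (fv_linr _)).
Qed.

Lemma top_functional_inactive b x : b \in bs -> block_series (bl b) a i d = 0%N ->
  P a%:Z i d x -> top_functional b x = 0.
Proof.
move=> hb na hx; have := piece_top hx hb; move: na; rewrite /top_functional /block_series.
case: (bl b) => [lin [[a0 i0] d0]] na /=.
case: ifP => [/andP[/eqP E1 /eqP E2] hq|_ ->]; last by rewrite mcoeff0 (lin0 (@ev_lin k)) if_same.
subst a0 i0; move: na; case: lin; rewrite /geom /mono !eqxx => /= /eqP; rewrite eqb0 => na.
  have [->|[e E]] := homdeg_even hq; first by rewrite (lin0 (@ev_lin k)).
  by case/negP: na; rewrite -Num.Theory.subr_ge0 E PoszM dvdz_mulr.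
by apply: (homdeg_const hq); rewrite subr_eq0.
Qed.

Lemma top_functional_boundary b (y : FV) : b \in bs -> top_functional b (D y) = 0.
Proof.
move=> hb; rewrite /top_functional; case: ifPn => lb.
  by have [_ ->] := lin_coord char0 bs_uniq y hb lb; rewrite evM (linD (@ev_lin k)) evX evY addNr mul0r.
have [_ _ _ ->] := kos_coord char0 bs_uniq y hb lb.
by rewrite mcoeffB !mcoeffMU !mnm0E subrr.
Qed.

Lemma sum_nz : X + Y != 0.
Proof.
apply/eqP => /(congr1 (mcoeff U_(0))); rewrite mcoeffD !mcoeffX mcoeff0 eqxx eq_mnm1.
by rewrite addr0 => /eqP; rewrite oner_eq0.
Qed.

(** Exactness of every block away from the classes seen by [top_functional]: the
    preimage y is given by division, at i4 because the functional vanishes and at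
    the middle generators because x is a cycle. *)
Lemma cycle_boundary (x : FV) : P a%:Z i d x -> D x = 0 ->
  (forall b, b \in bs -> top_functional b x = 0) ->
  exists2 y, P a%:Z (i - 1) d y & x = D y.
Proof.
move=> hx Dx lx.
(* Division by X + Y; the degree is part of the argument because it has to be
   controlled when the entry is zero. *)
have /choice[ld ldP] (ze : R * int) : exists q : R, homdeg ze.2 ze.1 -> ev ze.1 = 0 ->
    homdeg (ze.2 - 2) q /\ ze.1 = (X + Y) * q.
  case: ze => z e; have [hz|nhz] := pselect (homdeg e z); last by exists 0.
  have [z0|[e' Ee]] := homdeg_even hz.
    by exists 0 => _ _ /=; rewrite z0 mulr0; split=> //; apply: homdeg0.
  rewrite Ee in hz *; have [q hq E] := sum_div hz.
  by exists q => _ ez; split=> //=; rewrite {1}E /= ez scale0r addr0.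
pose y0 (s b : positive) : R :=
  let: (lin, (_, _, d0)) := bl b in
  let z := x (kenc i4 b) in
  if lin then if s is i3 then ld (z, d - d0) else 0
  else match s with
    | i1 => mdivX 0 (x (kenc i2 b))
    | i2 => mdivX 1 z
    | i3 => - mdivX 0 (z - Y * mdivX 1 z)
    | _ => 0 end.
pose y : FV := fun m => if m \in ix then y0 (kdec m).2 (kdec m).1 else 0.
have yE b s : b \in bs -> s \in kpos (bl b).1 -> y (kenc s b) = y0 s b.
  move=> hb hs; have hs4 := kpos_four hs.
  by rewrite /y mem_b_ix // hb hs kencK.
have py : P a%:Z (i - 1) d y.
  move=> m; case: (boolP (m \in ix)) => [/b_ixP[b [s [hb hs ->]]]|hm]; last first.
    by rewrite gradeE (negPf hm) /y (negPf hm).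
  have hs4 := kpos_four hs.
  have lin_bl : (bl b).1 -> (s == i3) || (s == i4).
    by move=> lb; move: hs; rewrite lb !inE.
  rewrite b_dg // yE // /b_deg kencK // /y0; have := lx b hb.
  have := hx (kenc i2 b); have := piece_top hx hb; rewrite /top_functional.
  have in2 : ~~ (bl b).1 -> dg (kenc i2 b) = Some (b_deg bl (kenc i2 b)).
    by move=> lb; apply: b_dg => //; rewrite (negPf lb).
  move: lin_bl in2; rewrite /b_deg kencK //.
  case: (bl b) => [[] [[a0 i0] d0]] /= lin_bl in2.
    have [/eqP -> /=|/eqP -> /=] := orP (lin_bl isT); last first.
      by move=> *; case: ifP => // _; apply: regular_piece0.
    rewrite eqz_nat (inj_eq (addIr (-1))); case: ifP => _ hz _ ez.
      have [hq _] := ldP (x (kenc i4 b), d - d0) hz ez.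
      by rewrite opprD addrA.
    have hz' : homdeg (d - d0) (x (kenc i4 b)) by rewrite hz; apply: homdeg0.
    have [_ /esym/eqP] := ldP (x (kenc i4 b), d - d0) hz' ez.
    by rewrite /= {2}hz mulf_eq0 (negPf sum_nz) => /eqP.
  rewrite in2 //; move: hs4; rewrite !inE => /or4P[] /eqP -> /=;
    rewrite !eqz_nat ?(inj_eq (addIr _)).
  - move=> _ h2 _; move: h2; have -> : (i0 - 1 == i) = (i0 - 2 == i - 1).
      by rewrite -[RHS](inj_eq (addIr 1)) subrK -addrA.
    case: ifP => _ h2; last by rewrite h2 (lin0 (mdivX_linear _)).
    have -> : d - (d0 + 4) = d - (d0 + 2) - 2 by rewrite -addrA -opprD -addrA.
    exact: mdivX_homdeg.
  - case: ifP => _ hz _ _; last by rewrite hz (lin0 (mdivX_linear _)).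
    by rewrite opprD addrA; apply: mdivX_homdeg.
  - case: ifP => _ hz _ _; last first.
      by rewrite hz (lin0 (mdivX_linear _)) mulr0 subr0 (lin0 (mdivX_linear _)) oppr0.
    rewrite opprD addrA -scaleN1r; apply: homdegZ; apply: mdivX_homdeg; rewrite -scaleN1r.
    apply: homdegD => //; apply: homdegZ; rewrite -[d - d0](subrK 2) addrC.
    by apply: homdegM; [apply: homdegU | apply: mdivX_homdeg].
  - by move=> _ _ _; case: ifP => // _; apply: regular_piece0.
exists y => //; apply: funext => m.
have hDy := hom_checkP D_hom py; rewrite addr0 subrK in hDy.
case: (boolP (m \in ix)) => [/b_ixP[b [s [hb hs ->]]]|hm]; last first.
  by have := hx m; have := hDy m; rewrite gradeE (negPf hm) => -> ->.
have hs4 := kpos_four hs.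
case: (boolP (bl b).1) => lb.
  have [x3 x4] := lin_coord char0 bs_uniq x hb lb; have [y3 y4] := lin_coord char0 bs_uniq y hb lb.
  move: hs; rewrite lb !inE => /orP[] /eqP ->.
    rewrite y3; apply: (mulfI sum_nz); rewrite -x4 Dx mulr0 //.
  rewrite y4 yE ?lb // /y0; have := piece_top hx hb; have := lx b hb; rewrite /top_functional lb.
  case: (bl b) lb => [[] [[a0 i0] d0]] // _ ez hz.
  have [|_ //] := ldP (x (kenc i4 b), d - d0) _ ez.
  by move: hz; case: ifP => // _ -> /=; apply: homdeg0.
have [x1 x2 x3 x4] := kos_coord char0 bs_uniq x hb lb; have [y1 y2 y3 y4] := kos_coord char0 bs_uniq y hb lb.
have in_k s' : s' \in four -> s' \in kpos (bl b).1 by rewrite (negPf lb).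
have y0E s' : s' \in four -> y (kenc s' b) = match s' with
    | i1 => mdivX 0 (x (kenc i2 b)) | i2 => mdivX 1 (x (kenc i4 b))
    | i3 => - mdivX 0 (x (kenc i4 b) - Y * mdivX 1 (x (kenc i4 b))) | _ => 0 end.
  move=> hs'; rewrite yE ?in_k // /y0; case: (bl b) lb => [[] [[a0 i0] d0]] //.
have xx : Y * x (kenc i2 b) = X * x (kenc i3 b).
  by apply/eqP; rewrite -subr_eq0 -x4 Dx.
have x2E : X * mdivX 0 (x (kenc i2 b)) = x (kenc i2 b) by apply: mdivX_cofactor xx.
move: hs4; rewrite !inE => /or4P[] /eqP ->.
- by rewrite y1; apply: (mulfI (X_neq0 k 0)); rewrite -x2 Dx mulr0.
- by rewrite y2 y0E // x2E.
- rewrite y3 y0E //; apply: (mulfI (X_neq0 k 0)).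
  by rewrite -xx mulrCA x2E.
- rewrite y4 !y0E // mulrN opprK; apply: mdivX_ideal.
  by have := lx b hb; rewrite /top_functional (negPf lb).
Qed.

(** The blocks contributing in degree (a, i, d) give one class each, dual to the
    functionals. *)
Lemma block_homology_dim :
  has_dim (cplx_H P D a%:Z i d) (\sum_(b <- bs) block_series (bl b) a i d)%N.
Proof.
pose J := [seq b <- bs | block_series (bl b) a i d != 0%N].
have J_bs b : b \in J -> b \in bs by rewrite mem_filter => /andP[].
have J_act b : b \in J -> block_series (bl b) a i d != 0%N by rewrite mem_filter => /andP[].
have J_uniq : uniq J by apply: filter_uniq.
have -> : (\sum_(b <- bs) block_series (bl b) a i d)%N = size J.
  rewrite size_filter -sum1_count [RHS]big_mkcond; apply: eq_bigr => b _.
  rewrite /block_series; case: (bl b) => [[] [[a0 i0] d0]]; rewrite /geom /mono.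
    by case: [&& _, _, _ & _].
  by case: [&& _, _ & _].
pose nb (j : 'I_(size J)) : positive := nth xH J j.
have nbJ j : nb j \in J by apply: mem_nth.
have lD : linear D by apply: op_lin.
exists (fun j => top_cycle (nb j)) => [j|z [Pz Dz]].
  by split; [apply: top_cycle_piece; [apply: J_bs | apply: J_act] | apply/D_top_cycle/J_bs].
pose res (c : {ffun 'I_(size J) -> k}) : FV := z - \sum_j c j *: top_cycle (nb j).
have res_P c : P a%:Z i d (res c).
  apply: (subspaceB (@vpiece_sub k dg a%:Z i d)) => //.
  apply: (subspace_sum _ _ (@vpiece_sub k dg a%:Z i d)) => j.
  by apply: top_cycle_piece; [apply: J_bs | apply: J_act].
have res_D c : D (res c) = 0.
  rewrite /res (lin_sub _ _ lD) Dz (lin_sum _ _ _ lD) big1 ?subr0 // => j _.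
  by rewrite D_top_cycle ?scaler0 //; apply: J_bs.
have res_top c j : top_functional (nb j) (res c) = top_functional (nb j) z - c j.
  rewrite /res (lin_sub _ _ (top_functional_lin _)) (lin_sum _ _ _ (top_functional_lin _)).
  congr (_ - _); rewrite (bigD1 j) //= big1 ?addr0 => [|j' ne].
    by rewrite top_functional_cycle ?eqxx ?J_bs ?J_act //; apply: mulr1.
  rewrite top_functional_cycle ?J_bs ?J_act // nth_uniq // (inj_eq val_inj) (negPf ne).
  by rewrite scaler0.
exists [ffun j => top_functional (nb j) z]; split=> [|c'].
  apply: (cycle_boundary (res_P _) (res_D _)) => b hb.
  have [na|act] := eqVneq (block_series (bl b) a i d) 0%N.
    exact: top_functional_inactive na (res_P _).
  have hbJ : b \in J by rewrite mem_filter act.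
  have hi : (index b J < size J)%N by rewrite index_mem.
  have := res_top [ffun j => top_functional (nb j) z] (Ordinal hi).
  by rewrite ffunE /nb /= nth_index // subrr.
move=> [y _ E]; apply/ffunP => j; rewrite ffunE.
have := res_top c' j; rewrite [res c']E top_functional_boundary ?J_bs // => /esym/eqP.
by rewrite subr_eq0 => /eqP.
Qed.
End BlockHomology.

(** * The Whitehead complex *)

(** Gaussian elimination on the columns of a matrix A.  Only its result is verified,
    so the choices made here are heuristic.  A column with an invertible entry
    in row i is scaled to have entry 1 there and used to clear row i from the other columns;
    it then cancels against row i.  Each column travels with the combination of
    basis vectors that produced it. *)
Definition unit_entry (s : svec) : option (positive * Q) :=
  foldr (fun t acc => if t.2 is [:: ((O, O), c)] then Some (t.1, c) else acc) None s.
Definition coef (i : positive) (s : svec) : poly :=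
  foldr (fun t acc => if BinPos.Pos.eqb t.1 i then t.2 else acc) [::] s.
Definition qinv (c : Q) : Q := Qreduction.Qred (QArith_base.Qinv c).

(** Modulo the image of A the basis vector pv_row equals pv_rest; the difference
    of the two is the image of pv_lift. *)
Record pivot := Pivot {
  pv_row : positive;
  pv_rest : svec;
  pv_lift : svec
}.
Notation column := (positive * (svec * svec))%type.

Definition clear (i : positive) (x : svec * svec) (c : column) : column :=
  let: (l, (v, io)) := c in
  if coef i v is [::] then c else
  let q := pmul (pcst (qopp (qnat xH))) (coef i v) in
  (l, (vadd v (vscale q x.1), vadd io (vscale q x.2))).

Fixpoint sweep (fuel : nat) (todo kept : seq column) (pv : seq pivot) : seq column * seq pivot :=
  match fuel, todo with
  | n.+1, (j, (v, io)) :: todo' =>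
    if unit_entry v is Some (i, c) then
      let u := pcst (qinv c) in let x := (vscale u v, vscale u io) in
      sweep n (map (clear i x) todo') (map (clear i x) kept)
        (Pivot i (vadd (svar i) (vopp x.1)) x.2 :: pv)
    else sweep n todo' ((j, (v, io)) :: kept) pv
  | _, _ => (todo ++ kept, pv)
  end.
(** Clearing creates new invertible entries in columns already passed over, so
    sweeps are repeated until one finds no pivot. *)
Fixpoint sweeps (n : nat) (cs : seq column) (pv : seq pivot) : seq column * seq pivot :=
  if n is n'.+1 then
    let: (cs', pv') := sweep (size cs) cs [::] pv in
    if size pv' == size pv then (cs', pv') else sweeps n' cs' pv'
  else (cs, pv).

(** The groups are the degrees, in increasing order: a basis vector that has been
    cancelled as a pivot row of one degree is left out as a column of the next. *)
Fixpoint eliminate_groups (A : positive -> svec) (gs : seq (seq positive)) (rows : PM.t unit)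
    (alive : seq (positive * svec)) (pv : seq pivot) : seq (positive * svec) * seq pivot :=
  if gs is g :: gs' then
    let cols := [seq (j, (A j, svar j)) | j <- g & ~~ PM.mem j rows] in
    let: (cs, pg) := sweeps 10 cols [::] in
    eliminate_groups A gs' (foldl (fun m x => PM.add (pv_row x) tt m) rows pg)
      ([seq (c.1, c.2.2) | c <- cs] ++ alive) (pg ++ pv)
  else (alive, pv).

(** A retraction onto the span of ct_ix: projection, inclusion, homotopy. *)
Record contraction := Contraction {
  ct_ix : seq positive;
  ct_p : positive -> svec;
  ct_io : positive -> svec;
  ct_h : positive -> svec
}.

Definition eliminate (A : positive -> svec) (gs : seq (seq positive)) : contraction :=
  let: (alive, pv) := eliminate_groups A gs (PM.empty _) [::] [::] in
  let ix := [seq x.1 | x <- alive] in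
  (* A later pivot column has been cleared of the earlier pivot rows, but not
     conversely, so the rows are resolved from the last pivot to the first; pv
     lists them in that order. *)
  let: (p, h) := foldl (fun ph v =>
      (PM.add (pv_row v) (app (look ph.1) (pv_rest v)) ph.1,
       PM.add (pv_row v) (vadd (pv_lift v) (app (look ph.2) (pv_rest v))) ph.2))
    (tabulate ix svar, PM.empty _) pv in
  Contraction ix (look p) (look (foldr (fun x m => PM.add x.1 x.2 m) (PM.empty _) alive)) (look h).

(** Degrees a run over 0, 1, 2; the complex lives in cohomological degrees -3 to 2. *)
Definition by_degree (dg : grading) (ix : seq positive) : seq (seq positive) :=
  [seq [seq j <- ix | if dg j is Some (a, i, _) then (a == n.1) && (i == n.2) else false]
    | n <- [seq (a, i) | a <- [:: 0; 1; 2 : int], i <- [:: -3; -2; -1; 0; 1; 2 : int]]].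

Definition W_model : mdata :=
  mtens (mtens (mtens (mtens (m_rouquier_inv false) (m_rouquier_inv false))
    (m_rouquier true)) (m_rouquier_inv false)) (m_rouquier true).
Definition W_ix : seq positive := k_ix W_model.
Definition W_dg : grading := grade W_ix (k_deg W_model).
Definition W_phi : positive -> svec := memo W_ix (k_phi W_model).
Definition W_d : positive -> svec := memo W_ix (k_d W_model).
Definition ct1 : contraction := eliminate W_phi (by_degree W_dg W_ix).
Definition ix1 : seq positive := ct_ix ct1.
Definition dg1 : grading := grade ix1 (k_deg W_model).
Definition p1 : positive -> svec := memo W_ix (ct_p ct1).
Definition io1 : positive -> svec := memo ix1 (ct_io ct1).
Definition h1 : positive -> svec := memo W_ix (ct_h ct1).
Definition d1 : positive -> svec := memo ix1 (fun j => app p1 (app W_d (io1 j))).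
Definition ct2 : contraction := eliminate d1 (by_degree dg1 ix1).
Definition d2 : positive -> svec :=
  memo (ct_ix ct2) (fun j => app (ct_p ct2) (app d1 (ct_io ct2 j))).

Definition point (a : nat) (i d : int) : block := (false, (a, i, d)).
Definition line (a : nat) (i d : int) : block := (true, (a, i, d)).
Definition blocks : seq block :=
  [:: point 0 1 (-1); point 0 2 (-3); point 1 (-1) (-1); point 1 0 (-3); line 1 0 (-3);
      point 1 1 (-5); point 1 2 (-7); point 2 (-1) (-5); line 2 0 (-7)].
Definition block_at (b : positive) : block := nth (point 0 0 0) blocks (BinPos.Pos.to_nat b).-1.
Definition block_ids : seq positive := [seq BinPos.Pos.of_nat n | n <- iota 1 (size blocks)].
Definition B_ix : seq positive := b_ix block_at block_ids.
Definition B_dg : grading := grade B_ix (b_deg block_at).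
Definition B_d : positive -> svec := memo B_ix (b_diff block_at).
Definition word (s : positive) (w : seq positive) : positive :=
  kenc s (if w is l :: w' then foldl enc l w' else xH).
(** For each block, the name of one generator surviving both eliminations, taken in
    the degree of the first generator of the block.  Its image under d2 determines
    the rest of the block. *)
Definition seeds : seq positive :=
  [:: word i1 [:: i3; i1; i3; i1; i2]; word i1 [:: i2; i3; i3; i1; i2];
      word i3 [:: i1; i1; i2; i1; i2]; word i3 [:: i1; i1; i3; i1; i2];
      word i3 [:: i2; i3; i2; i1; i1]; word i3 [:: i3; i1; i1; i3; i1];
      word i3 [:: i2; i3; i3; i1; i1]; word i4 [:: i1; i1; i2; i1; i1];
      word i4 [:: i2; i2; i2; i1; i1]].
Definition seed (b : positive) : positive := nth xH seeds (BinPos.Pos.to_nat b).-1.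

(** The coefficient vector of one variable in a vector with linear entries. *)
Definition monomial_part (v : bool) (s : svec) : svec :=
  let m := if v then (O, S O) else (S O, O) in
  flatten [seq [seq (t.1, pcst c.2) | c <- t.2 & c.1 == m] | t <- s].
(** The new basis.  If e is the first generator of a Koszul block then
    d2 e = X e1 + Y e1', and d2 e1 is Y times the last generator; for a map R -> R
    one has d2 e = (X + Y) e'. *)
Definition change (m : positive) : svec :=
  let: (b, s) := kdec m in
  let e := svar (seed b) in
  if (block_at b).1 then if s is i3 then e else monomial_part false (d2 (seed b))
  else
    let e1 := monomial_part false (app d2 e) in
    match s with
    | i1 => e
    | i2 => e1
    | i3 => monomial_part true (app d2 e)
    | _ => monomial_part true (app d2 e1) end.
(** Eliminating an invertible matrix completely produces its inverse, as the
    homotopy. *)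
Definition ct3 : contraction := eliminate (memo B_ix change) [:: B_ix].
Definition p2 : positive -> svec := memo ix1 (fun j => app (ct_h ct3) (ct_p ct2 j)).
Definition io2 : positive -> svec := memo B_ix (fun j => app (ct_io ct2) (change j)).
Definition h2 : positive -> svec := memo ix1 (ct_h ct2).

Definition certificate : bool :=
  [&& hom_check W_ix W_phi W_dg W_dg 1 0,
      contraction_check W_ix ix1 W_dg dg1 W_phi W_d p1 io1 h1,
      homotopy_check ix1 B_ix dg1 B_dg d1 p2 io2 h2 B_d,
      hom_check B_ix B_d B_dg B_dg 0 1,
      uniq block_ids & hom_check W_ix W_d W_dg W_dg 0 1].

Lemma certificateP : certificate.
Proof.
(* The cast leaves the evaluation to the final type check, so it is done once. *)
by vm_cast_no_check (erefl true).
Qed.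

Section Whitehead.
Variable k : fieldType.
Hypothesis char0 : [pchar k] =i pred0.

Lemma m_rouquier_closed u :
  [/\ {subset m_ix (m_rouquier u) <= three},
      forall v l, all (fun t => t.1 \in three) (m_r (m_rouquier u) v l)
    & forall l, all (fun t => t.1 \in three) (m_d (m_rouquier u) l)].
Proof. by split=> // [v|] [[l|l|]|[l|l|]|]; case: u; try case: v. Qed.

Lemma m_rouquier_inv_closed u :
  [/\ {subset m_ix (m_rouquier_inv u) <= three},
      forall v l, all (fun t => t.1 \in three) (m_r (m_rouquier_inv u) v l)
    & forall l, all (fun t => t.1 \in three) (m_d (m_rouquier_inv u) l)].
Proof. by split=> // [v|] [[l|l|]|[l|l|]|]; case: u; try case: v. Qed.

Lemma tens_rouquier (C : cplx k) M e co u : is_model (C := C) M e co ->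
  exists e' co', is_model (C := ctensor C (rouquier k (ord_of u))) (mtens M (m_rouquier u)) e' co'.
Proof.
move=> mC; have [h1 h2 h3] := m_rouquier_closed u.
by do 2!eexists; apply: (tens_model char0 mC (rouquier_model char0 u) h1 h2 h3).
Qed.

Lemma tens_rouquier_inv (C : cplx k) M e co u : is_model (C := C) M e co ->
  exists e' co', is_model (C := ctensor C (rouquier_inv k (ord_of u)))
    (mtens M (m_rouquier_inv u)) e' co'.
Proof.
move=> mC; have [h1 h2 h3] := m_rouquier_inv_closed u.
by do 2!eexists; apply: (tens_model char0 mC (rouquier_inv_model char0 u) h1 h2 h3).
Qed.

Lemma whitehead_model : exists e co, is_model (C := whitehead_cplx k) W_model e co.
Proof.
have m0 := rouquier_inv_model char0 false.
have [e1 [c1 m1]] := tens_rouquier_inv false m0.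
have [e2 [c2 m2]] := tens_rouquier true m1.
have [e3 [c3 m3]] := tens_rouquier_inv false m2.
exact: tens_rouquier true m3.
Qed.

(* Unification has to treat the matrices as names: unfolding them would start the
   whole computation outside of the evaluation in [certificateP]. *)
Opaque W_model.

Lemma block_idsE : [seq block_at b | b <- block_ids] = blocks.
Proof. by []. Qed.

Lemma whitehead_dim (P : proj_resolution (regular k)) a i d :
  has_dim (HHH P (whitehead_cplx k) a i d) (\sum_(x <- blocks) block_series x a i d)%N.
Proof.
have /and5P[phi_hom contr homot B_hom /andP[ids_uniq D_hom]] := certificateP.
have [e [co mW]] := whitehead_model.
have B_uniq := homotopy_check_uniq homot.
apply: has_dim_equiv (HHH_resolution_equiv (regular_graded k) P (koszul k) _ a i d) _.
apply: has_dim_equiv (koszul_HHH_equiv (model_graded_actions mW) a i d) _.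
apply: has_dim_equiv (koszul_dbl_equiv char0 mW phi_hom D_hom a i d) _.
apply: has_dim_equiv (contraction_checkP char0 a i d contr) _.
apply: has_dim_equiv (homotopy_checkP char0 a i d homot) _.
rewrite -block_idsE big_map.
exact: (block_homology_dim char0 ids_uniq B_uniq B_hom).
Qed.
End Whitehead.

Theorem theorem1p3 (k : fieldType) (char0 : [pchar k] =i pred0) :
  has_poincare_series (whitehead_cplx k) (fun a i d =>
    \sum_(f <- [:: mono 0 1 (-1); mono 0 2 (-3);
                   mono 1 (-1) (-1); mono 1 0 (-3); geom 1 0 (-3);
                   mono 1 1 (-5); mono 1 2 (-7);
                   mono 2 (-1) (-5); geom 2 0 (-7)]) f a i d)%N.
Proof.
split=> [|P a i d]; first exact: inhabits (koszul k).
have := whitehead_dim char0 P a i d.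
by rewrite -(big_map block_series xpredT (fun f => f a i d)).
Qed.
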